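(* Let $X$ be the almost sure uniform limit of $X_n(t)=\mathrm{LI}(u_1T_nu_2)(\bar\alpha^nt)$ for a consistent sequence $(T_n)$ of uniform spanning trees, where $\bar\alpha=\frac43+\frac1{15}\sqrt{205}$. Then almost surely the Hausdorff dimension of the path $X([0,\infty])$ is \[\dim_H X([0,\infty])=\frac{\log\bar\alpha}{\log2}\approx1.193995.\]
   Context: Let $u_1=(0,0)$, $u_2=(1,0)$, $u_3=(\tfrac12,\tfrac{\sqrt3}2)$ in $\mathbb R^2$ and $\psi_i(x)=\tfrac12(x-u_i)+u_i$ for $i\in\{1,2,3\}$. The Sierpiński gasket $K$ is the unique nonempty compact set with $K=\psi_1(K)\cup\psi_2(K)\cup\psi_3(K)$. The Sierpiński graphs $G_n$ (embedded in the plane, all edges as straight segments lie in $K$) are defined recursively: $G_0$ has vertex set $VG_0=\{u_1,u_2,u_3\}$ and edge set $\{\{u_1,u_2\},\{u_2,u_3\},\{u_3,u_1\}\}$; $G_{n+1}$ has vertex set $\psi_1(VG_n)\cup\psi_2(VG_n)\cup\psi_3(VG_n)$ and edge set $\psi_1(EG_n)\cup\psi_2(EG_n)\cup\psi_3(EG_n)$ (edges mapped vertexwise). For a word $w=w_1\cdots w_k\in\{1,2,3\}^k$ put $\psi_w=\psi_{w_1}\circ\cdots\circ\psi_{w_k}$; then $G_n=\bigcup_{w\in\{1,2,3\}^k}\psi_w(G_{n-k})$. For a spanning subgraph $H\subseteq G_n$ and $w\in\{1,2,3\}^k$, $\pi_w(H)=\psi_w^{-1}(H\cap\psi_w(G_{n-k}))$.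 $\mathcal T_n$ denotes the set of spanning trees of $G_n$; $\mathcal S_n^i$ the set of spanning forests of $G_n$ with two components, one containing $u_i$ and the other containing $\{u_1,u_2,u_3\}\setminus\{u_i\}$; $\mathcal R_n$ the set of spanning forests with three components each containing exactly one of $u_1,u_2,u_3$; $\mathcal Q_n=\mathcal T_n\cup\mathcal S_n^1\cup\mathcal S_n^2\cup\mathcal S_n^3\cup\mathcal R_n$. For $g\in\mathcal Q_1$, $\mathrm{Tr}\,g$ is the spanning subgraph of $G_0$ equal to: the two edges at $u_i$ if $g$ is a spanning tree of $G_1$ in which for both $j\neq i$ the path from $u_i$ to $u_j$ lies in $\psi_i(G_0)\cup\psi_j(G_0)$ (every spanning tree of $G_1$ satisfies this for exactly one $i$); the single edge not containing $u_i$ if $g\in\mathcal S_1^i$; the edgeless graph if $g\in\mathcal R_1$. For $f\in\mathcal Q_{n+1}$, $\mathrm{Tr}\,f=\bigcup_{w\in\{1,2,3\}^n}\psi_w(\mathrm{Tr}\,\pi_w(f))$; Tr maps spanning trees of $G_{n+1}$ to spanning trees of $G_n$. A consistent sequence of uniform spanning trees is a sequence $(T_n)_{n\ge0}$ of random spanning trees defined on a common probability space such that $T_n$ is uniformly distributed on $\mathcal T_n$ and $\mathrm{Tr}\,T_{n+1}=T_n$ for all $n$. For a tree $t$ and vertices $x,y$, $xty$ denotes the unique self-avoiding walk in $t$ from $x$ to $y$. For a walk $x=(x_0,\dots,x_r)$, $\mathrm{LI}(x):[0,\infty]\to K$ is the linear interpolation $\mathrm{LI}(x)(t)=(k+1-t)x_k+(t-k)x_{k+1}$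 for $k\le t<k+1$, $k<r$, and $\mathrm{LI}(x)(t)=x_r$ for $t\ge r$. It is known that $X_n$ converges almost surely uniformly to a continuous curve $X$. *)

(* Defs.v *)
From HB Require Import structures.
From mathcomp Require Import all_boot all_order all_algebra finmap.
From mathcomp Require Import all_classical all_reals all_analysis.
Set Implicit Arguments. Unset Strict Implicit. Unset Printing Implicit Defensive.
Import Order.TTheory GRing.Theory Num.Theory.
Local Open Scope classical_set_scope.
Local Open Scope ring_scope.

Section Sierpinski.
Variable R : realType.

Definition pt := (R * R)%type.
Definition pt0 : pt := (0, 0).

Definition dist (x y : pt) : R :=
  Num.sqrt ((x.1 - y.1) ^+ 2 + (x.2 - y.2) ^+ 2).

Definition i1 : 'I_3 := @Ordinal 3 0 isT.
Definition i2 : 'I_3 := @Ordinal 3 1 isT.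
Definition i3 : 'I_3 := @Ordinal 3 2 isT.

Definition corner (i : 'I_3) : pt :=
  match val i with
  | 0 => (0, 0)
  | 1 => (1, 0)
  | _ => (2^-1, Num.sqrt 3 / 2)
  end.

Definition psi (i : 'I_3) (x : pt) : pt :=
  ((x.1 - (corner i).1) / 2 + (corner i).1,
   (x.2 - (corner i).2) / 2 + (corner i).2).

Definition psiw (w : seq 'I_3) : pt -> pt :=
  foldr (fun i f => psi i \o f) id w.

Definition mkedge (x y : pt) : set pt := [set z | z = x \/ z = y].

Fixpoint Vlist (n : nat) : seq pt :=
  match n with
  | 0 => [:: corner i1; corner i2; corner i3]
  | n'.+1 => flatten [seq [seq psi i x | x <- Vlist n'] | i <- enum 'I_3]
  end.

Fixpoint Elist (n : nat) : seq (pt * pt) :=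
  match n with
  | 0 => [:: (corner i1, corner i2); (corner i2, corner i3);
             (corner i3, corner i1)]
  | n'.+1 => flatten [seq [seq (psi i e.1, psi i e.2) | e <- Elist n']
                     | i <- enum 'I_3]
  end.

(** VG_n and EG_n. A spanning subgraph of G_n is a set of edges
    H `<=` EG n (its vertex set being VG n). *)
Definition VG (n : nat) : set pt := [set x | x \in Vlist n].
Definition EG (n : nat) : set (set pt) :=
  [set e | exists2 p, p \in Elist n & e = mkedge p.1 p.2].

Definition walk (H : set (set pt)) (x y : pt) (p : seq pt) : Prop :=
  [/\ (0 < size p)%N, head pt0 p = x, last pt0 p = y &
      forall i, (i.+1 < size p)%N -> H (mkedge (nth pt0 p i) (nth pt0 p i.+1))].

Definition saw (H : set (set pt)) (x y : pt) (p : seq pt) : Prop :=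
  walk H x y p /\ uniq p.

Definition conn (H : set (set pt)) (x y : pt) : Prop := exists p, walk H x y p.

Definition acyclic (H : set (set pt)) : Prop :=
  ~ exists p : seq pt, [/\ (3 <= size p)%N, uniq p,
      (forall i, (i.+1 < size p)%N -> H (mkedge (nth pt0 p i) (nth pt0 p i.+1)))
    & H (mkedge (last pt0 p) (head pt0 p))].

Definition spanning_tree (n : nat) (H : set (set pt)) : Prop :=
  [/\ H `<=` EG n, acyclic H &
      forall x y, VG n x -> VG n y -> conn H x y].

Definition forestS (n : nat) (i : 'I_3) (H : set (set pt)) : Prop :=
  [/\ H `<=` EG n, acyclic H,
      (forall x, VG n x -> conn H x (corner i) \/
                           exists2 j, j != i & conn H x (corner j)),
      (forall j k, j != i -> k != i -> conn H (corner j) (corner k)) &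
      (forall j, j != i -> ~ conn H (corner i) (corner j))].

Definition forestR (n : nat) (H : set (set pt)) : Prop :=
  [/\ H `<=` EG n, acyclic H,
      (forall x, VG n x -> exists j, conn H x (corner j)) &
      (forall j k, j != k -> ~ conn H (corner j) (corner k))].

Definition EGpsi0 (i : 'I_3) : set (set pt) :=
  [set e | exists2 p, p \in Elist 0 & e = mkedge (psi i p.1) (psi i p.2)].

Definition tree_center (g : set (set pt)) (i : 'I_3) : Prop :=
  forall j, j != i -> exists p, saw g (corner i) (corner j) p /\
    forall m, (m.+1 < size p)%N ->
      (EGpsi0 i `|` EGpsi0 j) (mkedge (nth pt0 p m) (nth pt0 p m.+1)).

(** Tr on Q_1 (a subgraph of G_0):
    - tree with center i  |-> the two edges at u_i,
    - element of S_1^i    |-> the edge not containing u_i,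
    - element of R_1      |-> no edge. *)
Definition Tr1 (g : set (set pt)) : set (set pt) :=
  [set e | (spanning_tree 1 g /\ exists i, tree_center g i /\
              exists2 j, j != i & e = mkedge (corner i) (corner j))
        \/ (exists i, forestS 1 i g /\
              exists j k, [/\ j != i, k != i, j != k &
                              e = mkedge (corner j) (corner k)])].

Definition piw (w : seq 'I_3) (H : set (set pt)) : set (set pt) :=
  [set e | EG 1 e /\ H (psiw w @` e)].

Definition Tr (n : nat) (f : set (set pt)) : set (set pt) :=
  [set e | exists w : seq 'I_3, size w = n /\
             exists2 e', Tr1 (piw w f) e' & e = psiw w @` e'].

Definition consistent_UST (d : measure_display) (Omega : measurableType d)
  (P : probability Omega R) (T : nat -> Omega -> set (set pt)) : Prop :=
  [/\ (forall n w, spanning_tree n (T n w)),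
      (forall n t, spanning_tree n t ->
         measurable [set w | T n w = t] /\
         P [set w | T n w = t] =
           ((#|` fset_set [set t' | spanning_tree n t']|%fset)%:R^-1)%:E) &
      (forall n w, T n w = Tr n (T n.+1 w))].

(** The self-avoiding walk u_1 H u_2 (unique when H is a tree). *)
Definition sawpath (H : set (set pt)) : seq pt :=
  xget [::] [set p | saw H (corner i1) (corner i2) p].

Definition ptcomb (a b : R) (x y : pt) : pt :=
  (a * x.1 + b * y.1, a * x.2 + b * y.2).

Definition LI (x : seq pt) (t : \bar R) : pt :=
  let r := (size x).-1 in
  match t with
  | +oo%E => nth pt0 x r
  | -oo%E => nth pt0 x 0
  | s%:E => if s < 0 then nth pt0 x 0 else
      let k := Num.truncn s in
      if (k < r)%N then
        ptcomb (k.+1%:R - s) (s - k%:R) (nth pt0 x k) (nth pt0 x k.+1)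
      else nth pt0 x r
  end.

Definition alpha : R := 4 / 3 + Num.sqrt 205 / 15.

Definition Xn (Omega : Type) (T : nat -> Omega -> set (set pt)) (n : nat)
  (w : Omega) (t : \bar R) : pt :=
  LI (sawpath (T n w)) ((alpha ^+ n)%:E * t)%E.

Definition unif_conv (f : nat -> \bar R -> pt) (g : \bar R -> pt) : Prop :=
  forall e : R, 0 < e -> exists N, forall n, (N <= n)%N ->
    forall t : \bar R, (0 <= t)%E -> dist (f n t) (g t) < e.

Definition diam (A : set pt) : \bar R :=
  ereal_sup [set z | exists x y, [/\ A x, A y & z = (dist x y)%:E]].

Definition hterm (s : R) (U : set pt) : \bar R :=
  if pselect (U = set0) then 0%E else (diam U `^ s)%E.

Definition hausdorff_delta (s delta : R) (A : set pt) : \bar R :=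
  ereal_inf [set z | exists U : nat -> set pt,
    [/\ A `<=` \bigcup_i U i, (forall i, (diam (U i) <= delta%:E)%E) &
        z = (\sum_(i <oo) hterm s (U i))%E]].

Definition hausdorff_measure (s : R) (A : set pt) : \bar R :=
  ereal_sup [set hausdorff_delta s delta A | delta in [set delta : R | 0 < delta]].

Definition hausdorff_dim (A : set pt) : \bar R :=
  ereal_inf [set s%:E | s in [set s : R | 0 <= s /\ hausdorff_measure s A = 0%E]].

End Sierpinski.

(* Main.v *)
Require Import Defs.
From HB Require Import structures.
From mathcomp Require Import all_boot all_order all_algebra finmap.
From mathcomp Require Import all_classical all_reals all_analysis.
From mathcomp Require Import ring lra zify.
Set Implicit Arguments. Unset Strict Implicit. Unset Printing Implicit Defensive.
Import Order.TTheory GRing.Theory Num.Theory.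

(** Inside a level-n cell a spanning tree of G_n has one or two edges or none, and the
    trace map replaces the part of a tree of G_(n+1) in that cell by the subgraph of G_0
    with the same connections between the corners.  Such a part may be exchanged for any
    other one with the same trace, so given T_n the parts of T_(n+1) in the cells are
    independent and uniform.  Hence the cells crossed by the path from u_1 to u_2 form a
    Galton-Watson process with three types (edges in the cell, path edges in the cell);
    its mean matrix has the eigenvalue alpha, with a positive right eigenvector, and
    every crossed cell has at least two crossed children.

    Let Z_n be the number of crossed cells weighted by the eigenvector, and Z_n(u) the
    contribution of the subcells of u.  Then alpha^-n Z_n is a martingale bounded in L^2.
    As E Z_n <= 10 alpha^n and the curve lies near the crossed cells, the dimension is at
    most log alpha / log 2.  Conversely, for 2^s < alpha the energies
    sum_(k <= n) 2^(ks) sum_(|u| = k) (alpha^-n Z_n(u))^2 are bounded in mean, and by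
    Chebyshev's inequality alpha^-n Z_n stays away from 0 with high probability.  A cover
    of the curve with a small s-dimensional sum would, by compactness and Cauchy-Schwarz,
    contradict these two facts for a large n. *)

(** * Subgraphs of G_1 *)

(** That the trace maps trees onto trees and preserves the uniform law is not obtained by
    combinatorics: under [consistent_UST] every tree has positive probability, so it is a value of
    [T n], and consistency transfers these facts ([trb_tree], [trb_surj], [trb_Ex]). What has to be
    computed concerns a single cell. There a part is a mask of 9 edges, and the surrounding tree
    enters only through the pairs of corners that it connects, so gluing, mean matrix and number of
    crossed children are settled by exhaustive evaluation. Expectations are finite sums over the
    type [gcode n] of subgraphs of G_n, and conditional independence is used only in the form
    [dev_mean0]: the deviation of one cell is orthogonal to everything unaffected by an exchange in
    that cell. No limit of the martingale and no measure on the curve is constructed. The estimates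
    hold at a finite level n, uniformly in n, and events of probability at least 1 - 1/(j+1) for all
    large n are turned into events occurring for infinitely many n ([ae_infinitely_often]), which is
    what both bounds on the dimension use. *)

(* The edge with index k of G_0 is the one opposite to the corner k. *)
Definition ends (k : nat) : nat * nat :=
  match k with 0 => (1, 2) | 1 => (2, 0) | _ => (0, 1) end.

(* The vertices of G_1 are numbered 0, 1, 2 (corners) and 3, 4, 5 (midpoints, 3 + k being
   opposite to the corner k), so that psi_i maps the corner j to [vtx i j].  The edge
   [3 * i + k] of G_1 is the image under psi_i of the edge k of G_0. *)
Definition vtx (i j : nat) : nat := if i == j then i else 6 - i - j.

Definition edge1 (i k : nat) : nat * nat := (vtx i (ends k).1, vtx i (ends k).2).

Definition edges0 : seq (nat * nat) := [seq ends k | k <- iota 0 3].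
Definition edges1 : seq (nat * nat) :=
  [seq edge1 i k | i <- iota 0 3, k <- iota 0 3].

(* Component labels of the vertices 0, .., 5, updated edge by edge. *)
Definition labs (L : seq (nat * nat)) : seq nat :=
  foldr (fun ab s => let la := nth 0 s ab.1 in let lb := nth 0 s ab.2 in
           [seq if x == la then lb else x | x <- s]) (iota 0 6) L.

Definition reach (L : seq (nat * nat)) (a b : nat) : bool :=
  let s := labs L in nth 0 s a == nth 0 s b.

Definition Lo (o : seq bool) := mask o edges0.
Definition Lg (g : seq bool) := mask g edges1.
Definition del (g : seq bool) (e : nat) := set_nth false g e false.

Definition bridges (g : seq bool) :=
  all (fun e => nth false g e ==>
    let ab := nth (0, 0) edges1 e in ~~ reach (Lg (del g e)) ab.1 ab.2) (iota 0 9).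

Definition rooted (g : seq bool) :=
  let s := labs (Lg g) in
  all (fun x => has (fun a => nth 0 s x == nth 0 s a) (iota 0 3)) (iota 0 6).

(** The bit form of Q_1: an acyclic graph each of whose components contains a corner. The number of
    components, 1, 2 or 3, then distinguishes trees, S_1^i and R_1. *)
Definition Q1b (g : seq bool) := bridges g && rooted g.

Definition allc (g : seq bool) := reach (Lg g) 0 1 && reach (Lg g) 1 2.

Definition two_cells (g : seq bool) (i j : nat) : seq bool :=
  [seq nth false g e && ((e %/ 3 == i) || (e %/ 3 == j)) | e <- iota 0 9].

Definition centerb (g : seq bool) (i : nat) :=
  all (fun j => (j == i) || reach (Lg (two_cells g i j)) i j) (iota 0 3).

Definition sep2 (g : seq bool) (k : nat) :=
  reach (Lg g) (ends k).1 (ends k).2 && ~~ reach (Lg g) k (ends k).1.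

(** The two edges of G_0 at u_i are those with index [k != i], and for [g] in Q_1 the test
    [sep2 g k] is membership in S_1^k. *)
Definition tr1 (g : seq bool) : seq bool :=
  [seq (allc g && has (fun i => (i != k) && centerb g i) (iota 0 3)) || sep2 g k
  | k <- iota 0 3].

Fixpoint bitseqs n : seq (seq bool) :=
  if n is n'.+1 then [seq b :: s | b <- [:: true; false], s <- bitseqs n'] else [:: [::]].

Lemma mem_bitseqs n s : (s \in bitseqs n) = (size s == n).
Proof.
elim: n s => [|n IH] [|b s] //=.
  rewrite mem_cat cats0; apply/negbTE; rewrite negb_or.
  by apply/andP; split; apply/negP => /mapP[].
rewrite eqSS -IH mem_cat cats0.
apply/orP/idP => [[|]/mapP[s' Hs [_ ->]] //|Hs].
by case: b; [left|right]; apply/mapP; exists s.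
Qed.

Lemma uniq_bitseqs n : uniq (bitseqs n).
Proof.
elim: n => //= n IH; rewrite cats0 cat_uniq !map_inj_uniq ?IH; try by move=> ? ? [].
by rewrite andbT /=; apply/hasPn => x /mapP[s _ ->]; apply/mapP => -[s' _].
Qed.

Definition Q1s := [seq g <- bitseqs 9 | Q1b g].

(* The mask [o] tells which pairs of corners of a cell are connected outside the cell. *)
Definition compat (L : seq (nat * nat)) (o : seq bool) :=
  all (fun k => ~~ (reach L (ends k).1 (ends k).2 && reach (Lo o) (ends k).1 (ends k).2))
      (iota 0 3).

(* The type of a cell: the number of its edges in the tree, and the number of those on the
   path, where [s] and [s'] are the corners connected outside the cell to the two ends of
   the path: an edge is on the path iff its removal disconnects [s] from [s']. *)
Definition ty0 (q o : seq bool) (s s' : nat) : nat * nat :=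
  (count (nth false q) (iota 0 3),
   count (fun k => nth false q k && ~~ reach (Lo (del q k) ++ Lo o) s s') (iota 0 3)).

Definition ty1 (g o : seq bool) (s s' i : nat) : nat * nat :=
  (count (fun k => nth false g (3 * i + k)) (iota 0 3),
   count (fun k => nth false g (3 * i + k) &&
                   ~~ reach (Lg (del g (3 * i + k)) ++ Lo o) s s') (iota 0 3)).

(* Evaluated once, so that the exhaustive checks below do not recompute the trace. *)
Definition tr1_table := Eval vm_compute in [seq (g, tr1 g) | g <- Q1s].
Definition fiber (q : seq bool) := [seq x.1 | x <- tr1_table & x.2 == q].

Lemma tr1_tableE : tr1_table = [seq (g, tr1 g) | g <- Q1s].
Proof. by vm_cast_no_check (erefl tr1_table). Qed.

Lemma filter_graph (A B : eqType) (f : A -> B) (q : B) (s : seq A) :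
  [seq x.1 | x <- [seq (g, f g) | g <- s] & x.2 == q] = [seq g <- s | f g == q].
Proof. by elim: s => //= a s IH; case: ifP => //= _; rewrite IH. Qed.

Lemma fiberE q : fiber q = [seq g <- bitseqs 9 | Q1b g && (tr1 g == q)].
Proof.
rewrite /fiber tr1_tableE filter_graph /Q1s -filter_predI.
by apply: eq_filter => g; rewrite /= andbC.
Qed.

Definition types (q o : seq bool) (s s' : nat) :=
  [seq ty1 g o s s' i | g <- fiber q, i <- iota 0 3].

(** The local situation of a cell that the path needs: part and surroundings join no pair of corners
    twice, and [s] is joined to [s'] only with the help of the part. *)
Definition crossing (q o : seq bool) (s s' : nat) :=
  [&& compat (Lo q) o, reach (Lo q ++ Lo o) s s' & ~~ reach (Lo o) s s'].

(* For each type, the size of the fiber and the total number of children of each type. *)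
Definition row_ok (q o : seq bool) (s s' : nat) :=
  let t := types q o s s' in
  let c := (size (fiber q), count_mem (1, 1) t, count_mem (2, 1) t, count_mem (2, 2) t) in
  (ty0 q o s s', c) \in [:: ((1, 1), (30, 30, 24, 12)); ((2, 1), (18, 9, 18, 9));
                            ((2, 2), (18, 18, 24, 12))].

(** Two crossed children per crossed cell give at least 2^n crossed cells at level n, the
    deterministic bound behind the Chebyshev estimate. *)
Definition types_ok (q o : seq bool) (s s' : nat) :=
  all (fun g => let t := [seq ty1 g o s s' i | i <- iota 0 3] in
     (2 <= count (fun x => x.2 != 0) t) &&
     all (fun x => (x.2 == 0) || (x \in [:: (1, 1); (2, 1); (2, 2)])) t) (fiber q).

(** [bitseqs] starts with the all-true mask, so [behead] discards the triangle, which is never a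
    trace. At most 7 * 8 * 9 configurations remain. *)
Definition all_crossings (P : seq bool -> seq bool -> nat -> nat -> bool) :=
  all (fun q => all (fun o => all (fun s => all (fun s' =>
    crossing q o s s' ==> P q o s s') (iota 0 3)) (iota 0 3)) (bitseqs 3))
  (behead (bitseqs 3)).

Lemma all_crossingsP P : all_crossings P ->
  forall q o s s', size q = 3 -> q != nseq 3 true -> size o = 3 -> s < 3 -> s' < 3 ->
  crossing q o s s' -> P q o s s'.
Proof.
rewrite /all_crossings; set b3 := bitseqs 3 => H q o s s' Hq Hqt Ho Hs Hs' Hc.
have Hin : q \in behead (bitseqs 3).
  have : q \in bitseqs 3 by rewrite mem_bitseqs Hq.
  by rewrite /b3 [bitseqs 3]/= inE (negbTE Hqt).
move/allP: H => /(_ q Hin) /allP /(_ o); rewrite mem_bitseqs Ho => /(_ isT) /allP /(_ s).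
by rewrite mem_iota => /(_ Hs) /allP /(_ s'); rewrite mem_iota => /(_ Hs') /implyP/(_ Hc).
Qed.

Lemma rows_ok : all_crossings row_ok.
Proof. by vm_cast_no_check (erefl true). Qed.

Lemma all_types_ok : all_crossings types_ok.
Proof. by vm_cast_no_check (erefl true). Qed.
(** Compatibility looks only at pairs of corners; the check shows that it keeps every edge of the
    part a bridge after the outside connections are added. This is the acyclicity half of exchanging
    parts. *)
Definition glue_ok g := all (fun o => compat (Lg g) o ==>
    all (fun e => nth false g e ==> let ab := nth (0, 0) edges1 e in
      ~~ reach (Lg (del g e) ++ Lo o) ab.1 ab.2) (iota 0 9)) (bitseqs 3).
Lemma all_glue_ok : all glue_ok [seq x.1 | x <- tr1_table].
Proof. by vm_cast_no_check (erefl true). Qed.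

(** Three facts about a part and its trace: they connect the same corners; if two corners are
    connected, some edge has one end still attached to each of them after its removal (the source of
    the cycle in [tree_compat]); the trace is not a triangle. *)
Definition pattern_ok (x : seq bool * seq bool) := all (fun k =>
   (reach (Lg x.1) (ends k).1 (ends k).2 == reach (Lo x.2) (ends k).1 (ends k).2) &&
   (reach (Lg x.1) (ends k).1 (ends k).2 ==>
      has (fun e => nth false x.1 e && let ab := nth (0, 0) edges1 e in
        let L := Lg (del x.1 e) in
        (reach L (ends k).1 ab.1 && reach L (ends k).2 ab.2) ||
        (reach L (ends k).1 ab.2 && reach L (ends k).2 ab.1)) (iota 0 9))) (iota 0 3)
   && (x.2 != nseq 3 true).
Lemma all_pattern_ok : all pattern_ok tr1_table.
Proof. by vm_cast_no_check (erefl true). Qed.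

Local Open Scope classical_set_scope.
Local Open Scope ring_scope.

(** * Connectivity and gluing *)

Section Connectivity.
Variable R : realType.
Implicit Types (H K : set (set (pt R))) (x y z : pt R).

(** Connectivity in a form suited to induction along walks; [connE] identifies it with [conn]. *)
Inductive cn H x : pt R -> Prop :=
| cn0 : cn H x x
| cnS y z : cn H x y -> H (mkedge y z) -> cn H x z.

Definition touch H x := exists y, H (mkedge x y).

Lemma mkedgeC x y : mkedge x y = mkedge y x.
Proof. by apply/seteqP; split=> z [->|->]; [right|left|right|left]. Qed.

Lemma mkedge_eq x y a b : mkedge x y = mkedge a b ->
  (x = a /\ y = b) \/ (x = b /\ y = a).
Proof.
move=> E.
have Hx : mkedge a b x by rewrite -E; left.
have Hy : mkedge a b y by rewrite -E; right.
have Ha : mkedge x y a by rewrite E; left.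
have Hb : mkedge x y b by rewrite E; right.
case: Hx => E1; case: Hy => E2; [|by left|by right|]; move: Ha Hb; rewrite E1 E2.
  by move=> _ []<-; left.
by move=> []<- _; left.
Qed.

Lemma cn1 H x y : H (mkedge x y) -> cn H x y.
Proof. by move=> h; apply: cnS h; apply: cn0. Qed.

Lemma cn_trans H x y z : cn H x y -> cn H y z -> cn H x z.
Proof. by move=> Hxy; elim=> // u v _ IH Huv; apply: cnS Huv. Qed.

Lemma cn_sym H x y : cn H x y -> cn H y x.
Proof.
elim=> [|u v _ IH Huv]; first exact: cn0.
by apply: cn_trans IH; apply: cn1; rewrite mkedgeC.
Qed.

Lemma cn_mono H K x y : (forall u v, H (mkedge u v) -> cn K u v) -> cn H x y -> cn K x y.
Proof. by move=> HK; elim=> [|u v _ IH /HK]; [exact: cn0|exact: cn_trans]. Qed.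

Lemma cn_sub H K x y : H `<=` K -> cn H x y -> cn K x y.
Proof. by move=> HK; apply: cn_mono => u v /HK; apply: cn1. Qed.

Lemma cn_touchl H x y : cn H x y -> x = y \/ touch H x.
Proof.
elim=> [|u v _ [->|?] Huv]; [by left|right; by exists v|by right].
Qed.

Lemma cn_touchr H x y : cn H x y -> x = y \/ touch H y.
Proof. by move/cn_sym/cn_touchl => [->|]; [left|right]. Qed.

(* Every excursion between two points of S stays in one piece H i. *)
Lemma cn_glue (I : Type) (D : I -> Prop) (H : I -> set (set (pt R))) K (S : set (pt R)) x y :
  (forall i j z, D i -> D j -> i <> j -> touch (H i) z -> touch (H j) z -> S z) ->
  (forall i s s', D i -> S s -> S s' -> cn (H i) s s' -> cn K s s') ->
  S x -> S y ->
  cn [set e | exists2 i, D i & H i e] x y -> cn K x y.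
Proof.
move=> Hsep HK Sx Sy Hxy.
suff [s [Ss Hs [<-//|[i Di Hi]]]] : exists s, [/\ S s, cn K x s &
    s = y \/ exists2 i, D i & cn (H i) s y].
  exact: cn_trans (HK _ _ _ Di Ss Sy Hi).
elim: Hxy {Sy} => [|u v _ [s [Ss Hs Hsu]] [i Di Huv]].
  by exists x; split=> //; [exact: cn0|left].
case: Hsu => [Esu|[j Dj Hj]].
  by subst u; exists s; split=> //; right; exists i => //; apply: cn1.
have [Eij|Nij] := pselect (i = j).
  by subst j; exists s; split=> //; right; exists i => //; apply: cnS Huv.
have Su : S u.
  case: (cn_touchr Hj) => [<-//|Hu].
  by apply: (Hsep j i u) => //; [exact: nesym|exists v].
exists u; split=> //; first exact: cn_trans (HK _ _ _ Dj Ss Su Hj).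
by right; exists i => //; apply: cn1.
Qed.

Definition LG (p : nat -> pt R) (L : seq (nat * nat)) : set (set (pt R)) :=
  [set e | exists2 ab, ab \in L & e = mkedge (p ab.1) (p ab.2)].

Definition wf6 (L : seq (nat * nat)) := all (fun ab => (ab.1 < 6)%N && (ab.2 < 6)%N) L.

Lemma labs_size L : size (labs L) = 6.
Proof. by elim: L => //= ab L IH; rewrite size_map. Qed.

Lemma labs_mem L ab : wf6 L -> ab \in L -> reach L ab.1 ab.2.
Proof.
elim: L => //= cd L IH /andP[/andP[c6 d6] wL].
rewrite inE => /orP[/eqP->|Hab].
  rewrite /reach /= !(nth_map 0%N) ?labs_size // eqxx.
  by case: ifP => // _; rewrite eqxx.
have /andP[a6 b6] := allP wL _ Hab.
move/eqP: (IH wL Hab) => E.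
by rewrite /reach /= !(nth_map 0%N) ?labs_size // E.
Qed.

Lemma reach_cn p L i j : wf6 L -> (i < 6)%N -> (j < 6)%N -> reach L i j -> cn (LG p L) (p i) (p j).
Proof.
elim: L i j => [|cd L IH] i j.
  move=> _ i6 j6; rewrite /reach /= => /eqP.
  by do 6 (destruct i as [|i]; [do 6 (destruct j as [|j]; [by move=> //= _; apply: cn0|]); by []|]).
move=> /= /andP[/andP[c6 d6] wL] i6 j6.
rewrite /reach /= !(nth_map 0%N) ?labs_size //.
have up x y : cn (LG p L) x y -> cn (LG p (cd :: L)) x y.
  by apply: cn_sub => e [ab Hab ->]; exists ab => //; rewrite inE Hab orbT.
have Hcd : cn (LG p (cd :: L)) (p cd.1) (p cd.2).
  by apply: cn1; exists cd => //; rewrite inE eqxx.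
have R2 a b : (a < 6)%N -> (b < 6)%N -> (nth 0%N (labs L) a == nth 0%N (labs L) b) ->
    cn (LG p (cd :: L)) (p a) (p b) by move=> *; apply/up/IH.
case: ifP => [Hi|_]; case: ifP => [Hj|_].
- by move=> _; apply: (@cn_trans _ _ (p cd.1)); apply: R2; rewrite // eq_sym.
- move=> Hd; apply: (@cn_trans _ _ (p cd.1)); first exact: R2.
  by apply: cn_trans Hcd _; apply: R2.
- move=> Hd; apply: (@cn_trans _ _ (p cd.2)); first exact: R2.
  by apply: (cn_trans (cn_sym Hcd)); apply: R2; rewrite // eq_sym.
- exact: R2.
Qed.

Lemma cn_reach p L i y : {in gtn 6 &, injective p} -> wf6 L -> (i < 6)%N ->
  cn (LG p L) (p i) y -> exists2 j, (j < 6)%N & y = p j /\ reach L i j.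
Proof.
move=> pinj wL i6; elim=> [|u v _ [j j6 [-> Hij]] [ab Hab /mkedge_eq E]].
  by exists i => //; split => //; apply: eqxx.
have /andP[a6 b6] := allP wL _ Hab; have Rab := labs_mem wL Hab.
case: E => -[/pinj E ->].
- by exists ab.2 => //; split=> //; move: Rab; rewrite -E // /reach => /eqP <-.
- by exists ab.1 => //; split=> //; move: Rab; rewrite -E // /reach => /eqP ->.
Qed.

(** The computed labels decide connectivity in an embedded copy; injectivity keeps distinct indices
    from becoming the same point of the plane. *)
Lemma cn_reachE p L i j : {in gtn 6 &, injective p} -> wf6 L -> (i < 6)%N -> (j < 6)%N ->
  cn (LG p L) (p i) (p j) <-> reach L i j.
Proof.
move=> pinj wL i6 j6; split; last exact: reach_cn.
by case/(cn_reach pinj wL i6) => k k6 [/pinj -> //].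
Qed.

Lemma LG_cat p L L' : LG p (L ++ L') = LG p L `|` LG p L'.
Proof.
apply/seteqP; split=> [e [ab]|e [] [ab Hab ->]].
- by rewrite mem_cat => /orP[] ? ->; [left|right]; exists ab.
- by exists ab => //; rewrite mem_cat Hab.
- by exists ab => //; rewrite mem_cat Hab orbT.
Qed.

End Connectivity.

(** * Barycentric coordinates *)

Section Plane.
Variable R : realType.
Implicit Types (x y z : pt R) (v : seq 'I_3).

Definition bary x (k : nat) : R :=
  match k with
  | 0 => 1 - x.1 - x.2 / Num.sqrt 3
  | 1 => x.1 - x.2 / Num.sqrt 3
  | _ => 2 * x.2 / Num.sqrt 3
  end.

Definition Tri : set (pt R) := [set x | forall k, (k < 3)%N -> 0 <= bary x k].

Lemma sqrt3_gt0 : 0 < Num.sqrt 3 :> R. Proof. by rewrite sqrtr_gt0 ltr0n. Qed.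
Lemma sqrt3_neq0 : Num.sqrt 3 != 0 :> R. Proof. by rewrite gt_eqF // sqrt3_gt0. Qed.

Lemma bary_sum x : bary x 0 + bary x 1 + bary x 2 = 1.
Proof. by rewrite /bary; field; exact: sqrt3_neq0. Qed.

Lemma bary_corner (i : 'I_3) k : (k < 3)%N -> bary (corner R i) k = (k == i)%:R.
Proof.
have := sqrt3_neq0 => s0.
by case: i => [[|[|[|i]]] Hi] //; case: k => [|[|[|k]]] //= _; rewrite /bary /corner /=; field.
Qed.

Lemma bary_psi i x k : (k < 3)%N -> bary (psi i x) k = bary x k / 2 + (k == i)%:R / 2.
Proof.
have := sqrt3_neq0 => s0.
by case: i => [[|[|[|i]]] Hi] //; case: k => [|[|[|k]]] //= _; rewrite /bary /psi /corner /=; field.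
Qed.

Lemma bary_inj x y : (forall k, (k < 3)%N -> bary x k = bary y k) -> x = y.
Proof.
move=> H; have H1 := H 1%N isT; have H2 := H 2%N isT.
have s0 := sqrt3_neq0.
case: x y H1 H2 {H} => [x1 x2] [y1 y2]; rewrite /bary /= => H1 H2.
have E2 : x2 = y2.
  have E (z : R) : z = (2 * z / Num.sqrt 3) * (Num.sqrt 3 / 2) :> R by field.
  by rewrite (E x2) H2 -E.
by move: H1; rewrite E2 => /addIr->.
Qed.

Lemma psi_inj i : injective (@psi R i).
Proof.
move=> x y E; apply: bary_inj => k k3.
have := bary_psi i x k3; rewrite E (bary_psi i y k3) => ?; lra.
Qed.

Lemma psiw_inj v : injective (@psiw R v).
Proof. by elim: v => // i v IH x y /psi_inj/IH. Qed.

Lemma psiw_cat u v x : psiw (u ++ v) x = psiw u (psiw v x).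
Proof. by elim: u => //= i u ->. Qed.

Lemma psiw_rcons v i x : psiw (rcons v i) x = psiw v (psi i x).
Proof. by rewrite -cats1 psiw_cat. Qed.

Lemma Tri_psi i x : Tri x -> Tri (psi i x).
Proof.
move=> Hx k k3; rewrite bary_psi //.
by apply: addr_ge0; apply: divr_ge0 => //; exact: Hx.
Qed.

Lemma Tri_psiw v x : Tri x -> Tri (psiw v x).
Proof. by move=> Hx; elim: v => //= i v; exact: Tri_psi. Qed.

Lemma Tri_corner i : Tri (corner R i).
Proof. by move=> k k3; rewrite bary_corner. Qed.

Lemma bary1_corner x (i : 'I_3) : Tri x -> 1 <= bary x i -> x = corner R i.
Proof.
move=> Hx Hi; apply: bary_inj => k k3; rewrite bary_corner //.
have := bary_sum x; have := (Hx 0%N isT, Hx 1%N isT, Hx 2%N isT) => -[[]].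
by move: Hi; case: i => [[|[|[|i]]] Hi] //=; case: k k3 => [|[|[|k]]] //= *; lra.
Qed.

Lemma psi_corner i x j : Tri x -> psi i x = corner R j -> x = corner R j.
Proof.
move=> Hx E; apply: bary1_corner => //.
have := bary_psi i x (ltn_ord j); rewrite E bary_corner // eqxx.
by case: (_ == _) => /= ?; lra.
Qed.

Lemma psiw_corner v x j : Tri x -> psiw v x = corner R j -> x = corner R j.
Proof.
move=> Hx; elim: v => //= i v IH E; apply: IH.
exact: psi_corner (Tri_psiw v Hx) E.
Qed.

(** On the triangle, coordinate [j] is at most 1/2 after psi_i and at least 1/2 after psi_j, so at a
    common point [x] has coordinate [j] equal to 1. *)
Lemma psi_overlap i j x y : i != j -> Tri x -> Tri y -> psi i x = psi j y ->
  x = corner R j /\ y = corner R i.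
Proof.
move=> Nij.
suff H i' j' x' y' : i' != j' -> Tri x' -> Tri y' -> psi i' x' = psi j' y' -> x' = corner R j'.
  by move=> Hx Hy E; split; [exact: (H i j x y)|apply: (H j i y x) => //; rewrite eq_sym].
move=> N Hx Hy E; apply: bary1_corner => //.
have := bary_psi i' x' (ltn_ord j'); rewrite E bary_psi // eqxx.
have /negbTE-> : val j' != val i' by rewrite eq_sym.
have := Hy j' (ltn_ord j').
by move=> /= *; lra.
Qed.

(** Cells of one level share at most one point, a corner of both: [psi_overlap] applies at the first
    differing letter, and a point of the triangle that psi_w sends to a corner of the triangle is
    that corner. *)
Lemma psiw_sep v v' : size v = size v' -> v <> v' -> exists j j' : 'I_3,
  forall x y, Tri x -> Tri y -> psiw v x = psiw v' y -> x = corner R j /\ y = corner R j'.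
Proof.
elim: v v' => [|i v IH] [|i' v'] //= [Es] N.
have [Ei|Ni] := eqVneq i i'.
  subst i'; have [|j [j' H]] := IH v' Es; first by move=> Ev; apply: N; rewrite Ev.
  by exists j, j' => x y Hx Hy /psi_inj; exact: H.
exists i', i => x y Hx Hy /(psi_overlap Ni (Tri_psiw v Hx) (Tri_psiw v' Hy)) [E1 E2].
by split; [apply: psiw_corner E1|apply: psiw_corner E2].
Qed.

Definition P6 (a : nat) : pt R :=
  match a with
  | 0 => corner R i1 | 1 => corner R i2 | 2 => corner R i3
  | 3 => psi i2 (corner R i3) | 4 => psi i1 (corner R i3) | _ => psi i1 (corner R i2)
  end.

Lemma corner_P6 (i : 'I_3) : corner R i = P6 i.
Proof. by case: i => [[|[|[|i]]] Hi]. Qed.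

Lemma Tri_P6 a : Tri (P6 a).
Proof. by case: a => [|[|[|[|[|a]]]]]; try apply: Tri_psi; apply: Tri_corner. Qed.

Lemma bary_P6 a k : (k < 3)%N -> (a < 6)%N ->
  bary (P6 a) k = if (a < 3)%N then (k == a)%:R else (k != (a - 3)%N)%:R / 2.
Proof.
by case: a => [|[|[|[|[|[|a]]]]]] //= k3 _; rewrite ?bary_psi // !bary_corner //;
   case: k k3 => [|[|[|k]]] //= _; field.
Qed.

Lemma P6_inj : {in gtn 6 &, injective P6}.
Proof.
move=> a b a6 b6 E.
have H k (k3 : (k < 3)%N) : (if (a < 3)%N then (k == a)%:R else (k != (a - 3)%N)%:R / 2) =
    (if (b < 3)%N then (k == b)%:R else (k != (b - 3)%N)%:R / 2) :> R.
  by rewrite -!bary_P6 // E.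
have := (H 0%N isT, H 1%N isT, H 2%N isT) => -[[]].
move: a6 b6; rewrite !inE.
case: a {E H} => [|[|[|[|[|[|a]]]]]] //= _; case: b => [|[|[|[|[|[|b]]]]]] //= _ *; exfalso; lra.
Qed.

Lemma psi_P6 (i : 'I_3) j : (j < 3)%N -> psi i (P6 j) = P6 (vtx i j).
Proof.
move=> j3; apply: bary_inj => k k3.
have v6 : (vtx i j < 6)%N.
  by case: i => [[|[|[|i]]] Hi] //; case: j j3 => [|[|[|j]]].
rewrite bary_psi // !bary_P6 //; last exact: ltn_trans j3 _.
rewrite j3; move: v6; case: i => [[|[|[|i]]] Hi] //; case: j j3 => [|[|[|j]]] // _ _;
  by case: k k3 => [|[|[|k]]] //= _; field.
Qed.

Definition pv v (a : nat) : pt R := psiw v (P6 a).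

Lemma pv_inj v : {in gtn 6 &, injective (pv v)}.
Proof. by move=> a b a6 b6 /psiw_inj/P6_inj ->. Qed.

Lemma pv_eq v a b : (a < 6)%N -> (b < 6)%N -> pv v a = pv v b -> a = b.
Proof. by move=> a6 b6; apply: pv_inj. Qed.

Lemma pv_sep v v' a b : size v = size v' -> v <> v' -> (a < 6)%N -> (b < 6)%N ->
  pv v a = pv v' b -> (a < 3)%N /\ (b < 3)%N.
Proof.
move=> Es N a6 b6 E; have [j [j' /(_ _ _ (Tri_P6 a) (Tri_P6 b) E)]] := psiw_sep Es N.
have j6 (k : 'I_3) : (k < 6)%N by apply: ltn_trans (ltn_ord k) _.
case=> Ea Eb; have Ea' : a = j by apply: P6_inj; rewrite ?inE // Ea corner_P6.
have Eb' : b = j' by apply: P6_inj; rewrite ?inE // Eb corner_P6.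
by split; [rewrite Ea'|rewrite Eb'].
Qed.

Lemma pv_rcons v i j : (j < 3)%N -> pv (rcons v i) j = pv v (vtx i j).
Proof. by move=> j3; rewrite /pv psiw_rcons psi_P6. Qed.

Definition Ed v (k : nat) : set (pt R) := mkedge (pv v (ends k).1) (pv v (ends k).2).

Lemma ends_lt k : ((ends k).1 < 3)%N /\ ((ends k).2 < 3)%N.
Proof. by case: k => [|[|k]]. Qed.

(** Different cells share at most one point, whereas an edge has two ends; within one cell the pair
    of ends determines the index. *)
Lemma Ed_inj v v' k k' : size v = size v' -> (k < 3)%N -> (k' < 3)%N ->
  Ed v k = Ed v' k' -> v = v' /\ k = k'.
Proof.
move=> Es k3 k3'; have lt6 a : (a < 3)%N -> (a < 6)%N by move/ltn_trans; apply.
have [a3 b3] := ends_lt k; have [c3 d3] := ends_lt k'.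
have Nab : (ends k).1 <> (ends k).2 by case: k {a3 b3 k3} => [|[|k]].
have [<- /mkedge_eq E|N] := pselect (v = v').
  split=> //.
  have : ((ends k).1 = (ends k').1 /\ (ends k).2 = (ends k').2) \/
         ((ends k).1 = (ends k').2 /\ (ends k).2 = (ends k').1).
    by case: E => -[E1 E2]; [left|right]; split; apply: (@pv_eq v); rewrite ?lt6.
  by move: k3 k3'; case: k {a3 b3 Nab E} => [|[|[|k]]] // _;
     case: k' {c3 d3} => [|[|[|k']]] //= _ [] [].
have [j [j' H]] := psiw_sep Es N.
have uniq a b c d : pv v a = pv v' c -> pv v b = pv v' d -> P6 a = P6 b.
  move=> E1 E2; have [-> _] := H _ _ (Tri_P6 a) (Tri_P6 c) E1.
  by have [-> _] := H _ _ (Tri_P6 b) (Tri_P6 d) E2.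
by case/mkedge_eq => -[E1 E2]; case: Nab; apply: P6_inj; rewrite ?inE ?lt6 //;
   apply: uniq E1 E2.
Qed.

Lemma Ed_rcons v (i : 'I_3) k : Ed (rcons v i) k = mkedge (pv v (edge1 i k).1) (pv v (edge1 i k).2).
Proof. by have [? ?] := ends_lt k; rewrite /Ed !pv_rcons. Qed.

End Plane.

(** * Graphs assembled from cells *)

Section LevelGraphs.
Variable R : realType.
Implicit Types (x y z : pt R) (v : seq 'I_3) (L : seq 'I_3 -> seq (nat * nat)).

(** One graph will be read in two ways: three edges per cell of its own level ([Lo]), or nine edges
    per cell of the next coarser level ([Lg]). *)
Definition gl n L (D : seq 'I_3 -> Prop) : set (set (pt R)) :=
  [set e | exists2 v, size v = n /\ D v & LG (pv R v) (L v) e].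

(* The vertex set of G_n, see [VG_E]. *)
Definition Cn n : set (pt R) :=
  [set z | exists v a, [/\ size v = n, (a < 3)%N & z = pv R v a]].

Lemma touch_LG v (l : seq (nat * nat)) z : wf6 l -> touch (LG (pv R v) l) z ->
  exists2 a, (a < 6)%N & z = pv R v a.
Proof.
move=> wl [y [ab Hab /mkedge_eq E]]; have /andP[a6 b6] := allP wl _ Hab.
by case: E => -[-> _]; [exists ab.1|exists ab.2].
Qed.

Lemma lt3_6 a : (a < 3)%N -> (a < 6)%N. Proof. by move/ltn_trans; apply. Qed.

Lemma Cn_pv n v a : size v = n -> (a < 6)%N -> Cn n (pv R v a) -> (a < 3)%N.
Proof.
move=> Sv a6 [u [c [Su c3 E]]].
have [Euv|N] := pselect (v = u).
  by subst u; rewrite (pv_eq a6 (lt3_6 c3) E).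
by have [] := pv_sep (etrans Sv (esym Su)) N a6 (lt3_6 c3) E.
Qed.

Lemma pv_Cn n v a : size v = n -> (a < 3)%N -> Cn n (pv R v a).
Proof. by move=> Sv a3; exists v, a. Qed.

Lemma gl_sep n L : (forall v, wf6 (L v)) -> forall u v z, size u = n -> size v = n ->
  u <> v -> touch (LG (pv R u) (L u)) z -> touch (LG (pv R v) (L v)) z -> Cn n z.
Proof.
move=> wL u v z Su Sv N /(touch_LG (wL u)) [a a6 ->] /(touch_LG (wL v)) [b b6 E].
have [a3 _] := pv_sep (etrans Su (esym Sv)) N a6 b6 E.
exact: pv_Cn.
Qed.

Lemma LG_Cn n v (l : seq (nat * nat)) s s' : size v = n -> wf6 l -> Cn n s -> Cn n s' ->
  cn (LG (pv R v) l) s s' ->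
  s = s' \/ exists a b, [/\ (a < 3)%N, (b < 3)%N, s = pv R v a, s' = pv R v b & reach l a b].
Proof.
move=> Sv wl Cs Cs' Hc.
have [->|Ts] := cn_touchl Hc; first by left.
have [->|Ts'] := cn_touchr Hc; first by left.
right; have [a a6 Ea] := touch_LG wl Ts; have [b b6 Eb] := touch_LG wl Ts'.
subst s s'; exists a, b; split=> //; [exact: Cn_pv Cs|exact: Cn_pv Cs'|].
by apply/(cn_reachE (@pv_inj R v)).
Qed.

(** A walk between vertices of level n enters and leaves each cell at corners, so only the
    connections between corners inside each cell matter. Hence connectivity survives the passage to
    the trace. *)
Lemma gl_corner_cn n L D K x y : (forall v, wf6 (L v)) ->
  (forall v a b, size v = n -> D v -> (a < 3)%N -> (b < 3)%N -> reach (L v) a b ->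
     cn K (pv R v a) (pv R v b)) ->
  Cn n x -> Cn n y -> cn (gl n L D) x y -> cn K x y.
Proof.
move=> wL HK Cx Cy; apply: (@cn_glue _ _ _ _ _ (Cn n)) => //.
  by move=> u v z [Su _] [Sv _]; apply: gl_sep.
move=> v s s' [Sv Dv] Cs Cs' /(LG_Cn Sv (wL v) Cs Cs') [->|[a [b [a3 b3 -> -> Hr]]]].
  exact: cn0.
exact: HK.
Qed.

Lemma gl_reach_sub n L L' (D : seq 'I_3 -> Prop) x y :
  (forall v, wf6 (L v)) -> (forall v, wf6 (L' v)) ->
  (forall v a b, size v = n -> D v -> (a < 3)%N -> (b < 3)%N ->
     reach (L v) a b -> reach (L' v) a b) ->
  Cn n x -> Cn n y -> cn (gl n L D) x y -> cn (gl n L' D) x y.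
Proof.
move=> wL wL' H Cx Cy; apply: gl_corner_cn => // v a b Sv Dv a3 b3 /(H _ _ _ Sv Dv a3 b3) Hr.
apply: (@cn_sub _ (LG (pv R v) (L' v))); first by move=> e; exists v.
by apply/(cn_reachE (@pv_inj R v)) => //; apply: lt3_6.
Qed.

Definition out n L v := gl n L (fun u => u <> v).

Lemma gl_split n L v : size v = n -> gl n L (fun=> True) = LG (pv R v) (L v) `|` out n L v.
Proof.
move=> Sv; apply/seteqP; split=> [e [u [Su _] He]|e [He|[u [Su N] He]]].
- by have [<-|N] := pselect (u = v); [left|right; exists u].
- by exists v.
- by exists u.
Qed.

Lemma touch_out n L v a : (forall v, wf6 (L v)) -> size v = n -> (a < 6)%N ->
  touch (out n L v) (pv R v a) -> (a < 3)%N.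
Proof.
move=> wL Sv a6 [y [u [Su N] He]].
have [b b6 E] : exists2 b, (b < 6)%N & pv R v a = pv R u b.
  by apply: (touch_LG (wL u)); exists y.
by have [] := pv_sep (etrans Sv (esym Su)) (nesym N) a6 b6 E.
Qed.

(* The corner connections of the cell v through the rest of the graph; by [local_cn] they
   are all that matters for connectivity between vertices of the cell. *)
Definition obits n L v : seq bool :=
  [seq `[< cn (out n L v) (pv R v (ends k).1) (pv R v (ends k).2) >] | k <- iota 0 3].

Lemma wf6_mask (m : seq bool) (l : seq (nat * nat)) : wf6 l -> wf6 (mask m l).
Proof. by move=> /allP H; apply/allP => x /mem_mask; apply: H. Qed.
Lemma wf6_Lo o : wf6 (Lo o). Proof. exact: wf6_mask. Qed.
Lemma wf6_Lg g : wf6 (Lg g). Proof. exact: wf6_mask. Qed.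
Lemma wf6_cat l l' : wf6 (l ++ l') = wf6 l && wf6 l'. Proof. exact: all_cat. Qed.

Lemma Lo_mem (o : seq bool) ab : size o = 3%N -> ab \in Lo o ->
  exists2 k, (k < 3)%N & nth false o k /\ ab = ends k.
Proof.
case: o => [|b0 [|b1 [|b2 [|]]]] //= _.
by case: b0; case: b1; case: b2; rewrite /Lo /= ?inE => H //; move: H;
  rewrite -?(orbA _ _ (_ == _)); do ?case/orP; move=> /eqP->; by [exists 0%N|exists 1%N|exists 2%N].
Qed.

Lemma Lo_nth (o : seq bool) k : (k < 3)%N -> nth false o k -> ends k \in Lo o.
Proof.
case: o => [|[] [|[] [|[] o]]]; case: k => [|[|[|k]]] //= _ _;
  by rewrite /Lo /= ?mask0 ?inE ?eqxx ?orbT.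
Qed.

Lemma obits_Lo_cn n L v a b : size v = n -> (a < 6)%N -> (b < 6)%N ->
  reach (Lo (obits n L v)) a b -> cn (out n L v) (pv R v a) (pv R v b).
Proof.
move=> Sv a6 b6 /(reach_cn (pv R v) (wf6_Lo _) a6 b6); apply: cn_mono => s t.
case=> ab /Lo_mem [|k k3 [Hk ->]]; first by rewrite size_map.
move: Hk; rewrite (nth_map 0%N) ?size_iota // nth_iota // add0n => /asboolP Hk.
by case/mkedge_eq => -[-> ->] //; apply: cn_sym.
Qed.

Lemma corner_ends a b : (a < 3)%N -> (b < 3)%N -> a = b \/
  exists2 k, (k < 3)%N & ((a, b) = ends k \/ (b, a) = ends k).
Proof.
case: a => [|[|[|a]]] //; case: b => [|[|[|b]]] // _ _; try (by left); right;
by [exists 0%N; auto|exists 1%N; auto|exists 2%N; auto].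
Qed.

Lemma obits_cn n L v a b : size v = n -> (a < 3)%N -> (b < 3)%N ->
  cn (out n L v) (pv R v a) (pv R v b) <-> reach (Lo (obits n L v)) a b.
Proof.
move=> Sv a3 b3; split; last by apply: obits_Lo_cn => //; apply: lt3_6.
have [->|[k k3 E]] := corner_ends a3 b3; first by rewrite /reach eqxx.
have key : cn (out n L v) (pv R v (ends k).1) (pv R v (ends k).2) ->
    reach (Lo (obits n L v)) (ends k).1 (ends k).2.
  move=> Hc; apply: labs_mem; first exact: wf6_Lo.
  apply: Lo_nth => //.
  by rewrite (nth_map 0%N) ?size_iota // nth_iota // add0n; apply/asboolP.
move=> Hc; case: E => E; move: key; rewrite -E /=; first exact.
by move=> H; rewrite /reach eq_sym; apply: H; apply: cn_sym.
Qed.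

(** Excursions out of the cell leave and return through corners, and [obits] records which corners
    they join; global connectivity thus becomes a finite test. *)
Lemma local_cn n L v (l : seq (nat * nat)) a b : (forall v, wf6 (L v)) -> wf6 l -> size v = n ->
  (a < 6)%N -> (b < 6)%N ->
  cn (LG (pv R v) l `|` out n L v) (pv R v a) (pv R v b) <-> reach (l ++ Lo (obits n L v)) a b.
Proof.
move=> wL wl Sv a6 b6; set o := obits n L v.
have wlo : wf6 (l ++ Lo o) by rewrite wf6_cat wl wf6_Lo.
split=> [|/(reach_cn (pv R v) wlo a6 b6)]; last first.
  apply: cn_mono => s t; rewrite LG_cat => -[He|He]; first by apply: cn1; left.
  apply: (@cn_sub _ (out n L v)); first by move=> e; right.
  have := cn1 He; case: He => ab Hab /mkedge_eq E.
  have /andP[c6 d6] := allP (wf6_Lo o) _ Hab.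
  by case: E => -[-> ->] /(cn_reachE (@pv_inj R v) (wf6_Lo o)) H;
    apply: obits_Lo_cn => //; apply: H.
move=> Hc; apply/(cn_reachE (@pv_inj R v) wlo a6 b6).
pose H (i : bool) := if i then LG (pv R v) l else out n L v.
pose S : set (pt R) := [set z | exists2 c, (c < 6)%N & z = pv R v c].
have {}Hc : cn [set e | exists2 i, True & H i e] (pv R v a) (pv R v b).
  by apply: cn_sub Hc => e [He|He]; [exists true|exists false].
apply: (@cn_glue _ bool (fun=> True) H _ S) Hc => //.
- by move=> [] [] z _ _ // _; [move=> /(touch_LG wl)|move=> _ /(touch_LG wl)].
- move=> [] s s' _ Ss Ss' /= Hc; first by apply: cn_sub Hc; rewrite LG_cat; left.
  have [->|Ts] := cn_touchl Hc; first exact: cn0.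
  have [->|Ts'] := cn_touchr Hc; first exact: cn0.
  case: Ss Ss' Hc Ts Ts' => c c6 -> [d d6 ->] Hc Tc Td.
  have c3 := touch_out wL Sv c6 Tc; have d3 := touch_out wL Sv d6 Td.
  apply: (@cn_sub _ (LG (pv R v) (Lo o))); first by rewrite LG_cat; right.
  by apply/(cn_reachE (@pv_inj R v) (wf6_Lo o) c6 d6); apply/obits_cn.
- by exists a.
- by exists b.
Qed.

(** Follow the walk to its first edge in the cell: that edge starts at a corner, since outside edges
    touch the cell only there. *)
Lemma out_reach n L v (l : seq (nat * nat)) x y : (forall v, wf6 (L v)) -> wf6 l -> size v = n ->
  (forall a, (a < 6)%N -> x = pv R v a -> (a < 3)%N) ->
  cn (LG (pv R v) l `|` out n L v) x y ->
  cn (out n L v) x y \/ exists2 a, (a < 3)%N & cn (out n L v) x (pv R v a).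
Proof.
move=> wL wl Sv Hx; elim=> [|s t _ [Hs|Ha] Hst]; [by left; apply: cn0| |by right].
case: Hst => [Hst|Hst]; last by left; apply: cnS Hst.
have [a a6 Ea] : exists2 a, (a < 6)%N & s = pv R v a by apply: (touch_LG wl); exists t.
right; exists a; last by rewrite -Ea.
have [Exs|Ts] := cn_touchr Hs; first by apply: Hx => //; rewrite Exs.
by apply: (touch_out wL Sv a6); rewrite -Ea.
Qed.

End LevelGraphs.

(** * Spanning trees *)

Lemma mem_maskP (T : eqType) (x0 : T) (m : seq bool) (s : seq T) x :
  reflect (exists2 e, (e < size s)%N & nth false m e /\ x = nth x0 s e) (x \in mask m s).
Proof.
elim: s m => [|y s IH] [|b m] /=.
- by rewrite ?mask0; apply: (iffP idP) => // -[].
- by apply: (iffP idP) => // -[].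
- by apply: (iffP idP) => // -[e _ []]; rewrite nth_nil.
have E : (x \in (if b then y :: mask m s else mask m s)) = (b && (x == y)) || (x \in mask m s).
  by case: b => //; rewrite inE.
rewrite E; apply: (iffP orP) => [[/andP[Hb /eqP->]|/IH[e He [H1 ->]]]|[[|e] He [H1 Ex]]].
- by exists 0%N.
- by exists e.+1.
- by left; move: H1 => /= ->; rewrite Ex eqxx.
- by right; apply/IH; exists e.
Qed.

Section Graphs.
Variable R : realType.
Implicit Types (H K : set (set (pt R))) (x y z : pt R) (e : nat).

(* Acyclicity, in the form that removing an edge disconnects its ends. *)
Definition bridged H := forall x y, H (mkedge x y) -> ~ cn (H `\ mkedge x y) x y.

Definition stepb H : rel (pt R) := [rel u v | `[< H (mkedge u v) >]].

Lemma cn_path H x y : cn H x y -> exists2 p, path (stepb H) x p & last x p = y.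
Proof.
elim=> [|u v _ [p Hp Hl] Huv]; first by exists [::].
exists (rcons p v); last by rewrite last_rcons.
by rewrite rcons_path Hp Hl; apply/asboolP.
Qed.

Lemma path_walk H x p : path (stepb H) x p -> walk H x (last x p) (x :: p).
Proof.
move/(pathP (pt0 R)) => Hp; split=> //= i; rewrite ltnS => Hi.
by have /asboolP := Hp i Hi.
Qed.

Lemma walk_nth_cn H (p : seq (pt R)) :
  (forall i, (i.+1 < size p)%N -> H (mkedge (nth (pt0 R) p i) (nth (pt0 R) p i.+1))) ->
  forall k, (k < size p)%N -> cn H (nth (pt0 R) p 0) (nth (pt0 R) p k).
Proof.
move=> Hp; elim=> [|k IH] Hk; first exact: cn0.
by apply: cnS (IH (ltnW Hk)) (Hp k Hk).
Qed.

Lemma connE H x y : conn H x y <-> cn H x y.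
Proof.
split=> [[p [Hs <- <- Hp]]|/cn_path[p Hp <-]]; last by exists (x :: p); exact: path_walk.
by rewrite -nth0 -nth_last; apply: walk_nth_cn => //; rewrite prednK.
Qed.

Lemma cn_saw H x y : cn H x y -> exists p, saw H x y p.
Proof.
case/cn_path=> p Hp <-; case: (shortenP Hp) => p' Hp' Hu _.
by exists (x :: p'); split=> //; exact: path_walk.
Qed.

Lemma acyclic_bridged H : (forall x, ~ H (mkedge x x)) -> acyclic H <-> bridged H.
Proof.
move=> loopless; split=> [Hac x y Hxy /cn_saw [p [[Hs Hh Hl Hp] Hu]]|Hb [p [Hs Hu Hp Hc]]].
- apply: Hac; exists p; split=> //; last first.
    by rewrite Hh Hl mkedgeC.
    by move=> i /Hp [].
  (* One vertex would make the removed edge a loop; two vertices would use the removed edge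
     itself. *)
  case: p Hs Hh Hl Hp Hu => [|a [|b [|c p]]] //= _ Ea Eb Hp _.
    by case: (loopless a); rewrite {1}Ea Eb.
  by have [_ /= N] := Hp 0%N isT; case: N; rewrite Ea Eb.
- apply: (Hb _ _ Hc); apply: cn_sym.
  rewrite -nth0 -nth_last; apply: walk_nth_cn; last by rewrite prednK // (leq_trans _ Hs).
  move=> i Hi; split; first exact: Hp.
  (* A consecutive pair equal to the closing pair contradicts distinctness, because the cycle has at
     least three vertices. *)
  move=> /mkedge_eq.
  have s0 : (0 < size p)%N by apply: leq_trans Hs.
  have sp : ((size p).-1 < size p)%N by rewrite prednK.
  have inj a b : (a < size p)%N -> (b < size p)%N -> nth (pt0 R) p a = nth (pt0 R) p b -> a = b.
    by move=> Ha Hb' /eqP; rewrite nth_uniq // => /eqP.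
  by case=> -[/inj E1 /inj E2]; have := E1 (ltnW Hi); have := E2 Hi; lia.
Qed.

Lemma VG_E n : VG n = Cn n :> set (pt R).
Proof.
elim: n => [|n IH]; apply/seteqP; split=> x.
- rewrite /VG /= !inE => /or3P[] /eqP->; [exists [::], 0%N|exists [::], 1%N|exists [::], 2%N]; split=> //.
- case=> v [a [/size0nil-> a3 ->]]; rewrite /VG /= !inE.
  by case: a a3 => [|[|[|a]]] // _; rewrite eqxx ?orbT.
- move=> /= /flatten_mapP [i _ /mapP[y Hy ->]].
  have : VG n y by [].
  by rewrite IH => -[v [a [Sv a3 ->]]]; exists (i :: v), a; rewrite /= Sv.
- case=> v [a []]; case: v => // i v [Sv] a3 ->; apply/flatten_mapP; exists i; first by rewrite mem_enum.
  by apply/mapP; exists (pv R v a) => //; have : VG n (pv R v a) by rewrite IH; exists v, a.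
Qed.

Lemma Elist_P n p : p \in Elist R n <-> exists v k,
  [/\ size v = n, (k < 3)%N & p = (pv R v (ends k).1, pv R v (ends k).2)].
Proof.
elim: n p => [|n IH] p; split.
(* The list of edges of G_0 starts with the edge u_1 u_2, opposite to the corner numbered 2; hence
   the order 2, 0, 1. *)
- rewrite /= !inE => /or3P[] /eqP->; [exists [::], 2%N|exists [::], 0%N|exists [::], 1%N]; split=> //.
- case=> v [k [/size0nil-> k3 ->]]; rewrite /= !inE.
  by case: k k3 => [|[|[|k]]] // _; rewrite eqxx ?orbT.
- move=> /= /flatten_mapP [i _ /mapP[y /IH [v [k [Sv k3 ->]]] ->]].
  by exists (i :: v), k; rewrite /= Sv.
- case=> v [k []]; case: v => // i v [Sv] k3 ->; apply/flatten_mapP; exists i; first by rewrite mem_enum.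
  by apply/mapP; exists (pv R v (ends k).1, pv R v (ends k).2) => //; apply/IH; exists v, k.
Qed.

Lemma EG_P n (e : set (pt R)) : EG n e <-> exists v k, [/\ size v = n, (k < 3)%N & e = Ed v k].
Proof.
split=> [[p /Elist_P [v [k [Sv k3 ->]]] ->]|[v [k [Sv k3 ->]]]]; first by exists v, k.
by exists (pv R v (ends k).1, pv R v (ends k).2) => //; apply/Elist_P; exists v, k.
Qed.

Lemma EG_loopless n x : ~ EG n (mkedge x x).
Proof.
case/EG_P => v [k [Sv k3 E]]; have [a3 b3] := ends_lt k.
have N : (ends k).1 <> (ends k).2 by case: k {k3 E a3 b3} => [|[|k]].
by case: N; apply: (@pv_eq R v); rewrite ?(lt3_6 a3) ?(lt3_6 b3) //; case: (mkedge_eq E) => -[<- <-].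
Qed.

Lemma spanning_treeE n H : spanning_tree n H <->
  [/\ H `<=` EG n, bridged H & forall x y, Cn n x -> Cn n y -> cn H x y].
Proof.
rewrite /spanning_tree VG_E; split=> -[H1 H2 H3]; split=> //.
- by apply/acyclic_bridged => // x /H1; exact: EG_loopless.
- by move=> x y Hx Hy; apply/connE/H3.
- by apply/acyclic_bridged => // x /H1; exact: EG_loopless.
- by move=> x y Hx Hy; apply/connE/H3.
Qed.

Definition Eg v (e : nat) : set (pt R) :=
  mkedge (pv R v (nth (0, 0)%N edges1 e).1) (pv R v (nth (0, 0)%N edges1 e).2).

Lemma Eg_rcons v i k : (i < 3)%N -> (k < 3)%N -> Eg v (3 * i + k) = Ed (rcons v (inord i)) k.
Proof.
by case: i => [|[|[|i]]] //; case: k => [|[|[|k]]] // _ _; rewrite Ed_rcons inordK.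
Qed.

Lemma lt9P e : (e < 9)%N -> exists i k, [/\ (i < 3)%N, (k < 3)%N & e = (3 * i + k)%N].
Proof. by exists (e %/ 3)%N, (e %% 3)%N; split; lia. Qed.

Lemma inord3_inj i j : (i < 3)%N -> (j < 3)%N -> inord i = inord j :> 'I_3 -> i = j.
Proof. by move=> i3 j3 /(congr1 val); rewrite /= !inordK. Qed.

Lemma Eg_inj v e e' : (e < 9)%N -> (e' < 9)%N -> Eg v e = Eg v e' -> e = e'.
Proof.
case/lt9P => i [k [i3 k3 ->]] /lt9P [i' [k' [i3' k3' ->]]]; rewrite !Eg_rcons // => /Ed_inj.
rewrite !size_rcons => /(_ erefl k3 k3') [/rcons_inj [] /inord3_inj -> // ->] //.
Qed.

Lemma LG_LgP v g (x : set (pt R)) : LG (pv R v) (Lg g) x <-> exists2 e, (e < 9)%N & nth false g e /\ x = Eg v e.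
Proof.
split=> [[ab /(mem_maskP (0, 0)%N) [e He [Hg ->]] ->]|[e He [Hg ->]]]; first by exists e.
by exists (nth (0, 0)%N edges1 e) => //; apply/(mem_maskP (0, 0)%N); exists e.
Qed.

Lemma LG_LoP v o (x : set (pt R)) : LG (pv R v) (Lo o) x <-> exists2 k, (k < 3)%N & nth false o k /\ x = Ed v k.
Proof.
split=> [[ab /(mem_maskP (0, 0)%N) [e He [Hg ->]] ->]|[e He [Hg ->]]].
  by exists e => //; split=> //; move: He {Hg}; case: e => [|[|[|e]]].
exists (nth (0, 0)%N edges0 e); last by move: He {Hg}; case: e => [|[|[|e]]].
by apply/(mem_maskP (0, 0)%N); exists e.
Qed.

Lemma nth_del g e e' : nth false (del g e) e' = (e' != e) && nth false g e'.
Proof. by rewrite /del nth_set_nth /=; case: eqP. Qed.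

Lemma LG_Lg_del v g e : (e < 9)%N -> LG (pv R v) (Lg g) `\ Eg v e = LG (pv R v) (Lg (del g e)).
Proof.
move=> He; apply/seteqP; split=> x.
- case=> /LG_LgP [e' He' [Hg ->]] N; apply/LG_LgP; exists e' => //; split=> //.
  by rewrite nth_del Hg andbT; apply/eqP => E; apply: N; rewrite /= E.
- case/LG_LgP => e' He' []; rewrite nth_del => /andP[/eqP N Hg] ->; split; first by apply/LG_LgP; exists e'.
  by move=> /(Eg_inj He' He).
Qed.

Lemma LG_Lo_del v o k : (k < 3)%N -> LG (pv R v) (Lo o) `\ Ed v k = LG (pv R v) (Lo (del o k)).
Proof.
move=> He; apply/seteqP; split=> x.
- case=> /LG_LoP [e' He' [Hg ->]] N; apply/LG_LoP; exists e' => //; split=> //.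
  by rewrite nth_del Hg andbT; apply/eqP => E; apply: N; rewrite /= E.
- case/LG_LoP => e' He' []; rewrite nth_del => /andP[/eqP N Hg] ->; split; first by apply/LG_LoP; exists e'.
  by move=> /(Ed_inj erefl He' He) [].
Qed.

Lemma edges1_lt e : ((nth (0, 0) edges1 e).1 < 6)%N /\ ((nth (0, 0) edges1 e).2 < 6)%N.
Proof.
case: (ltnP e 9) => He; last by rewrite nth_default.
by move: He; do 9 (case: e => [|e] //).
Qed.

Lemma bridgesP v g : bridges g <-> bridged (LG (pv R v) (Lg g)).
Proof.
split=> [/allP Hb x y Hxy|Hb].
  have /LG_LgP [e He [Hg Ee]] := Hxy.
  have : e \in iota 0 9 by rewrite mem_iota.
  move/Hb => /implyP/(_ Hg) /negP Hr; rewrite Ee LG_Lg_del // => Hc; apply: Hr.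
  have [a6 b6] := edges1_lt e.
  apply/(cn_reachE (@pv_inj R v) (wf6_Lg _) a6 b6).
  by case: (mkedge_eq Ee) => -[<- <-] //; apply: cn_sym.
apply/allP => e; rewrite mem_iota => He; apply/implyP => Hg; apply/negP => Hr.
have [a6 b6] := edges1_lt e.
apply: (Hb _ _ (_ : LG (pv R v) (Lg g) (Eg v e))); first by apply/LG_LgP; exists e.
rewrite -/(Eg v e) LG_Lg_del //.
exact/(cn_reachE (@pv_inj R v) (wf6_Lg _) a6 b6).
Qed.

Lemma rootedP v g : rooted g <-> forall a, (a < 6)%N -> exists2 c, (c < 3)%N &
  cn (LG (pv R v) (Lg g)) (pv R v a) (pv R v c).
Proof.
split=> [/allP Hr a a6|H].
  have : a \in iota 0 6 by rewrite mem_iota.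
  move/Hr => /hasP [c]; rewrite mem_iota => /andP[_ c3] Hc; exists c => //.
  by apply/(cn_reachE (@pv_inj R v) (wf6_Lg _) a6 (lt3_6 c3)).
apply/allP => a; rewrite mem_iota => /andP[_ a6]; apply/hasP; have [c c3 Hc] := H a a6.
exists c; first by rewrite mem_iota.
by apply/(cn_reachE (@pv_inj R v) (wf6_Lg _) a6 (lt3_6 c3)).
Qed.

End Graphs.

(** * The trace on G_1 *)

Section TraceOne.
Variable R : realType.
Implicit Types (x y z : pt R).

Notation G1 g := (LG (pv R [::]) (Lg g)).

Lemma corner_pv (i : 'I_3) : corner R i = pv R [::] i.
Proof. exact: corner_P6. Qed.

Lemma G1_EG g : G1 g `<=` EG 1.
Proof.
move=> e /LG_LgP [m /lt9P [i [k [i3 k3 ->]]] [_ ->]]; apply/EG_P.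
by exists [:: inord i], k; rewrite Eg_rcons.
Qed.

Lemma G1_cn g a b : (a < 6)%N -> (b < 6)%N -> cn (G1 g) (pv R [::] a) (pv R [::] b) <-> reach (Lg g) a b.
Proof. exact: (cn_reachE (@pv_inj R [::]) (wf6_Lg g)). Qed.

Lemma Ed_corner (i j k : 'I_3) : i != j -> k != i -> k != j ->
  Ed [::] k = mkedge (corner R i) (corner R j).
Proof.
move=> ij ki kj; rewrite !corner_pv.
have : ends k = (val i, val j) \/ ends k = (val j, val i).
  by move: ij ki kj; case: i => [[|[|[|i]]] Hi] //; case: j => [[|[|[|j]]] Hj] //;
     case: k => [[|[|[|k]]] Hk] //; auto.
by rewrite /Ed; case=> -> //=; rewrite mkedgeC.
Qed.

Lemma third (i j : 'I_3) : i != j -> exists2 k : 'I_3, k != i & k != j.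
Proof.
by case: i => [[|[|[|i]]] Hi] //; case: j => [[|[|[|j]]] Hj] // _;
  [exists i3|exists i2|exists i3|exists i1|exists i2|exists i1].
Qed.

Lemma two_cellsE g (i j : 'I_3) :
  G1 g `&` (EGpsi0 i `|` EGpsi0 j) = G1 (two_cells g i j).
Proof.
have EGpsi (i0 : 'I_3) (e : set (pt R)) : EGpsi0 i0 e <-> exists2 k, (k < 3)%N & e = Eg [::] (3 * i0 + k).
  split=> [[p /Elist_P [v [k [/size0nil -> k3 ->]]] ->]|[k k3 ->]]; rewrite /=.
    by exists k => //; rewrite Eg_rcons // inord_val /Ed !pv_rcons //; have [? ?] := ends_lt k; rewrite -?pv_rcons.
  exists (pv R [::] (ends k).1, pv R [::] (ends k).2); first by apply/Elist_P; exists [::], k.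
  by rewrite Eg_rcons // inord_val.
have n9 e : (e < 9)%N -> nth false (two_cells g i j) e =
    nth false g e && ((e %/ 3 == i)%N || (e %/ 3 == j)%N).
  by move=> He; rewrite (nth_map 0%N) ?size_iota // nth_iota.
apply/seteqP; split=> e.
- case=> /LG_LgP [m m9 [Hm Em]] Hij; apply/LG_LgP; exists m => //; split=> //.
  rewrite n9 // Hm /=; case: Hij => /EGpsi [k k3]; rewrite Em.
    have i3' : (3 * i + k < 9)%N by have := ltn_ord i; lia.
    by move=> /(Eg_inj m9 i3') ->; apply/orP; left; apply/eqP; lia.
  have i3' : (3 * j + k < 9)%N by have := ltn_ord j; lia.
  by move=> /(Eg_inj m9 i3') ->; apply/orP; right; apply/eqP; lia.
- case/LG_LgP => m m9 []; rewrite n9 // => /andP[Hm Hij] ->; split; first by apply/LG_LgP; exists m.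
  by case/orP: Hij => /eqP Ei; [left|right]; apply/EGpsi; exists (m %% 3)%N; rewrite ?ltn_mod //; congr Eg; lia.
Qed.

(** A walk inside the two cells shortens to a self-avoiding one, so the path in [tree_center]
    amounts to reachability within these cells. *)
Lemma centerP g (i : 'I_3) : tree_center (G1 g) i <-> centerb g i.
Proof.
split=> [Hc|/allP Hc j Nji].
- apply/allP => j; rewrite mem_iota => /andP[_ j3]; rewrite add0n in j3.
  have [//|Nji] := eqVneq j i; rewrite /=.
  have Nji' : Ordinal j3 != i by [].
  have [p [[[Hs Hh Hl Hp] _] Hm]] := Hc _ Nji'.
  apply/G1_cn; [exact: lt3_6|exact: lt3_6|].
  have -> : pv R [::] j = corner R (Ordinal j3) by rewrite corner_pv.
  rewrite -corner_pv -Hh -Hl -nth0 -nth_last -[j]/(val (Ordinal j3)) -two_cellsE.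
  by apply: walk_nth_cn; [move=> m Hm'; split; [exact: Hp|exact: Hm]|rewrite prednK].
- have : val j \in iota 0 3 by rewrite mem_iota; exact: ltn_ord.
  move/Hc; rewrite (_ : (val j == i) = false) /=; last exact: negbTE.
  move/(G1_cn (two_cells g i j) (lt3_6 (ltn_ord i)) (lt3_6 (ltn_ord j))).
  rewrite -two_cellsE -!corner_pv => /cn_saw [p [[Hs Hh Hl Hp] Hu]].
  exists p; split; last by move=> m /Hp [].
  by split=> //; split=> // m /Hp [].
Qed.

Lemma reach_sym L a b : reach L a b -> reach L b a.
Proof. by rewrite /reach eq_sym. Qed.
Lemma reach_trans L a b c : reach L a b -> reach L b c -> reach L a c.
Proof. by rewrite /reach => /eqP -> . Qed.

Lemma allcP g a b : allc g -> (a < 3)%N -> (b < 3)%N -> reach (Lg g) a b.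
Proof.
move=> /andP[/eqP H1 /eqP H2] a3 b3; rewrite /reach.
by move: a3 b3; case: a => [|[|[|a]]] // _; case: b => [|[|[|b]]] // _; rewrite ?H1 ?H2.
Qed.

Lemma Cn1_P6 x : Cn 1 x -> exists2 a, (a < 6)%N & x = pv R [::] a.
Proof.
case=> v [a []]; case: v => [|i [|]] // _ a3 ->; exists (vtx i a); last exact: (pv_rcons _ [::] i a3).
by case: i => [[|[|[|i]]] Hi] //; case: a a3 => [|[|[|a]]].
Qed.

Lemma spanning_tree1P g : bridges g -> rooted g -> spanning_tree 1 (G1 g) <-> allc g.
Proof.
move=> /(bridgesP R [::]) Hb /(rootedP R [::]) Hr; rewrite spanning_treeE; split=> [[_ _ H]|Ha].
  have C a : (a < 3)%N -> Cn 1 (pv R [::] a).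
    move=> a3; exists [:: inord a], a; split=> //.
    by rewrite -[pv R [::] a](_ : pv R (rcons [::] (inord a)) a = _) // pv_rcons // /vtx inordK // eqxx.
  by apply/andP; split; apply/G1_cn => //; apply: H; apply: C.
split=> //; first exact: G1_EG.
move=> x y /Cn1_P6 [a a6 ->] /Cn1_P6 [b b6 ->].
have [c c3 Hc] := Hr a a6; have [d d3 Hd] := Hr b b6.
apply: (cn_trans Hc); apply: (cn_trans _ (cn_sym Hd)).
by apply/G1_cn; [exact: lt3_6|exact: lt3_6|exact: allcP].
Qed.

Lemma ends_perm (i j k : 'I_3) : j != i -> k != i -> j = k \/ ends i = (val j, val k) \/ ends i = (val k, val j).
Proof.
case: i => [[|[|[|i]]] Hi] //; case: j => [[|[|[|j]]] Hj] //;
     case: k => [[|[|[|k]]] Hk] //; auto => _ _; left; exact: val_inj.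
Qed.

Lemma forestS1P g (i : 'I_3) : bridges g -> rooted g -> forestS 1 i (G1 g) <-> sep2 g i.
Proof.
move=> /(bridgesP R [::]) Hb /(rootedP R [::]) Hr.
have c6 (j : 'I_3) := lt3_6 (ltn_ord j).
have cr (j k : 'I_3) : conn (G1 g) (corner R j) (corner R k) <-> reach (Lg g) j k.
  by rewrite !corner_pv connE G1_cn.
have [j [k [Nj Nk Njk Ei]]] : exists j k : 'I_3, [/\ j != i, k != i, j != k & ends i = (val j, val k)].
  by case: i {Hb} => [[|[|[|i]]] Hi] //; [exists i2, i3|exists i3, i1|exists i1, i2]; split.
split=> [[_ _ _ H1 H2]|/andP[]].
  rewrite /sep2 Ei /=; apply/andP; split; first by apply/cr/H1.
  by apply/negP => /cr; apply: H2.
rewrite Ei /= => Hjk Nij; split.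
- exact: G1_EG.
- by apply/acyclic_bridged => // x /G1_EG; apply: EG_loopless.
- move=> x; rewrite VG_E => /Cn1_P6 [a a6 ->]; have [c c3 /connE Hc] := Hr a a6.
  rewrite -[c]/(val (Ordinal c3)) -corner_pv in Hc.
  by have [E|N] := eqVneq (Ordinal c3) i; [left; rewrite -E|right; exists (Ordinal c3)].
- move=> j' k' /ends_perm H /H; rewrite Ei => -[->|[[E1 E2]|[E1 E2]]]; apply/cr.
  + by rewrite /reach eqxx.
  + by rewrite -E1 -E2.
  + by rewrite -E1 -E2; apply: reach_sym.
- move=> j' /(@ends_perm i j j' Nj); rewrite Ei => H /cr Hij'; move/negP: Nij; apply.
  case: H => [->//|[[E]|[E]]]; last by rewrite E.
  by apply: (reach_trans Hij'); rewrite -E; apply: reach_sym.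
Qed.

(** Elements of R_1 trigger neither clause of [Tr1], so it remains to match trees and S_1^i with the
    two alternatives in [tr1]. *)
Lemma Tr1P g : Q1b g -> Tr1 (G1 g) = LG (pv R [::]) (Lo (tr1 g)).
Proof.
move=> /andP[Hb Hr].
have n3 k : (k < 3)%N -> nth false (tr1 g) k =
    (allc g && has (fun i => (i != k) && centerb g i) (iota 0 3)) || sep2 g k.
  by move=> k3; rewrite (nth_map 0%N) ?size_iota // nth_iota.
apply/seteqP; split=> e.
- case=> [[/spanning_tree1P Ht [i [/centerP Hi [j Nji ->]]]]|[i [/forestS1P Hs [j [k [Nj Nk Njk ->]]]]]].
  + have Nij : i != j by rewrite eq_sym.
    have [k Nki Nkj] := third Nij.
    apply/LG_LoP; exists (val k); first exact: ltn_ord.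
    split; last by rewrite (@Ed_corner i j k).
    rewrite n3 ?ltn_ord // Ht // andTb; apply/orP; left; apply/hasP; exists (val i); first by rewrite mem_iota; exact: ltn_ord.
    by rewrite Hi andbT eq_sym.
  + apply/LG_LoP; exists (val i); first exact: ltn_ord.
    split; last by rewrite (@Ed_corner j k i) // eq_sym.
    by rewrite n3 ?ltn_ord // Hs // orbT.
- case/LG_LoP => k k3 []; rewrite n3 // => /orP[/andP[Ha /hasP[i Hi1 Hi2]]|Hs] ->.
  + move: Hi1 Hi2; rewrite mem_iota add0n => /andP[_ i3'] /andP[Nik Hc]; left; split; first exact/spanning_tree1P.
    exists (Ordinal i3'); split; first exact/centerP.
    have N : Ordinal i3' != Ordinal k3 by [].
    have [j Nji Njk] := third N; exists j => //.
    rewrite -(@Ed_corner (Ordinal i3') j (Ordinal k3)) //; by rewrite eq_sym.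
  + right; exists (Ordinal k3); split; first exact/forestS1P.
    have [j [l [Nj Nk Njk]]] : exists j l : 'I_3, [/\ j != Ordinal k3, l != Ordinal k3 & j != l].
      by case: k k3 {Hs} => [|[|[|k]]] // k3; [exists i2, i3|exists i3, i1|exists i1, i2]; split.
    by exists j, l; split=> //; rewrite -(@Ed_corner j l (Ordinal k3)) // eq_sym.
Qed.

End TraceOne.

(** * Coded subgraphs of G_n *)

Section Codes.
Variable R : realType.
Implicit Types (x y z : pt R) (v u : seq 'I_3).

(** Subgraphs of G_n as a finite type: expectations of the uniform tree become finite sums, and
    events become boolean predicates. *)
Definition gcode n := {ffun n.-tuple 'I_3 * 'I_3 -> bool}.

Definition bb n (b : gcode n) v (k : nat) : bool :=
  if insub v is Some w then b (w, inord k) else false.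

Lemma bb_tuple n (b : gcode n) (w : n.-tuple 'I_3) (k : 'I_3) : bb b w k = b (w, k).
Proof. by rewrite /bb valK inord_val. Qed.

Definition lb n (b : gcode n) v : seq bool := [seq bb b v k | k <- iota 0 3].

Lemma nth_lb n (b : gcode n) v k : (k < 3)%N -> nth false (lb b v) k = bb b v k.
Proof. by move=> k3; rewrite (nth_map 0%N) ?size_iota // nth_iota. Qed.

Definition gr n (b : gcode n) : set (set (pt R)) := gl n (fun v => Lo (lb b v)) (fun=> True).

Lemma grP n (b : gcode n) e : gr b e <->
  exists v k, [/\ size v = n, (k < 3)%N, bb b v k & e = Ed v k].
Proof.
split=> [[v [Sv _] /LG_LoP [k k3 []]]|[v [k [Sv k3 Hb ->]]]].
  by rewrite nth_lb // => Hb ->; exists v, k.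
by exists v => //; apply/LG_LoP; exists k => //; rewrite nth_lb.
Qed.

Lemma gr_Ed n (b : gcode n) v k : size v = n -> (k < 3)%N -> gr b (Ed v k) <-> bb b v k.
Proof.
move=> Sv k3; split=> [/grP [u [k' [Su k3' Hb]]]|Hb]; last by apply/grP; exists v, k.
by move/(Ed_inj (etrans Sv (esym Su)) k3 k3') => [-> ->].
Qed.

Lemma gr_EG n (b : gcode n) : gr b `<=` EG n.
Proof. by move=> e /grP [v [k [Sv k3 _ ->]]]; apply/EG_P; exists v, k. Qed.

Definition enc n (H : set (set (pt R))) : gcode n := [ffun wk : n.-tuple 'I_3 * 'I_3 => `[< H (Ed wk.1 wk.2) >]].

Lemma bb_enc n H v k : size v = n -> (k < 3)%N -> bb (enc n H) v k <-> H (Ed v k).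
Proof.
move=> /eqP Sv k3; rewrite -[v]/(val (Tuple Sv)) -[k]/(val (Ordinal k3)) bb_tuple ffunE /=.
by split=> /asboolP.
Qed.

Lemma encK n H : H `<=` EG n -> gr (enc n H) = H.
Proof.
move=> HE; apply/seteqP; split=> e; first by case/grP => v [k [Sv k3 /bb_enc H1 ->]]; apply: H1.
move=> He; have /EG_P [v [k [Sv k3 Ee]]] := HE _ He; subst e.
by apply/grP; exists v, k; split=> //; apply/bb_enc.
Qed.

Lemma gr_inj n : injective (@gr n).
Proof.
have H (c c' : gcode n) w k : gr c = gr c' -> c (w, k) -> c' (w, k).
  move=> E; rewrite -!bb_tuple => /(gr_Ed c (size_tuple w) (ltn_ord k)).
  by rewrite E => /gr_Ed; apply=> //; exact: size_tuple.
by move=> b b' E; apply/ffunP => -[w k]; apply/idP/idP; apply: H.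
Qed.

Definition gb n (b : gcode n.+1) v : seq bool :=
  [seq bb b (rcons v (inord i)) k | i <- iota 0 3, k <- iota 0 3].

Lemma size_gb n (b : gcode n.+1) v : size (gb b v) = 9.
Proof. by []. Qed.

Lemma nth_gb n (b : gcode n.+1) v i k : (i < 3)%N -> (k < 3)%N ->
  nth false (gb b v) (3 * i + k) = bb b (rcons v (inord i)) k.
Proof. by case: i => [|[|[|i]]] //; case: k => [|[|[|k]]]. Qed.

Lemma gr_Lg n (b : gcode n.+1) : gr b = gl n (fun v => Lg (gb b v)) (fun=> True).
Proof.
apply/seteqP; split=> e.
- case/grP=> u [k []]; case/lastP: u => // v i; rewrite size_rcons => -[Sv] k3 Hb ->.
  exists v => //; apply/LG_LgP; exists (3 * i + k)%N; first by have := ltn_ord i; lia.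
  by rewrite Eg_rcons // nth_gb // inord_val.
- case=> v [Sv _] /LG_LgP [m /lt9P [i [k [i3 k3 ->]]] []]; rewrite nth_gb // Eg_rcons // => Hb ->.
  by apply/grP; exists (rcons v (inord i)), k; rewrite size_rcons Sv.
Qed.

Lemma psiw_Ed v u k : psiw v @` (Ed u k : set (pt R)) = Ed (v ++ u) k.
Proof.
apply/seteqP; split=> [z [y [->|->] <-]|z [->|->]].
- by left; rewrite /pv psiw_cat.
- by right; rewrite /pv psiw_cat.
- by exists (pv R u (ends k).1); [left|rewrite /pv psiw_cat].
- by exists (pv R u (ends k).2); [right|rewrite /pv psiw_cat].
Qed.

Lemma piw_gr n (b : gcode n.+1) v : size v = n -> piw v (gr b) = LG (pv R [::]) (Lg (gb b v)).
Proof.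
move=> Sv; apply/seteqP; split=> e.
- case=> /EG_P [u [k []]]; case: u => [|i [|]] // _ k3 ->.
  rewrite psiw_Ed cats1 => /gr_Ed; rewrite size_rcons Sv => /(_ erefl k3) Hb.
  apply/LG_LgP; exists (3 * i + k)%N; first by have := ltn_ord i; lia.
  by rewrite nth_gb // Eg_rcons // inord_val.
- case/LG_LgP => m /lt9P [i [k [i3 k3 ->]]] []; rewrite nth_gb // Eg_rcons // => Hb ->.
  split; first by apply/EG_P; exists [:: inord i], k.
  by rewrite psiw_Ed cats1; apply/gr_Ed; rewrite ?size_rcons ?Sv.
Qed.

Definition treeb n (b : gcode n) : bool := `[< spanning_tree n (gr b) >].

Definition trb n (b : gcode n.+1) : gcode n := [ffun wk : n.-tuple 'I_3 * 'I_3 => nth false (tr1 (gb b wk.1)) wk.2].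

Lemma bb_trb n (b : gcode n.+1) v k : size v = n -> (k < 3)%N -> bb (trb b) v k = nth false (tr1 (gb b v)) k.
Proof.
move=> /eqP Sv k3; by rewrite -[v]/(val (Tuple Sv)) -[k]/(val (Ordinal k3)) bb_tuple ffunE.
Qed.

Lemma lb_trb n (b : gcode n.+1) v : size v = n -> lb (trb b) v = tr1 (gb b v).
Proof.
move=> Sv; apply: (@eq_from_nth _ false); rewrite ?size_map // => k k3.
by rewrite nth_lb // bb_trb.
Qed.

Lemma corner_Cn n i : Cn n (corner R i).
Proof.
(* u_i is the fixed point of psi_i, hence a corner of the cell i...i. *)
exists (nseq n i), i; split=> //; first by rewrite size_nseq.
elim: n => [|n IH]; first exact: corner_P6.
rewrite /pv /= -/(pv R (nseq n i) i) -IH.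
apply: bary_inj => k k3; rewrite bary_psi // bary_corner //; by field.
Qed.

Lemma Cn_succ n x : Cn n.+1 x <-> exists v a, [/\ size v = n, (a < 6)%N & x = pv R v a].
Proof.
split=> [[u [a []]]|[v [a [Sv a6 ->]]]].
  case/lastP: u => // v i; rewrite size_rcons => -[Sv] a3 ->.
  exists v, (vtx i a); split=> //; last exact: pv_rcons.
  by case: i => [[|[|[|i]]] Hi] //; case: a a3 => [|[|[|a]]].
have [i [j [i3 j3 ->]]] : exists i j, [/\ (i < 3)%N, (j < 3)%N & a = vtx i j].
  by move: a6; case: a => [|[|[|[|[|[|a]]]]]] // _;
   [exists 0%N, 0%N|exists 1%N, 1%N|exists 2%N, 2%N|exists 1%N, 2%N|exists 0%N, 2%N|exists 0%N, 1%N].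
exists (rcons v (inord i)), j; rewrite size_rcons Sv; split=> //.
by rewrite pv_rcons // inordK.
Qed.

(** The walk ends at a corner of the cell or leaves the cell through one; for a tree this shows that
    its part in the cell is rooted. *)
Lemma in_reach n L v (l : seq (nat * nat)) a y : (forall v, wf6 (L v)) -> wf6 l -> size v = n ->
  (a < 6)%N -> Cn n y ->
  cn (LG (pv R v) l `|` out n L v) (pv R v a) y ->
  exists2 c, (c < 3)%N & cn (LG (pv R v) l) (pv R v a) (pv R v c).
Proof.
move=> wL wl Sv a6 Cy Hc.
suff [H|//] : cn (LG (pv R v) l) (pv R v a) y \/
    exists2 c, (c < 3)%N & cn (LG (pv R v) l) (pv R v a) (pv R v c).
  have [c c6 [Ey _]] := cn_reach (@pv_inj R v) wl a6 H.
  by subst y; exists c => //; apply: Cn_pv Cy.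
elim: Hc {Cy} => [|s t _ [Hs|Hs] Hst]; [by left; apply: cn0| |by right].
case: Hst => Hst; first by left; apply: cnS Hst.
have [c c6 [Es _]] := cn_reach (@pv_inj R v) wl a6 Hs.
subst s; right; exists c => //; apply: (touch_out wL Sv c6); by exists t.
Qed.

Lemma tree_split n (b : gcode n.+1) v : size v = n ->
  gr b = LG (pv R v) (Lg (gb b v)) `|` out n (fun u => Lg (gb b u)) v.
Proof. by move=> Sv; rewrite gr_Lg (gl_split _ _ Sv). Qed.

Lemma treeP n (b : gcode n) : treeb b <->
  bridged (gr b) /\ forall x y, Cn n x -> Cn n y -> cn (gr b) x y.
Proof.
rewrite /treeb; split=> [/asboolP/spanning_treeE[]//|[H1 H2]].
by apply/asboolP/spanning_treeE; split=> //; apply: gr_EG.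
Qed.

Lemma bridged_sub (H K : set (set (pt R))) : H `<=` K -> bridged K -> bridged H.
Proof.
move=> HK bK x y Hxy Hc; apply: (bK x y); first exact: HK.
by apply: cn_sub Hc => e [He N]; split; first exact: HK.
Qed.

Lemma piece_Q1 n (b : gcode n.+1) v : treeb b -> size v = n -> Q1b (gb b v).
Proof.
move=> /treeP [Hb Hc] Sv; apply/andP; split.
  apply/(bridgesP R v); apply: bridged_sub Hb; rewrite (tree_split b Sv); exact: subsetUl.
apply/(rootedP R v) => a a6.
have wL u : wf6 (Lg (gb b u)) by apply: wf6_Lg.
apply: (in_reach wL (wL v) Sv a6 (corner_Cn n i1)).
rewrite -tree_split //; apply: Hc; last exact: corner_Cn.
by apply/Cn_succ; exists v, a.
Qed.

Lemma Tr_gr n (b : gcode n.+1) : treeb b -> Tr n (gr b) = gr (trb b).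
Proof.
move=> Hb; apply/seteqP; split=> e.
- case=> v [Sv [e' He' ->]]; move: He'; rewrite piw_gr // Tr1P ?(piece_Q1 Hb) //.
  case/LG_LoP => k k3 [Hk ->]; rewrite psiw_Ed cats0.
  by apply/gr_Ed => //; rewrite bb_trb.
- case/grP => v [k [Sv k3]]; rewrite bb_trb // => Hk ->; exists v; split=> //.
  exists (Ed [::] k); last by rewrite psiw_Ed cats0.
  by rewrite piw_gr // Tr1P ?(piece_Q1 Hb) //; apply/LG_LoP; exists k.
Qed.

End Codes.

(** * Consequences of the exhaustive checks *)

Lemma tr1_table_mem g : size g = 9%N -> Q1b g -> (g, tr1 g) \in tr1_table.
Proof.
move=> Sg Hg; rewrite tr1_tableE; apply: map_f.
by rewrite /Q1s mem_filter Hg mem_bitseqs Sg.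
Qed.

Lemma corners_ends (L L' : seq (nat * nat)) :
  (forall k, (k < 3)%N -> reach L (ends k).1 (ends k).2 = reach L' (ends k).1 (ends k).2) ->
  forall a b, (a < 3)%N -> (b < 3)%N -> reach L a b = reach L' a b.
Proof.
move=> H a b a3 b3; have [->|[k k3 E]] := corner_ends a3 b3; first by rewrite /reach !eqxx.
by have := H k k3; case: E => <- //=; rewrite /reach eq_sym => ->; rewrite eq_sym.
Qed.

Lemma tr1_reach g a b : size g = 9%N -> Q1b g -> (a < 3)%N -> (b < 3)%N ->
  reach (Lg g) a b = reach (Lo (tr1 g)) a b.
Proof.
move=> Sg Hg; apply: corners_ends => k k3.
have /andP[/allP H _] := allP all_pattern_ok _ (tr1_table_mem Sg Hg).
have : k \in iota 0 3 by rewrite mem_iota.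
by move/H => /andP[/eqP].
Qed.

Lemma tr1_proper g : size g = 9%N -> Q1b g -> tr1 g != nseq 3 true.
Proof. by move=> Sg Hg; have /andP[] := allP all_pattern_ok _ (tr1_table_mem Sg Hg). Qed.

Lemma Q1b_bridge g k : size g = 9%N -> Q1b g -> (k < 3)%N -> reach (Lg g) (ends k).1 (ends k).2 ->
  exists2 e, (e < 9)%N & nth false g e /\ let ab := nth (0, 0)%N edges1 e in
    let L := Lg (del g e) in
    (reach L (ends k).1 ab.1 /\ reach L (ends k).2 ab.2) \/
    (reach L (ends k).1 ab.2 /\ reach L (ends k).2 ab.1).
Proof.
move=> Sg Hg k3 Hr.
have /andP[/allP H _] := allP all_pattern_ok _ (tr1_table_mem Sg Hg).
have : k \in iota 0 3 by rewrite mem_iota.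
move/H => /andP[_ /implyP/(_ Hr)/hasP [e]]; rewrite mem_iota => He /andP[Hge Hor].
by exists e => //; split=> //; case/orP: Hor => /andP; auto.
Qed.

Lemma compatP (L : seq (nat * nat)) o : compat L o <-> forall k, (k < 3)%N ->
  ~ (reach L (ends k).1 (ends k).2 /\ reach (Lo o) (ends k).1 (ends k).2).
Proof.
split=> [/allP H k k3 [H1 H2]|H].
  have : k \in iota 0 3 by rewrite mem_iota.
  by move/H; rewrite H1 H2.
by apply/allP => k; rewrite mem_iota => k3; apply/negP => /andP; exact: H.
Qed.

Lemma Q1b_glue g o e : size g = 9%N -> size o = 3%N -> Q1b g -> compat (Lg g) o -> (e < 9)%N -> nth false g e ->
  ~~ reach (Lg (del g e) ++ Lo o) (nth (0, 0)%N edges1 e).1 (nth (0, 0)%N edges1 e).2.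
Proof.
move=> Sg So Hg Hc He Hge.
have : g \in [seq x.1 | x <- tr1_table] by apply/mapP; exists (g, tr1 g) => //; apply: tr1_table_mem.
move/(allP all_glue_ok) => /allP /(_ o); rewrite mem_bitseqs So => /(_ isT) /implyP /(_ Hc) /allP /(_ e).
by rewrite mem_iota => /(_ He) /implyP/(_ Hge).
Qed.

(** * Replacing the part of a tree in one cell *)

Section Swap.
Variable R : realType.
Implicit Types (x y z : pt R) (v u : seq 'I_3).
Local Notation gr := (@gr R _).
Local Notation treeb := (@treeb R _).

Definition swap n (b : gcode n.+1) v (g : seq bool) : gcode n.+1 :=
  [ffun wk : n.+1.-tuple 'I_3 * 'I_3 => if take n wk.1 == v
     then nth false g (3 * last ord0 wk.1 + wk.2) else b wk].

Lemma bb_swap n (b : gcode n.+1) v g u (i : 'I_3) k : size u = n -> (k < 3)%N ->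
  bb (swap b v g) (rcons u i) k = if u == v then nth false g (3 * i + k) else bb b (rcons u i) k.
Proof.
move=> Su k3; have Sr : size (rcons u i) == n.+1 by rewrite size_rcons Su.
rewrite -[rcons u i]/(val (Tuple Sr)) -[k]/(val (Ordinal k3)) !bb_tuple ffunE /=.
have Et : take n (rcons u i) = u by rewrite -cats1 -Su take_size_cat.
by rewrite Et last_rcons.
Qed.

Lemma gb_swap n (b : gcode n.+1) v g u : size u = n -> size g = 9%N ->
  gb (swap b v g) u = if u == v then g else gb b u.
Proof.
move=> Su Sg; apply: (@eq_from_nth _ false); first by case: ifP.
rewrite size_gb => e /lt9P [i [k [i3 k3 ->]]].
rewrite nth_gb // bb_swap // inordK //; case: ifP => // _; by rewrite nth_gb.
Qed.

Lemma swapK n (b : gcode n.+1) v g : size v = n -> size g = 9%N ->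
  swap (swap b v g) v (gb b v) = b.
Proof.
move=> Sv Sg; apply/ffunP => -[w k]; rewrite -!bb_tuple.
have Sw := size_tuple w.
case/lastP E : (val w) Sw => [//|u i]; rewrite size_rcons => -[Su].
rewrite bb_swap //; case: eqP => [->|/eqP N]; last by rewrite bb_swap // (negbTE N).
by rewrite nth_gb // inord_val.
Qed.

Lemma Eg_notin_out n (L : seq 'I_3 -> seq bool) v e : size v = n -> (e < 9)%N ->
  ~ out n (fun u => Lg (L u)) v (Eg v e : set (pt R)).
Proof.
move=> Sv /lt9P [i [k [i3 k3 ->]]] [u [Su N] /LG_LgP [e' /lt9P [i' [k' [i3' k3' ->]]] [_]]].
rewrite !Eg_rcons // => /Ed_inj; rewrite !size_rcons Sv Su => /(_ erefl k3 k3') [/rcons_inj []].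
by move=> E; case: N.
Qed.

Lemma del_out n (L : seq 'I_3 -> seq bool) g v e : size v = n -> (e < 9)%N ->
  (LG (pv R v) (Lg g) `|` out n (fun u => Lg (L u)) v) `\ Eg v e =
  LG (pv R v) (Lg (del g e)) `|` out n (fun u => Lg (L u)) v.
Proof.
move=> Sv He; rewrite setDUl LG_Lg_del //; congr (_ `|` _).
apply/seteqP; split=> [x []//|x Hx]; split=> // E.
by apply: (@Eg_notin_out n L v e) => //; rewrite -E.
Qed.

Lemma out_swap n (b : gcode n.+1) v g : size v = n -> size g = 9%N ->
  out n (fun u => Lg (gb (swap b v g) u)) v = out n (fun u => Lg (gb b u)) v :> set (set (pt R)).
Proof.
move=> Sv Sg; rewrite /out /gl; apply/seteqP; split=> e [u [Su N] H]; exists u => //;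
 by move: H; rewrite gb_swap //; case: eqP.
Qed.

(** Excludes the three midpoints of the cell, the vertices of G_(n+1) in it that outside edges
    cannot touch. *)
Definition off v x := forall a, (a < 6)%N -> x = pv R v a -> (a < 3)%N.

(** Each excursion into the cell joins two corners and can be rerouted through the other part. [O]
    may be smaller than the outside, so that the lemma also applies after the removal of an outside
    edge. *)
Lemma replace_cn n L v (g h : seq bool) (O : set (set (pt R))) K x y :
  (forall v, wf6 (L v)) -> size v = n -> O `<=` out n L v ->
  (forall a b, (a < 3)%N -> (b < 3)%N -> reach (Lg g) a b -> reach (Lg h) a b) ->
  LG (pv R v) (Lg h) `<=` K -> O `<=` K ->
  off v x -> off v y -> cn (LG (pv R v) (Lg g) `|` O) x y -> cn K x y.
Proof.
move=> wL Sv HO Hgh hK OK Sx Sy Hc.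
pose H (i : bool) := if i then LG (pv R v) (Lg g) else O.
have {}Hc : cn [set e | exists2 i, True & H i e] x y.
  by apply: cn_sub Hc => e [He|He]; [exists true|exists false].
have tO z a : (a < 6)%N -> z = pv R v a -> touch O z -> (a < 3)%N.
  move=> a6 -> [t Ht]; apply: (touch_out wL Sv a6); exists t; exact: HO.
apply: (@cn_glue _ bool (fun=> True) H _ (off v)) Hc => //.
- by move=> [] [] z _ _ // _ T1 T2 a a6 Ea; apply: (tO z).
- move=> [] s s' _ Ss Ss' /= Hc; last exact: cn_sub Hc.
  have [->|Ts] := cn_touchl Hc; first exact: cn0.
  have [->|Ts'] := cn_touchr Hc; first exact: cn0.
  have [a a6 Ea] := touch_LG (wf6_Lg g) Ts; have [c c6 Ec] := touch_LG (wf6_Lg g) Ts'.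
  have a3 := Ss a a6 Ea; have c3 := Ss' c c6 Ec; subst s s'.
  apply: cn_sub hK _; apply/(cn_reachE (@pv_inj R v) (wf6_Lg _)) => //; apply: Hgh => //.
  by apply/(cn_reachE (@pv_inj R v) (wf6_Lg _)).
Qed.

Lemma off_out n (L : seq 'I_3 -> seq (nat * nat)) v x y : (forall v, wf6 (L v)) -> size v = n ->
  out n L v (mkedge x y) -> off v x.
Proof.
move=> wL Sv H a a6 Ea; have : touch (out n L v) x by exists y.
by rewrite Ea; apply: touch_out.
Qed.

Lemma off_Cn n v x : size v = n -> Cn n x -> off v x.
Proof. by move=> Sv Cx a a6 E; subst x; apply: Cn_pv Cx. Qed.

(** Two corners connected both inside and outside would close a cycle: the edge given by
    [Q1b_bridge] could be bypassed through the outside. *)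
Lemma tree_compat n (b : gcode n.+1) v : treeb b -> size v = n ->
  compat (Lg (gb b v)) (obits R n (fun u => Lg (gb b u)) v).
Proof.
move=> Hb Sv; apply/compatP => k k3 [Hr Ho].
have [a3 c3] := ends_lt k; have a6 := lt3_6 a3; have c6 := lt3_6 c3.
have [e He [Hge Hor]] := Q1b_bridge (size_gb b v) (piece_Q1 Hb Sv) k3 Hr.
have /treeP [Hbr _] := Hb.
have Ht : gr b (Eg v e) by rewrite (tree_split R b Sv); left; apply/LG_LgP; exists e.
apply: (Hbr _ _ Ht); rewrite -/(Eg v e) (tree_split R b Sv) del_out //.
set K := _ `|` _.
have HO : cn K (pv R v (ends k).1) (pv R v (ends k).2).
  apply: (@cn_sub _ (out n (fun u => Lg (gb b u)) v)); first by move=> ?; right.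
  by apply: obits_Lo_cn.
have HL c d : (c < 6)%N -> (d < 6)%N -> reach (Lg (del (gb b v) e)) c d -> cn K (pv R v c) (pv R v d).
  move=> c6' d6 Hcd; apply: (@cn_sub _ (LG (pv R v) (Lg (del (gb b v) e)))); first by move=> ?; left.
  by apply: reach_cn => //; apply: wf6_Lg.
have [e6 f6] := edges1_lt e.
case: Hor => -[H1 H2].
- apply: (cn_trans (cn_sym (HL _ _ a6 e6 H1))); apply: (cn_trans HO); exact: HL.
- apply: (cn_trans (cn_sym (HL _ _ c6 e6 H2))); apply: (cn_trans (cn_sym HO)); exact: HL.
Qed.

Lemma compat_tr1 g h o : size g = 9%N -> size h = 9%N -> Q1b g -> Q1b h -> tr1 g = tr1 h ->
  compat (Lg h) o -> compat (Lg g) o.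
Proof.
move=> Sg Sh Hg Hh E /compatP H; apply/compatP => k k3 [H1 H2]; apply: (H k k3); split=> //.
by have [a3 c3] := ends_lt k; rewrite tr1_reach // -E -tr1_reach.
Qed.

Lemma swap_tree n (b : gcode n.+1) v g : treeb b -> size v = n -> size g = 9%N -> Q1b g ->
  tr1 g = tr1 (gb b v) -> treeb (swap b v g).
Proof.
move=> Hb Sv Sg Hg Etr; have Hh := piece_Q1 Hb Sv.
have wL u : wf6 (Lg (gb b u)) by apply: wf6_Lg.
have /treeP [Hbr Hcn] := Hb; rewrite (tree_split R b Sv) in Hbr Hcn.
apply/treeP; rewrite (tree_split R _ Sv) out_swap // gb_swap // eqxx.
set O := out n _ v in Hbr Hcn *; set h := gb b v in Etr Hh Hbr Hcn *.
have hg a c : (a < 3)%N -> (c < 3)%N -> reach (Lg h) a c = reach (Lg g) a c.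
  by move=> a3 c3; rewrite !tr1_reach // Etr.
split.
  (* Edges of the new part are bridges by the gluing check, since parts with equal traces are
     compatible with the same surroundings. *)
  move=> x y [/LG_LgP [e He [Hge Exy]]|HO].
    rewrite Exy del_out // => Hc.
    have [a6 c6] := edges1_lt e.
    have := Q1b_glue Sg _ Hg (compat_tr1 Sg (size_gb b v) Hg Hh Etr (tree_compat Hb Sv)) He Hge.
    move=> /(_ (size_map _ _)) /negP; apply.
    apply/(local_cn R wL (wf6_Lg (del g e)) Sv a6 c6).
    by case: (mkedge_eq Exy) => -[<- <-] //; apply: cn_sym.
  have Nl l : ~ LG (pv R v) (Lg l) (mkedge x y).
    by case/LG_LgP => e He [_ E]; apply: (@Eg_notin_out n (gb b) v e) => //; rewrite -E.
  have Dl l : (LG (pv R v) (Lg l) `|` O) `\ mkedge x y = LG (pv R v) (Lg l) `|` (O `\ mkedge x y).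
    rewrite setDUl; congr (_ `|` _); apply/seteqP; split=> [e []//|e He]; split=> // E.
    by apply: (Nl l); rewrite -E.
  (* A bypass of an outside edge is rerouted through the old part, where it contradicts the
     acyclicity of the given tree. *)
  rewrite Dl => Hc; apply: (Hbr x y); first by right.
  rewrite Dl; apply: (replace_cn (h := h) wL Sv _ _ _ _ _ _ Hc).
  - by move=> e [].
  - by move=> a c a3 c3; rewrite -hg.
  - by move=> e; left.
  - by move=> e; right.
  - exact: off_out HO.
  - by apply: (@off_out n _ v y x wL Sv); rewrite mkedgeC.
have key x y : Cn n.+1 x -> Cn n.+1 y -> off v x -> off v y -> cn (LG (pv R v) (Lg g) `|` O) x y.
  move=> Cx Cy Sx Sy; apply: (replace_cn (h := g) wL Sv _ _ _ _ Sx Sy (Hcn x y Cx Cy)) => //.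
  - by move=> a c a3 c3; rewrite hg.
(* A midpoint of the cell first reaches a corner through the new part, which is rooted. *)
have toff x : Cn n.+1 x -> exists2 y, Cn n.+1 y /\ off v y & cn (LG (pv R v) (Lg g) `|` O) x y.
  move=> Cx; have [Sx|] := pselect (off v x); first by exists x => //; apply: cn0.
  move/existsNP => [a] /not_implyP [a6] /not_implyP [Ex Na].
  case/andP: Hg => _ /(rootedP R v) /(_ a a6) [c c3 Hc].
  exists (pv R v c); last by rewrite Ex; apply: cn_sub Hc => e; left.
  split; first by apply/Cn_succ; exists v, c; split=> //; apply: lt3_6.
  by apply: (off_Cn Sv); apply: pv_Cn.
move=> x y Cx Cy; have [x' [Cx' Sx'] Hx] := toff x Cx; have [y' [Cy' Sy'] Hy] := toff y Cy.
by apply: (cn_trans Hx); apply: (cn_trans _ (cn_sym Hy)); apply: key.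
Qed.

Lemma swap_trb n (b : gcode n.+1) v g : size v = n -> size g = 9%N ->
  tr1 g = tr1 (gb b v) -> trb (swap b v g) = trb b.
Proof.
move=> Sv Sg E; apply/ffunP => -[w k]; rewrite !ffunE /= gb_swap ?size_tuple //.
by case: eqP => // ->; rewrite E.
Qed.

End Swap.

(** * Cells crossed by the path *)

Section Crossing.
Variable R : realType.
Implicit Types (x y z : pt R) (v u : seq 'I_3).
Local Notation gr := (@gr R _).
Local Notation treeb := (@treeb R _).
Local Notation u1 := (corner R i1).
Local Notation u2 := (corner R i2).

(** In a tree, an edge lies on the path from u_1 to u_2 iff its removal separates them. In this form
    the types reduce to connectivity, without reference to a walk. *)
Definition onp (t : set (set (pt R))) v k := t (Ed v k) /\ ~ cn (t `\ Ed v k) u1 u2.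

Definition ty (t : set (set (pt R))) v : nat * nat :=
  (count (fun k => `[< t (Ed v k) >]) (iota 0 3),
   count (fun k => `[< onp t v k >]) (iota 0 3)).

Definition outb n (b : gcode n) v : set (set (pt R)) := out n (fun u => Lo (lb b u)) v.
(** Crossing is expressed through the outside of the cell alone, which makes it pass from a cell to
    its ancestors ([crossed_child]). *)
Definition crossed n (b : gcode n) v : bool := `[< ~ cn (outb b v) u1 u2 >].
Definition ob n (b : gcode n) v := obits R n (fun u => Lo (lb b u)) v.
(* A corner of the cell v that is connected to x outside the cell (3 if there is none). *)
Definition gate n (b : gcode n) v x : nat := find (fun a => `[< cn (outb b v) x (pv R v a) >]) (iota 0 3).
Local Notation sA b v := (gate b v u1).
Local Notation sB b v := (gate b v u2).

Lemma gateP n (b : gcode n) v x a : (a < 3)%N -> cn (outb b v) x (pv R v a) ->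
  (gate b v x < 3)%N /\ cn (outb b v) x (pv R v (gate b v x)).
Proof.
move=> a3 Ha.
have Hh : has (fun a => `[< cn (outb b v) x (pv R v a) >]) (iota 0 3).
  by apply/hasP; exists a; [rewrite mem_iota|apply/asboolP].
have H3 : (gate b v x < 3)%N by move: Hh; rewrite has_find size_iota.
split=> //; have /asboolP := nth_find 0%N Hh.
by rewrite -/(gate b v x) nth_iota.
Qed.

Lemma level_split n (b : gcode n) v : size v = n ->
  gr b = LG (pv R v) (Lo (lb b v)) `|` outb b v.
Proof. by move=> Sv; rewrite /gr (gl_split _ _ Sv). Qed.

Lemma corner_off n v i : size v = n -> off v (corner R i).
Proof. by move=> Sv; apply: (off_Cn Sv); apply: corner_Cn. Qed.

Lemma gates n (b : gcode n) v : treeb b -> size v = n -> crossed b v ->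
  [/\ (sA b v < 3)%N, (sB b v < 3)%N, cn (outb b v) u1 (pv R v (sA b v)) &
      cn (outb b v) u2 (pv R v (sB b v))].
Proof.
move=> /treeP [_ Hc] Sv /asboolP Hx.
have wL u : wf6 (Lo (lb b u)) by apply: wf6_Lo.
have H i j := Hc _ _ (corner_Cn R n i) (corner_Cn R n j).
rewrite (level_split _ Sv) in H.
have [//|[a a3 Ha]] := out_reach wL (wL v) Sv (@corner_off n v i1 Sv) (H i1 i2).
have [/cn_sym//|[c c3 Hc']] := out_reach wL (wL v) Sv (@corner_off n v i2 Sv) (H i2 i1).
by have [? ?] := gateP a3 Ha; have [? ?] := gateP c3 Hc'.
Qed.

Lemma cross_reach n L v (l : seq (nat * nat)) s s' : (forall v, wf6 (L v)) -> wf6 l -> size v = n ->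
  (s < 3)%N -> (s' < 3)%N -> cn (out n L v) u1 (pv R v s) -> cn (out n L v) u2 (pv R v s') ->
  cn (LG (pv R v) l `|` out n L v) u1 u2 <-> reach (l ++ Lo (obits R n L v)) s s'.
Proof.
move=> wL wl Sv s3 s3' H1 H2.
have up x y : cn (out n L v) x y -> cn (LG (pv R v) l `|` out n L v) x y.
  by apply: cn_sub => e; right.
split=> [Hc|Hr].
  apply/(local_cn R wL wl Sv (lt3_6 s3) (lt3_6 s3')).
  exact: cn_trans (cn_sym (up _ _ H1)) (cn_trans Hc (up _ _ H2)).
apply: (cn_trans (up _ _ H1)); apply: (cn_trans _ (cn_sym (up _ _ H2))).
by apply/(local_cn R wL wl Sv (lt3_6 s3) (lt3_6 s3')).
Qed.

Lemma Ed_notin_out n (L : seq 'I_3 -> seq bool) v k : size v = n -> (k < 3)%N ->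
  ~ out n (fun u => Lo (L u)) v (Ed v k : set (pt R)).
Proof.
move=> Sv k3 [u [Su N] /LG_LoP [k' k3' [_]]].
by move/(Ed_inj (etrans Sv (esym Su)) k3 k3') => [/esym].
Qed.

Lemma del_outb n (b : gcode n) q v k : size v = n -> (k < 3)%N ->
  (LG (pv R v) (Lo q) `|` outb b v) `\ Ed v k = LG (pv R v) (Lo (del q k)) `|` outb b v.
Proof.
move=> Sv k3; rewrite setDUl LG_Lo_del //; congr (_ `|` _).
apply/seteqP; split=> [x []//|x Hx]; split=> // E.
by apply: (@Ed_notin_out n (lb b) v k) => //; rewrite -E.
Qed.

Lemma ty_level n (b : gcode n) v : treeb b -> size v = n -> crossed b v ->
  ty (gr b) v = ty0 (lb b v) (ob b v) (sA b v) (sB b v).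
Proof.
move=> Hb Sv Hx; have [a3 c3 Ha Hc] := gates Hb Sv Hx.
have wL u : wf6 (Lo (lb b u)) by apply: wf6_Lo.
congr (_, _); apply: eq_in_count => k; rewrite mem_iota => k3; rewrite nth_lb //.
  by apply/asboolP/idP => /gr_Ed; apply.
apply/asboolP/andP => -[H1 H2]; split; try exact/(gr_Ed R b Sv k3).
- apply/negP => Hr; apply: H2; rewrite (level_split b Sv) del_outb //.
  apply/(cross_reach wL (wf6_Lo _) Sv a3 c3 Ha Hc); exact: Hr.
- rewrite (level_split b Sv) del_outb // => Hcn; move/negP: H2; apply.
  exact/(cross_reach wL (wf6_Lo _) Sv a3 c3 Ha Hc).
Qed.

Lemma ty_uncrossed n (b : gcode n) v : size v = n -> ~~ crossed b v -> (ty (gr b) v).2 = 0%N.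
Proof.
move=> Sv /asboolP/contrapT Hc; apply/eqP; rewrite -[_ == _]negbK -lt0n -has_count.
apply/hasP => -[k]; rewrite mem_iota => k3 /asboolP [_]; apply.
apply: cn_sub Hc; rewrite (level_split b Sv) del_outb //; exact: subsetUr.
Qed.

(** Part and trace have the same corner connections in every other cell, so the surroundings of a
    cell look the same in T_(n+1) and in T_n. *)
Lemma out_trb_cn n (b : gcode n.+1) v x y : treeb b -> size v = n -> Cn n x -> Cn n y ->
  cn (outb (trb b) v) x y <-> cn (out n (fun u => Lg (gb b u)) v) x y.
Proof.
move=> Hb Sv Cx Cy; have R1 u a c : size u = n -> (a < 3)%N -> (c < 3)%N ->
    reach (Lg (gb b u)) a c = reach (Lo (lb (trb b) u)) a c.
  by move=> Su a3 c3; rewrite lb_trb // tr1_reach // (piece_Q1 Hb).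
by split; apply: gl_reach_sub => //; try (by move=> u; apply: wf6_mask);
  move=> u a c Su _ a3 c3; rewrite R1.
Qed.

Lemma ob_trb n (b : gcode n.+1) v : treeb b -> size v = n ->
  ob (trb b) v = obits R n (fun u => Lg (gb b u)) v.
Proof.
move=> Hb Sv; rewrite /ob /obits; apply/eq_in_map => k; rewrite mem_iota => k3; have [a3 c3] := ends_lt k.
by apply/asboolP/asboolP; apply: (proj1 (out_trb_cn Hb Sv _ _)) || apply: (proj2 (out_trb_cn Hb Sv _ _)); apply: pv_Cn.
Qed.

(** The branching property: the types of the children of a crossed cell are a function of the part
    in the cell and of T_n alone. *)
Lemma ty_child n (b : gcode n.+1) v i : treeb b -> treeb (trb b) -> size v = n -> (i < 3)%N ->
  crossed (trb b) v -> ty (gr b) (rcons v (inord i)) =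
    ty1 (gb b v) (ob (trb b) v) (sA (trb b) v) (sB (trb b) v) i.
Proof.
move=> Hb Ht Sv i3' Hx; have [a3 c3 Ha Hc] := gates Ht Sv Hx.
have wL u : wf6 (Lg (gb b u)) by apply: wf6_Lg.
have Ha' : cn (out n (fun u => Lg (gb b u)) v) u1 (pv R v (sA (trb b) v)).
  by apply/out_trb_cn => //; [exact: corner_Cn|exact: pv_Cn].
have Hc' : cn (out n (fun u => Lg (gb b u)) v) u2 (pv R v (sB (trb b) v)).
  by apply/out_trb_cn => //; [exact: corner_Cn|exact: pv_Cn].
have Sr : size (rcons v (inord i : 'I_3)) = n.+1 by rewrite size_rcons Sv.
congr (_, _); apply: eq_in_count => k; rewrite mem_iota => k3; rewrite nth_gb //.
  by apply/asboolP/idP => /gr_Ed; apply.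
have m9 : (3 * i + k < 9)%N by lia.
have D : cn (gr b `\ Ed (rcons v (inord i)) k) u1 u2 <->
   reach (Lg (del (gb b v) (3 * i + k)) ++ Lo (ob (trb b) v)) (sA (trb b) v) (sB (trb b) v).
  rewrite (tree_split R b Sv) -Eg_rcons // del_out // ob_trb //.
  exact: (cross_reach wL (wf6_Lg _) Sv a3 c3 Ha' Hc').
apply/asboolP/andP => -[H1 H2]; split; try exact/(gr_Ed R b Sr k3).
- apply/negP => Hr; apply: H2; apply/D; exact: Hr.
- by move/D; apply/negP.
Qed.

Lemma out_child n (b : gcode n.+1) v i : size v = n ->
  out n (fun u => Lg (gb b u)) v `<=` outb b (rcons v i).
Proof.
move=> Sv e [u [Su N] /LG_LgP [m /lt9P [j [k [j3 k3 ->]]] []]]; rewrite nth_gb // Eg_rcons // => Hbb ->.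
exists (rcons u (inord j)); first by rewrite size_rcons Su; split=> // /rcons_inj [].
by apply/LG_LoP; exists k => //; rewrite nth_lb.
Qed.

Lemma crossed_child n (b : gcode n.+1) v i : treeb b -> size v = n ->
  crossed b (rcons v i) -> crossed (trb b) v.
Proof.
move=> Hb Sv /asboolP Hx; apply/asboolP => Hc; apply: Hx.
apply: (cn_sub (@out_child n b v i Sv)).
by apply/out_trb_cn => //; apply: corner_Cn.
Qed.

Lemma ty_child0 n (b : gcode n.+1) v i : treeb b -> size v = n -> ~~ crossed (trb b) v ->
  (ty (gr b) (rcons v i)).2 = 0%N.
Proof.
move=> Hb Sv Hx; apply: ty_uncrossed; first by rewrite size_rcons Sv.
by apply: contra Hx; apply: crossed_child.
Qed.

Lemma crossingP n (b : gcode n.+1) v : treeb b -> treeb (trb b) -> size v = n ->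
  crossed (trb b) v ->
  crossing (lb (trb b) v) (ob (trb b) v) (sA (trb b) v) (sB (trb b) v).
Proof.
move=> Hb Ht Sv Hx; have [a3 c3 Ha Hc] := gates Ht Sv Hx.
have wL u : wf6 (Lo (lb (trb b) u)) by apply: wf6_Lo.
apply/and3P; split.
- apply/compatP => k k3 [H1 H2]; have /compatP/(_ k k3) := tree_compat Hb Sv; apply.
  have [e3 f3] := ends_lt k.
  by rewrite -ob_trb // tr1_reach ?(piece_Q1 Hb) // -lb_trb.
- apply/(cross_reach wL (wL v) Sv a3 c3 Ha Hc); have /treeP [_ H] := Ht.
  rewrite -/(outb (trb b) v) -(level_split _ Sv); apply: H; exact: corner_Cn.
- apply/negP => Hr; move/asboolP: Hx; apply; apply: (cn_trans Ha); apply: (cn_trans _ (cn_sym Hc)).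
  by apply/obits_cn.
Qed.

End Crossing.

(** * Weighted offspring *)

Lemma fiberP q g : g \in fiber q -> [/\ size g = 9%N, Q1b g & tr1 g = q].
Proof. by rewrite fiberE mem_filter mem_bitseqs => /andP[/andP[-> /eqP->] /eqP->]. Qed.

Lemma mem_fiber g : size g = 9%N -> Q1b g -> g \in fiber (tr1 g).
Proof. by move=> Sg Hg; rewrite fiberE mem_filter mem_bitseqs Sg Hg !eqxx. Qed.

Section Weights.
Variable R : realType.
Implicit Types (v u : seq 'I_3).
Local Notation gr := (@gr R _).
Local Notation treeb := (@treeb R _).
Local Notation u1 := (corner R i1).
Local Notation u2 := (corner R i2).
Local Notation al := (alpha R).

Lemma sqrt205 : 14 < Num.sqrt (205 : R) < 15.
Proof.
have E : Num.sqrt 205 ^+ 2 = 205 :> R by rewrite sqr_sqrtr // ler0n.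
have P : 0 <= Num.sqrt 205 :> R by apply: sqrtr_ge0.
by apply/andP; split; nra.
Qed.

Lemma alpha_bounds : 2 < al < 3.
Proof. by have /andP[? ?] := sqrt205; rewrite /alpha; apply/andP; split; lra. Qed.

(** By the table in [row_ok] the mean offspring matrix has rows (1, 4/5, 2/5), (1/2, 1, 1/2), (1,
    4/3, 2/3); its characteristic polynomial is x (x^2 - 8/3 x + 13/15). *)
Lemma alpha_root : al ^+ 2 = 8 / 3 * al - 13 / 15.
Proof.
have E : Num.sqrt 205 ^+ 2 = 205 :> R by rewrite sqr_sqrtr // ler0n.
rewrite /alpha; set s := Num.sqrt 205 in E *.
have -> : (4 / 3 + s / 15) ^+ 2 = 16 / 9 + 8 / 45 * s + s ^+ 2 / 225 by field.
by rewrite E; field.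
Qed.

(* A right eigenvector, with eigenvalue alpha, of the mean offspring matrix. *)
Definition wt (x : nat * nat) : R :=
  if x == (1, 1)%N then 2 * al
  else if x == (2, 1)%N then 1 + 5 / 2 * (al - 1)
  else if x == (2, 2)%N then 2 + 10 / 3 * (al - 1) else 0.

Lemma wt_ge0 x : 0 <= wt x.
Proof.
have /andP[? ?] := alpha_bounds; rewrite /wt; do ?case: ifP => _ //; lra.
Qed.

Lemma wt_le x : wt x <= 10.
Proof. have /andP[? ?] := alpha_bounds; rewrite /wt; do ?case: ifP => _ //; lra. Qed.

Lemma wt0 x : x.2 = 0%N -> wt x = 0.
Proof. by case: x => a b /= ->; rewrite /wt !xpair_eqE /= !andbF. Qed.

Definition proper_types : seq (nat * nat) := [:: (1, 1); (2, 1); (2, 2)]%N.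

Lemma wt_ge1 x : x \in proper_types -> 1 <= wt x.
Proof.
have /andP[? ?] := alpha_bounds.
by rewrite !inE => /or3P[] /eqP->; rewrite /wt /=; lra.
Qed.

Lemma sum_wt (t : seq (nat * nat)) : \sum_(x <- t) wt x =
  2 * al * (count_mem (1, 1)%N t)%:R + (1 + 5 / 2 * (al - 1)) * (count_mem (2, 1)%N t)%:R
  + (2 + 10 / 3 * (al - 1)) * (count_mem (2, 2)%N t)%:R.
Proof.
elim: t => [|x t IH]; first by rewrite big_nil /=; lra.
rewrite big_cons {}IH /= !natrD /wt.
case: eqP => [->|_] /=; first by lra.
case: eqP => [->|_] /=; first by lra.
by case: eqP => [_|_] /=; lra.
Qed.

Lemma crossing_rows q o s s' : size q = 3%N -> q != nseq 3 true -> size o = 3%N ->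
  (s < 3)%N -> (s' < 3)%N -> crossing q o s s' ->
  [/\ ty0 q o s s' \in proper_types, (0 < size (fiber q))%N &
  \sum_(g <- fiber q) \sum_(i <- iota 0 3) wt (ty1 g o s s' i) =
    (size (fiber q))%:R * (al * wt (ty0 q o s s'))].
Proof.
move=> Sq Nq So s3 s3' Hc.
have := all_crossingsP rows_ok Sq Nq So s3 s3' Hc; rewrite /row_ok.
set t := types q o s s'.
have Et : \sum_(g <- fiber q) \sum_(i <- iota 0 3) wt (ty1 g o s s' i) = \sum_(x <- t) wt x.
  by rewrite /t /types big_allpairs_dep.
rewrite Et sum_wt; have E2 := alpha_root.
generalize (ty0 q o s s') => T0.
rewrite !inE => /or3P[] /eqP [-> -> -> -> ->]; split=> //; rewrite /wt /=; nra.
Qed.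

Definition hw n (b : gcode n) v : R := wt (ty (gr b) v).
Definition chw n (b : gcode n.+1) v : R := \sum_(i <- iota 0 3) hw b (rcons v (inord i)).

Section TraceClosed.
Hypothesis trace_tree : forall n (b : gcode n.+1), treeb b -> treeb (trb b).

Lemma lb_proper n (b : gcode n.+1) v : treeb b -> size v = n -> lb (trb b) v != nseq 3 true.
Proof. by move=> Hb Sv; rewrite lb_trb // tr1_proper // (piece_Q1 Hb). Qed.

Lemma crossed_rows n (b : gcode n.+1) v (q := lb (trb b) v) (o := ob R (trb b) v)
    (s := gate (trb b) v u1) (s' := gate (trb b) v u2) :
  treeb b -> size v = n -> crossed R (trb b) v ->
  [/\ hw (trb b) v = wt (ty0 q o s s'), ty0 q o s s' \in proper_types, (0 < size (fiber q))%N &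
  \sum_(g <- fiber q) \sum_(i <- iota 0 3) wt (ty1 g o s s' i) =
    (size (fiber q))%:R * (al * hw (trb b) v)].
Proof.
move=> Hb Sv Hx; have Ht := trace_tree Hb.
have [s3 s3' _ _] := gates Ht Sv Hx.
have Eh : hw (trb b) v = wt (ty0 q o s s') by rewrite /hw ty_level.
have [H1 H2 H3] := crossing_rows (size_map _ _ : size q = 3%N) (lb_proper Hb Sv)
  (size_map _ _ : size o = 3%N) s3 s3' (crossingP Hb Ht Sv Hx).
by split=> //; rewrite Eh.
Qed.

Lemma chwE n (b : gcode n.+1) v : treeb b -> size v = n -> chw b v =
  if crossed R (trb b) v then \sum_(i <- iota 0 3)
    wt (ty1 (gb b v) (ob R (trb b) v) (gate (trb b) v u1) (gate (trb b) v u2) i) else 0.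
Proof.
move=> Hb Sv; case: ifP => [Hx|/negbT Hx].
  apply: eq_big_seq => i; rewrite mem_iota => i3'.
  by rewrite /hw ty_child //; apply: trace_tree.
by apply: big1 => i _; rewrite /hw wt0 // ty_child0.
Qed.

Lemma chw_ge0 n (b : gcode n.+1) v : 0 <= chw b v.
Proof. by apply: sumr_ge0 => i _; apply: wt_ge0. Qed.

Lemma chw_le n (b : gcode n.+1) v : chw b v <= 30.
Proof.
rewrite /chw /= !big_cons big_nil /hw.
have := wt_le (ty (gr b) (rcons v (inord 0))); have := wt_le (ty (gr b) (rcons v (inord 1))).
have := wt_le (ty (gr b) (rcons v (inord 2))); lra.
Qed.

(** The martingale increment contributed by the cell, before division by a power of alpha. *)
Definition deviation n (b : gcode n.+1) v : R := chw b v - al * hw (trb b) v.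

(** For a crossed cell both terms of the deviation lie in [0, 30], so the square is at most 900, and
    the weight is at least 1; for an uncrossed cell both sides vanish. *)
Lemma dev_sq n (b : gcode n.+1) v : treeb b -> size v = n ->
  deviation b v ^+ 2 <= 1000 * hw (trb b) v.
Proof.
move=> Hb Sv; rewrite /deviation; have := wt_ge0 (ty (gr (trb b)) v); rewrite -/(hw _ v) => h0.
have [Hx|Hx] := boolP (crossed R (trb b) v); last first.
  rewrite chwE // (negbTE Hx) /hw wt0; last exact: ty_uncrossed.
  by rewrite mulr0 subr0 expr0n /= mulr0.
have [Eh /wt_ge1 h1 _ _] := crossed_rows Hb Sv Hx; rewrite -Eh in h1.
have := chw_ge0 b v; have := chw_le b v; have := wt_le (ty (gr (trb b)) v); rewrite -/(hw _ v).
have /andP[a2 a3] := alpha_bounds.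
set c := chw b v; set w := hw _ v in h0 h1 *; set a := al in a2 a3 * => w10 c30 c0.
have : 0 <= a * w <= 30 by nra.
move=> /andP[x0 x30]; set x := a * w in x0 x30 *.
have : 0 <= (30 - (c - x)) * (30 + (c - x)) by apply: mulr_ge0; lra.
nra.
Qed.

Lemma sum_bitseqs n (P : pred (seq bool)) (F : seq bool -> R) :
  \sum_(g <- bitseqs n | P g) F g = \sum_(g : n.-tuple bool | P g) F g.
Proof.
transitivity (\sum_(g <- map val (enum {: n.-tuple bool}) | P g) F g); last by rewrite big_map big_enum_cond.
apply: perm_big; apply: uniq_perm.
- exact: uniq_bitseqs.
- by rewrite map_inj_uniq ?enum_uniq //; apply: val_inj.
- move=> g; rewrite mem_bitseqs; apply/idP/mapP => [Sg|[t _ ->]]; last by rewrite size_tuple.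
  by exists (Tuple Sg) => //; rewrite mem_enum.
Qed.

(* Exchanging the piece of [b] in the cell v with [g] is an involution on such pairs. *)
Lemma swap_avg n v (F : gcode n.+1 -> R) : size v = n ->
  \sum_(b : gcode n.+1 | treeb b) \sum_(g <- fiber (tr1 (gb b v))) F (swap b v g) =
  \sum_(b : gcode n.+1 | treeb b) (size (fiber (tr1 (gb b v))))%:R * F b.
Proof.
move=> Sv.
pose P (b : gcode n.+1) (g : 9.-tuple bool) := Q1b g && (tr1 g == tr1 (gb b v)).
have fib (b : gcode n.+1) (f : seq bool -> R) :
    \sum_(g <- fiber (tr1 (gb b v))) f g = \sum_(g | P b g) f g.
  by rewrite fiberE big_filter sum_bitseqs.
have gbP (b : gcode n.+1) : size (gb b v) == 9%N by [].
pose sg (p : gcode n.+1 * 9.-tuple bool) := (swap p.1 v p.2, Tuple (gbP p.1)).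
have sgK : involutive sg.
  case=> b g; rewrite /sg /=; congr (_, _); first by rewrite swapK // size_tuple.
  by apply: val_inj; rewrite /= gb_swap ?size_tuple // eqxx.
have Psg p : treeb p.1 && P p.1 p.2 -> treeb (sg p).1 && P (sg p).1 (sg p).2.
  case: p => b g /= /and3P[Hb Hg /eqP E].
  rewrite swap_tree ?size_tuple //= /P /= (piece_Q1 Hb) //=.
  by rewrite gb_swap ?size_tuple // eqxx E.
under eq_bigr => b _ do rewrite fib.
rewrite pair_big_dep /= (reindex_inj (inv_inj sgK)) /=.
rewrite (eq_bigl (fun p : gcode n.+1 * 9.-tuple bool => treeb p.1 && P p.1 p.2)); last first.
  by move=> p; apply/idP/idP; [move=> H; have := Psg (sg p) H; rewrite sgK|exact: Psg].
transitivity (\sum_(p : gcode n.+1 * 9.-tuple bool | treeb p.1 && P p.1 p.2) F p.1).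
  by apply: eq_bigr => -[b g] _; rewrite /= swapK // size_tuple.
rewrite -(pair_big_dep treeb P (fun b _ => F b)) /=.
apply: eq_bigr => b _.
rewrite -(fib b (fun=> F b)) big_const_seq count_predT iter_addr_0.
by rewrite -[F b *+ _]mulr_natl.
Qed.

(** Averaging over the exchanges in the cell [v] leaves [F], the trace and the surroundings fixed,
    and the eigenvector equation makes the mean deviation vanish. This takes the place of a
    conditional expectation given the rest of the tree. *)
Lemma dev_mean0 n v (F : gcode n.+1 -> R) : size v = n ->
  (forall b g, treeb b -> size g = 9%N -> Q1b g -> tr1 g = tr1 (gb b v) -> F (swap b v g) = F b) ->
  \sum_(b : gcode n.+1 | treeb b) F b * deviation b v = 0.
Proof.
move=> Sv HF; pose N (b : gcode n.+1) : R := (size (fiber (tr1 (gb b v))))%:R.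
have Npos b : treeb b -> N b != 0.
  move=> Hb; rewrite pnatr_eq0 -lt0n.
  by have := mem_fiber (size_gb b v) (piece_Q1 Hb Sv); case: (fiber _).
(* [N b] is the weight produced by [swap_avg]; its inverse can be absorbed into the summand because
   exchanges keep the size of the fiber. *)
transitivity (\sum_(b : gcode n.+1 | treeb b) N b * ((N b)^-1 * (F b * deviation b v))).
  by apply: eq_bigr => b Hb; rewrite (mulVKf (Npos b Hb)).
rewrite -(swap_avg (fun b => (N b)^-1 * (F b * deviation b v)) Sv); apply: big1 => b Hb.
pose q := lb (trb b) v; pose o := ob R (trb b) v.
pose s := gate (trb b) v u1; pose s' := gate (trb b) v u2.
have Eq : tr1 (gb b v) = q by rewrite /q lb_trb.
rewrite (eq_big_seq (fun g => (N b)^-1 * F b * ((if crossed R (trb b) v then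
    \sum_(i <- iota 0 3) wt (ty1 g o s s' i) else 0) - al * hw (trb b) v))); last first.
  move=> g /fiberP [Sg Hg Eg]; have Hsw := swap_tree Hb Sv Sg Hg Eg.
  rewrite /N /deviation !chwE // HF // !(swap_trb Sv Sg Eg) !gb_swap // !eqxx Eg.
  by rewrite mulrA.
rewrite -mulr_sumr sumrB.
have [Hx|Hx] := boolP (crossed R (trb b) v); last first.
  have -> : hw (trb b) v = 0 by rewrite /hw wt0 // ty_uncrossed.
  by rewrite big1 // mulr0 big1 ?subr0 ?mulr0.
have [_ _ _ E] := crossed_rows Hb Sv Hx.
by rewrite Eq E big_const_seq count_predT iter_addr_0 -[(al * _) *+ _]mulr_natl subrr mulr0.
Qed.

End TraceClosed.
End Weights.

(** * Martingale estimates *)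

Section Moments.
Variable R : realType.
Implicit Types (v u : seq 'I_3) (Q : pred (seq 'I_3)).
Local Notation treeb := (@treeb R _).
Local Notation hw := (@hw R _).
Local Notation dev := (@deviation R _).
Local Notation al := (alpha R).

Lemma sum_rcons n Q (F : seq 'I_3 -> R) :
  \sum_(w : n.+1.-tuple 'I_3 | Q (take n w)) F w =
  \sum_(v : n.-tuple 'I_3 | Q v) \sum_(i <- iota 0 3) F (rcons v (inord i)).
Proof.
have E3 (v : n.-tuple 'I_3) :
    \sum_(i <- iota 0 3) F (rcons v (inord i)) = \sum_(i : 'I_3) F (rcons v i).
  rewrite !big_ord_recr big_ord0 /= !big_cons big_nil addr0 add0r addrA.
  by congr (_ + _ + _); congr (F (rcons _ _)); apply: val_inj; rewrite /= inordK.
under [RHS]eq_bigr => v _ do rewrite E3.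
rewrite pair_big_dep /= (reindex (fun p : n.-tuple 'I_3 * 'I_3 => [tuple of rcons p.1 p.2])) /=.
  by apply: eq_big => [[v i]|[v i] _] //=; rewrite -cats1 take_size_cat ?size_tuple // andbT.
exists (fun w => (belast_tuple (thead w) (behead_tuple w), last (thead w) (behead w))).
- move=> [v i] _; congr (_, _); last by rewrite /thead /= ; case: v => -[|x v] Hv //=; rewrite ?last_rcons.
  by apply: val_inj => /=; rewrite /thead; case: v => -[|x v] Hv //=; rewrite belast_rcons.
- move=> w _; apply: val_inj => /=; rewrite -lastI.
  by case/tupleP: w => x w /=; rewrite theadE.
Qed.

(** A predicate on words treats the whole population and the descendants of a single cell alike. *)
Definition Zs n Q (b : gcode n) : R := \sum_(v : n.-tuple 'I_3 | Q v) hw b v.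

Lemma Zs_ge0 n Q (b : gcode n) : 0 <= Zs Q b.
Proof. by apply: sumr_ge0 => v _; apply: wt_ge0. Qed.

Lemma Zs_dev n Q (b : gcode n.+1) :
  Zs (fun w => Q (take n w)) b - al * Zs Q (trb b) = \sum_(v : n.-tuple 'I_3 | Q v) dev b v.
Proof. by rewrite /Zs sum_rcons mulr_sumr -sumrB. Qed.

Variable p : nat -> R.
Hypothesis p_ge0 : forall n, 0 <= p n.
Hypothesis trace_tree : forall n (b : gcode n.+1), treeb b -> treeb (trb b).

Definition tree_mean n (f : gcode n -> R) : R := p n * \sum_(b : gcode n | treeb b) f b.

Hypothesis trace_Ex : forall n (f : gcode n -> R), tree_mean (fun b => f (trb b)) = tree_mean f.
Hypothesis Ex1 : forall n, @tree_mean n (fun=> 1) = 1.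

Lemma le_Ex n (f g : gcode n -> R) : (forall b, treeb b -> f b <= g b) -> tree_mean f <= tree_mean g.
Proof. by move=> H; apply: ler_wpM2l => //; apply: ler_sum. Qed.

Lemma eq_Ex n (f g : gcode n -> R) : (forall b, treeb b -> f b = g b) -> tree_mean f = tree_mean g.
Proof. by move=> H; rewrite /tree_mean; congr (_ * _); apply: eq_bigr. Qed.

Lemma ExD n (f g : gcode n -> R) : tree_mean (fun b => f b + g b) = tree_mean f + tree_mean g.
Proof. by rewrite /tree_mean big_split mulrDr. Qed.

Lemma ExZ n c (f : gcode n -> R) : tree_mean (fun b => c * f b) = c * tree_mean f.
Proof. by rewrite /tree_mean -mulr_sumr mulrCA. Qed.

Lemma Ex_sum n (I : Type) (r : seq I) (P : pred I) (f : I -> gcode n -> R) :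
  tree_mean (fun b => \sum_(i <- r | P i) f i b) = \sum_(i <- r | P i) tree_mean (f i).
Proof. by rewrite /tree_mean exchange_big /= mulr_sumr. Qed.

Lemma Ex_ge0 n (f : gcode n -> R) : (forall b, treeb b -> 0 <= f b) -> 0 <= tree_mean f.
Proof. by move=> H; apply: mulr_ge0 => //; apply: sumr_ge0. Qed.

Lemma ExB n (f g : gcode n -> R) : tree_mean (fun b => f b - g b) = tree_mean f - tree_mean g.
Proof. by rewrite /tree_mean sumrB mulrBr. Qed.

Lemma Ex_cst n c : @tree_mean n (fun=> c) = c.
Proof. by rewrite -{2}[c]mulr1 -(Ex1 n) -ExZ; apply: eq_Ex => b _; rewrite mulr1. Qed.

Lemma dev_swap n (b : gcode n.+1) v u g : treeb b -> size v = n -> size u = n -> size g = 9%N ->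
  Q1b g -> tr1 g = tr1 (gb b v) -> u <> v -> dev (swap b v g) u = dev b u.
Proof.
move=> Hb Sv Su Sg Hg Eg /eqP N; have Hs := swap_tree Hb Sv Sg Hg Eg.
by rewrite /deviation !(chwE trace_tree) // (swap_trb Sv Sg Eg) gb_swap // (negbTE N).
Qed.

Lemma step_mean n Q (G : gcode n -> R) :
  tree_mean (fun b : gcode n.+1 => G (trb b) * (Zs (fun w => Q (take n w)) b - al * Zs Q (trb b))) = 0.
Proof.
under eq_Ex => b _ do rewrite Zs_dev mulr_sumr.
rewrite Ex_sum big1 // => v _; rewrite /tree_mean (dev_mean0 trace_tree) ?mulr0 ?size_tuple //.
by move=> b g Hb Sg Hg Eg; rewrite (swap_trb (size_tuple v) Sg Eg).
Qed.

Lemma step_var n Q (G : gcode n -> R) : (forall b, treeb b -> 0 <= G b) ->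
  tree_mean (fun b : gcode n.+1 => G (trb b) * (Zs (fun w => Q (take n w)) b - al * Zs Q (trb b)) ^+ 2)
  <= 1000 * tree_mean (fun b => G b * Zs Q b).
Proof.
move=> G0.
have -> : tree_mean (fun b : gcode n.+1 => G (trb b) * (Zs (fun w => Q (take n w)) b - al * Zs Q (trb b)) ^+ 2)
   = \sum_(v : n.-tuple 'I_3 | Q v) tree_mean (fun b : gcode n.+1 => G (trb b) * dev b v ^+ 2).
  transitivity (tree_mean (fun b : gcode n.+1 => \sum_(v : n.-tuple 'I_3 | Q v)
      \sum_(u : n.-tuple 'I_3 | Q u) (G (trb b) * dev b u) * dev b v)).
    apply: eq_Ex => b _; rewrite Zs_dev expr2 mulrA -mulrA mulr_suml mulr_sumr; apply: eq_bigr => v _.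
    by rewrite -mulr_suml -mulr_sumr; ring.
  rewrite Ex_sum; apply: eq_bigr => v Qv; rewrite Ex_sum (bigD1 v) //= [X in _ + X]big1 ?addr0.
    by apply: eq_Ex => b _; rewrite expr2 mulrA.
  (* Exchanging the part in [v] does not change the deviation at [u], so mixed products have mean
     0. *)
  move=> u /andP[_ /eqP N]; rewrite /tree_mean (dev_mean0 trace_tree) ?mulr0 ?size_tuple //.
  move=> b g Hb Sg Hg Eg; rewrite (swap_trb (size_tuple v) Sg Eg).
  by rewrite (dev_swap Hb _ _ Sg Hg Eg) ?size_tuple // => /val_inj.
apply: (@le_trans _ _ (\sum_(v : n.-tuple 'I_3 | Q v)
    tree_mean (fun b : gcode n.+1 => G (trb b) * (1000 * hw (trb b) v)))).
  apply: ler_sum => v _; apply: le_Ex => b Hb; apply: ler_wpM2l; first exact/G0/trace_tree.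
  by apply: (dev_sq trace_tree); rewrite ?size_tuple.
rewrite -Ex_sum (trace_Ex (fun b => \sum_(v : n.-tuple 'I_3 | Q v) G b * (1000 * hw b v))) -ExZ.
apply: le_Ex => b _; rewrite /Zs !mulr_sumr; apply: ler_sum => v _.
by rewrite mulrCA.
Qed.

Fixpoint trm k m : gcode (m + k) -> gcode k :=
  match m with
  | 0 => fun b => b
  | m'.+1 => fun b => trm (trb (b : gcode (m' + k).+1))
  end.

Lemma trm_tree k m (b : gcode (m + k)) : treeb b -> treeb (trm b).
Proof. by elim: m b => //= m IH b Hb; apply/IH/trace_tree. Qed.

Lemma trm_Ex k m (f : gcode k -> R) : tree_mean (fun b : gcode (m + k) => f (trm b)) = tree_mean f.
Proof. by elim: m => [//|m IH]; rewrite -IH; apply: (trace_Ex (fun b => f (trm b))). Qed.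

(** The normalised population descending from the level [k] cells selected by [Q]: a martingale in
    [m] that starts at [Zs Q]. *)
Definition An k m Q (b : gcode (m + k)) : R := al ^- m * Zs (fun w => Q (take k w)) b.

Lemma al_gt0 : 0 < al. Proof. by have /andP[? ?] := alpha_bounds R; lra. Qed.
Lemma al_neq0 : al != 0. Proof. by rewrite gt_eqF // al_gt0. Qed.

Lemma An_step k m Q (b : gcode (m.+1 + k)) :
  An Q b - An Q (trb (b : gcode (m + k).+1)) =
  al ^- m.+1 * (Zs (fun w => (fun w' => Q (take k w')) (take (m + k) w)) (b : gcode (m + k).+1)
     - al * Zs (fun w => Q (take k w)) (trb (b : gcode (m + k).+1))).
Proof.
rewrite /An mulrBr; congr (_ - _); last first.
  rewrite mulrA; congr (_ * _); rewrite exprS.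
  have := expf_neq0 m al_neq0; have := al_neq0.
  by move: (al) (al ^+ m) => a x a0 x0; field; rewrite a0 x0.
congr (_ * _); apply: eq_bigl => w.
by rewrite take_takel // leq_addl.
Qed.

Lemma An0 k Q (b : gcode k) : An (m := 0) Q b = Zs Q b.
Proof.
rewrite /An expr0 invr1 mul1r; apply: eq_bigl => w.
by rewrite take_oversize // size_tuple.
Qed.

Lemma An_mean k m Q (G : gcode k -> R) :
  tree_mean (fun b : gcode (m + k) => G (trm b) * An Q b) = tree_mean (fun b => G b * Zs Q b).
Proof.
elim: m => [|m IH]; first by apply: eq_Ex => b _; rewrite An0.
rewrite -IH -[RHS](trace_Ex (fun b => G (trm b) * An Q b)).
pose f : gcode (m + k).+1 -> R := fun b => G (trm (trb b)) * @An k m.+1 Q b.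
pose g : gcode (m + k).+1 -> R := fun b => G (trm (trb b)) * @An k m Q (trb b).
rewrite -[LHS]/(tree_mean f) -[RHS]/(tree_mean g); apply/eqP; rewrite -subr_eq0 -ExB; apply/eqP.
pose D (b : gcode (m + k).+1) : R := Zs (fun w => (fun w' => Q (take k w')) (take (m + k) w)) b
     - al * Zs (fun w => Q (take k w)) (trb b).
transitivity (tree_mean (fun b : gcode (m + k).+1 => al ^- m.+1 * (G (trm (trb b)) * D b))).
  by apply: eq_Ex => b _; rewrite /f /g -mulrBr An_step mulrCA.
rewrite ExZ.
by rewrite (step_mean (fun w' => Q (take k w')) (fun b => G (trm b))) mulr0.
Qed.

(** Increments are orthogonal. The step from j to j+1 adds at most 1000 alpha^(-j-2) W, where W is
    the mean on the right, and these sum to 1000 (1 - alpha^(-m)) W / (alpha (alpha - 1)), with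
    alpha (alpha - 1) > 2. *)
Lemma An_var k m Q (G : gcode k -> R) : (forall b, treeb b -> 0 <= G b) ->
  tree_mean (fun b : gcode (m + k) => G (trm b) * (An Q b - Zs Q (trm b)) ^+ 2) <=
  500 * (1 - al ^- m) * tree_mean (fun b => G b * Zs Q b).
Proof.
move=> G0; elim: m => [|m IH].
  rewrite expr0 invr1 subrr mulr0 mul0r.
  by rewrite (eq_Ex (g := fun=> 0)) ?Ex_cst // => b _; rewrite An0 subrr expr0n mulr0.
set W := tree_mean (fun b => G b * Zs Q b) in IH *.
have W0 : 0 <= W by apply: Ex_ge0 => b Hb; apply: mulr_ge0; [exact: G0|exact: Zs_ge0].
pose D (b : gcode (m + k).+1) : R := Zs (fun w => (fun w' => Q (take k w')) (take (m + k) w)) b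
     - al * Zs (fun w => Q (take k w)) (trb b).
have Emix : tree_mean (fun b : gcode (m + k).+1 => (G (trm (trb b)) * (An Q (trb b) - Zs Q (trm (trb b)))) * D b) = 0.
  exact: (step_mean (fun w' => Q (take k w')) (fun b => G (trm b) * (An Q b - Zs Q (trm b)))).
have Evar : tree_mean (fun b : gcode (m + k).+1 => G (trm (trb b)) * D b ^+ 2) <= 1000 * (al ^+ m * W).
  apply: (le_trans (step_var (fun w' => Q (take k w')) (G := fun b => G (trm b)) _)).
    by move=> b Hb; apply/G0/trm_tree.
  apply: ler_wpM2l; first exact: ler0n.
  rewrite /W -(An_mean m Q G) -ExZ; apply: le_Ex => b _.
  by rewrite /An (mulrCA (al ^+ m)) (mulVKf (expf_neq0 m al_neq0)).
pose f0 : gcode (m + k) -> R := fun b => G (trm b) * (An Q b - Zs Q (trm b)) ^+ 2.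
pose f1 : gcode (m + k).+1 -> R := fun b => G (trm (trb b)) * (@An k m.+1 Q b - Zs Q (trm (trb b))) ^+ 2.
pose c := al ^- m.+1.
have E1 : tree_mean f1 = tree_mean f0 + c ^+ 2 * tree_mean (fun b : gcode (m + k).+1 => G (trm (trb b)) * D b ^+ 2).
  rewrite -(trace_Ex f0).
  transitivity (tree_mean (fun b : gcode (m + k).+1 => f0 (trb b) + (c ^+ 2 * (G (trm (trb b)) * D b ^+ 2) +
     2 * c * ((G (trm (trb b)) * (An Q (trb b) - Zs Q (trm (trb b)))) * D b)))).
    apply: eq_Ex => b _; rewrite /f1 /f0.
    have -> : @An k m.+1 Q b = An Q (trb b) + c * D b by rewrite /D /c -An_step addrC subrK.
    by ring.
  by rewrite !ExD !ExZ Emix mulr0 addr0.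
rewrite -[X in X <= _]/(tree_mean f1) E1.
apply: (le_trans (lerD IH (ler_wpM2l _ Evar))); first exact: sqr_ge0.
have /andP[a2 a3] := alpha_bounds R.
have -> : c ^+ 2 * (1000 * (al ^+ m * W)) = 1000 * (al ^- m * al^-1 * al^-1) * W.
  rewrite /c (exprS al m); have := expf_neq0 m al_neq0; have := al_neq0.
  by move: (al) (al ^+ m) => a x a0 x0; field; rewrite a0 x0.
have q0 : 0 < al ^- m by rewrite invr_gt0 exprn_gt0 // al_gt0.
have -> : al ^- m.+1 = al ^- m * al^-1 by rewrite exprSr invfM mulrC.
rewrite -mulrDl; apply: ler_wpM2r => //.
have i0 : 0 < al^-1 by rewrite invr_gt0 al_gt0.
have i2 : al^-1 < 2^-1 by rewrite ltf_pV2 ?posrE //; lra.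
move: (al ^- m) (al^-1) q0 i0 i2 => x y x0 y0 y2.
(* The induction step reduces to 2 y^2 + y - 1 <= 0 for y = 1/alpha, and the left side is -2 (1/2 -
   y) (y + 1). *)
have : 0 <= x * ((2^-1 - y) * (y + 1)) by do !apply: mulr_ge0; lra.
lra.
Qed.

End Moments.

(** * Moments of the population, energies, and the probability of a small mass *)

Section MomentBounds.
Variable R : realType.
Implicit Types (v u : seq 'I_3) (Q : pred (seq 'I_3)).
Local Notation treeb := (@treeb R _).
Local Notation hw := (@hw R _).
Local Notation al := (alpha R).

Variable p : nat -> R.
Hypothesis p_ge0 : forall n, 0 <= p n.
Hypothesis trace_tree : forall n (b : gcode n.+1), treeb b -> treeb (trb b).
Hypothesis trace_surj : forall n (b : gcode n), treeb b -> exists2 b', treeb b' & trb b' = b.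
Local Notation Ex := (@tree_mean R p).
Hypothesis trace_Ex : forall n (f : gcode n -> R), Ex (fun b => f (trb b)) = Ex f.
Hypothesis Ex1 : forall n, @tree_mean R p n (fun=> 1) = 1.

(** The exhaustive check speaks of traces of trees; surjectivity of the trace extends it to every
    tree. *)
Lemma crossed_hw n (b : gcode n) v : treeb b -> size v = n -> crossed R b v -> 1 <= hw b v.
Proof.
move=> /trace_surj [b' Hb' <-] Sv Hx.
by have [-> /wt_ge1] := crossed_rows trace_tree Hb' Sv Hx.
Qed.

Lemma crossed_children n (b : gcode n.+1) v : treeb b -> size v = n -> crossed R (trb b) v ->
  2 <= \sum_(i <- iota 0 3) (crossed R b (rcons v (inord i)))%:R :> R.
Proof.
move=> Hb Sv Hx; have Ht := trace_tree Hb.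
have [s3 s3' _ _] := gates Ht Sv Hx.
have := all_crossingsP all_types_ok (size_map _ _ : size (lb (trb b) v) = 3%N) (lb_proper Hb Sv)
  (size_map _ _ : size (ob R (trb b) v) = 3%N) s3 s3' (crossingP Hb Ht Sv Hx).
rewrite /types_ok => /allP H.
have : gb b v \in fiber (lb (trb b) v).
  by rewrite lb_trb //; apply: mem_fiber => //; apply: piece_Q1 Hb Sv.
move/H => /andP[Hc _].
apply: (@le_trans _ _ ((count (fun x => x.2 != 0%N) [seq ty1 (gb b v) (ob R (trb b) v)
  (gate (trb b) v (corner R i1)) (gate (trb b) v (corner R i2)) i | i <- iota 0 3])%:R)).
  by rewrite ler_nat.
rewrite -sum1_count natr_sum big_map big_mkcond big_seq [leRHS]big_seq.
apply: ler_sum => i; rewrite mem_iota => i3'.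
case: ifP => // H2; rewrite (_ : crossed R b _ = true) //.
rewrite -(ty_child Hb Ht Sv i3' Hx) in H2.
apply: contraT => Nx; rewrite ty_uncrossed ?eqxx // in H2.
by rewrite size_rcons Sv.
Qed.

Lemma root_crossed (b : gcode 0) : crossed R b [::].
Proof.
apply/asboolP => /cn_touchl [/(congr1 (fun x => x.1)) /= E|[y [u [/size0nil-> []//]]]].
by have /eqP := E; rewrite eq_sym oner_eq0.
Qed.

Lemma crossed_count n (b : gcode n) : treeb b ->
  2 ^+ n <= \sum_(v : n.-tuple 'I_3) (crossed R b v)%:R :> R.
Proof.
elim: n b => [|n IH] b Hb.
  by rewrite expr0 (bigD1 [tuple]) //= root_crossed lerDl; apply: sumr_ge0.
have := sum_rcons n xpredT (fun w => (crossed R b w)%:R : R) => /= ->.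
rewrite exprS; apply: le_trans (ler_wpM2l _ (IH _ (trace_tree Hb))) _; first exact: ler0n.
rewrite mulr_sumr; apply: ler_sum => v _.
have [Hx|Hx] := boolP (crossed R (trb b) v); last by rewrite mulr0; apply: sumr_ge0.
by rewrite mulr1; apply: crossed_children; rewrite ?size_tuple.
Qed.

Lemma crossed_le_Zs n (b : gcode n) Q : treeb b ->
  \sum_(v : n.-tuple 'I_3 | Q v) (crossed R b v)%:R <= Zs R Q b.
Proof.
move=> Hb; apply: ler_sum => v _.
have [Hx|_] := boolP (crossed R b v); last exact: wt_ge0.
by apply: crossed_hw; rewrite ?size_tuple.
Qed.

Lemma Zs_pow2 n (b : gcode n) : treeb b -> 2 ^+ n <= Zs R xpredT b.
Proof. by move=> Hb; apply: le_trans (crossed_count Hb) _; apply: crossed_le_Zs. Qed.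

Lemma Ex_Zs n : Ex (Zs R xpredT : gcode n -> R) <= 10 * al ^+ n.
Proof.
elim: n => [|n IH].
  rewrite expr0 mulr1 -[X in _ <= X](Ex_cst Ex1 0); apply: le_Ex => // b _.
  rewrite /Zs (bigD1 [tuple]) //= big1 ?addr0; first exact: wt_le.
  by move=> v /negP[]; apply/eqP/val_inj; case: v => -[].
have := step_mean p trace_tree xpredT (fun _ : gcode n => 1); rewrite /=.
under eq_Ex => b _ do rewrite mul1r.
rewrite ExB => /eqP; rewrite subr_eq0 => /eqP ->.
rewrite (trace_Ex (fun b => al * Zs R xpredT b)) ExZ exprS.
move: IH; move: (Ex _) (al_gt0 R) (al ^+ n) => x a0 y IH.
by rewrite (mulrCA 10); apply: ler_wpM2l => //; apply: ltW.
Qed.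

Lemma Zs_pred1 n (u : n.-tuple 'I_3) (b : gcode n) : Zs R (pred1 (u : seq _)) b = hw b u.
Proof. by rewrite /Zs (big_pred1 u). Qed.

Lemma Ex_An_sq k m (u : k.-tuple 'I_3) :
  Ex (fun b : gcode (m + k) => An R (pred1 (u : seq _)) b ^+ 2) <= 1020 * Ex (fun b : gcode k => hw b u).
Proof.
set Q := pred1 (u : seq _).
(* From x^2 <= 2 (x - y)^2 + 2 y^2; the variance bound 500 W and weights at most 10 give 1020 = 2 *
   500 + 2 * 10. *)
apply: (@le_trans _ _ (2 * Ex (fun b : gcode (m + k) => 1 * (An R Q b - Zs R Q (trm b)) ^+ 2) +
   2 * Ex (fun b : gcode k => hw b u ^+ 2))).
  rewrite -(trm_Ex trace_Ex m (fun b => hw b u ^+ 2)) -!ExZ -ExD; apply: le_Ex => // b _.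
  rewrite Zs_pred1; set x := An _ _ _; set y := hw _ _.
  have := sqr_ge0 (x - 2 * y).
  by rewrite (_ : 2 * (1 * (x - y) ^+ 2) + 2 * y ^+ 2 = x ^+ 2 + (x - 2 * y) ^+ 2); [rewrite lerDl|ring].
have V := An_var p_ge0 trace_tree trace_Ex Ex1 m Q (G := fun _ : gcode k => 1) (fun _ _ => ler01).
have E1 : Ex (fun b : gcode k => 1 * Zs R Q b) = Ex (fun b : gcode k => hw b u).
  by apply: eq_Ex => b _; rewrite mul1r Zs_pred1.
rewrite E1 in V; set W := Ex (fun b : gcode k => hw b u) in V *.
have W0 : 0 <= W by apply: Ex_ge0 => // b _; apply: wt_ge0.
have V' : 500 * (1 - al ^- m) * W <= 500 * W.
  apply: ler_wpM2r => //; have : 0 < al ^- m by rewrite invr_gt0 exprn_gt0 // al_gt0.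
  by move: (al ^- m) => x; lra.
have S : Ex (fun b : gcode k => hw b u ^+ 2) <= 10 * W.
  rewrite -ExZ; apply: le_Ex => // b _; rewrite expr2; apply: ler_wpM2r; [exact: wt_ge0|exact: wt_le].
move: V V' S; move: (500 * (1 - al ^- m) * W) => z; move: (Ex _) (Ex _) => x y; lra.
Qed.

Definition energy_at n k (b : gcode n) : R :=
  \sum_(u : k.-tuple 'I_3) (al ^- n * Zs R (fun w => take k w == u) b) ^+ 2.

(** A cell has second moment at most 1020 alpha^(-2k) times its mean weight, and the mean weights of
    level [k] sum to at most 10 alpha^k. *)
Lemma Ex_energy_at n k : (k <= n)%N -> Ex (energy_at k : gcode n -> R) <= 10200 * al ^- k.
Proof.
move=> Hkn; have [m ->] : exists m, n = (m + k)%N by exists (n - k)%N; rewrite subnK.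
rewrite Ex_sum.
have k0 := expf_neq0 k (al_neq0 R).
apply: (@le_trans _ _ (\sum_(u : k.-tuple 'I_3) al ^- k ^+ 2 * (1020 * Ex (fun b : gcode k => hw b u)))).
  apply: ler_sum => u _.
  apply: (@le_trans _ _ (al ^- k ^+ 2 * Ex (fun b : gcode (m + k) => An R (pred1 (u : seq _)) b ^+ 2))).
    rewrite -ExZ; apply: le_Ex => // b _; rewrite -exprMn /An mulrA.
    by rewrite exprD invfM (mulrC (al ^- m)).
  by apply: ler_wpM2l; [exact: sqr_ge0|exact: Ex_An_sq].
rewrite -mulr_sumr -mulr_sumr -Ex_sum -[X in _ * (_ * X)]/(Ex (Zs R xpredT : gcode k -> R)).
apply: (@le_trans _ _ (al ^- k ^+ 2 * (1020 * (10 * al ^+ k)))).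
  apply: ler_wpM2l; first exact: sqr_ge0.
  by apply: ler_wpM2l; [exact: ler0n|exact: Ex_Zs].
move: k0; move: (al ^+ k) => x x0.
by have -> : x^-1 ^+ 2 * (1020 * (10 * x)) = 10200 * x^-1 by field.
Qed.

(** For [r] = 2^s a discrete s-energy: the factor of level [k] is the diameter of its cells to the
    power -s. For [r] < alpha the mean is bounded by a geometric series. *)
Definition energy (r : R) n (b : gcode n) : R := \sum_(k < n.+1) r ^+ k * energy_at k b.

Lemma Ex_energy r n : 0 < r -> r < al -> Ex (fun b : gcode n => energy r b) <= 10200 / (1 - r / al).
Proof.
move=> r0 ra; rewrite Ex_sum.
have a0 := al_gt0 R; set x := r / al.
have x0 : 0 < x by apply: divr_gt0.
have x1 : x < 1 by rewrite ltr_pdivrMr // mul1r.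
apply: (@le_trans _ _ (\sum_(k < n.+1) 10200 * x ^+ k)).
  apply: ler_sum => k _; rewrite ExZ exprMn exprVn [leRHS]mulrCA.
  by apply: ler_wpM2l; [apply/exprn_ge0/ltW|apply: Ex_energy_at; rewrite -ltnS].
rewrite -mulr_sumr; apply: ler_wpM2l; first exact: ler0n.
rewrite -[X in _ <= X]mul1r ler_pdivlMr ?subr_gt0 //.
have -> : (\sum_(k < n.+1) x ^+ k) * (1 - x) = 1 - x ^+ n.+1.
  by rewrite mulrC -opprB mulNr -subrX1 opprB.
by rewrite gerBl exprn_ge0 // ltW.
Qed.

(** Chebyshev's inequality given T_k: the normalised population has mean Z_k >= 2^k and variance at
    most 500 Z_k, so it falls below Z_k / 2 with probability at most 4 * 500 / Z_k <= 2000 / 2^k. *)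
Lemma Ex_small k n : (k <= n)%N ->
  Ex (fun b : gcode n => (al ^- n * Zs R xpredT b < al ^- k * (2 ^+ k / 2))%R%:R) <= 2000 / 2 ^+ k.
Proof.
move=> Hkn; have [m ->] : exists m, n = (m + k)%N by exists (n - k)%N; rewrite subnK.
have k0 := expf_neq0 k (al_neq0 R).
have q0 : 0 < al ^- k by rewrite invr_gt0 exprn_gt0 // al_gt0.
(* The factor in Chebyshev's inequality depends on T_k; this is why [An_var] admits a weight. *)
pose G (b : gcode k) : R := 4 / Zs R xpredT b ^+ 2.
have Z0 b : treeb b -> 0 < Zs R xpredT (b : gcode k).
  by move/Zs_pow2; apply: lt_le_trans; apply: exprn_gt0.
have G0 b : treeb b -> 0 <= G b.
  by move=> Hb; apply: divr_ge0; [exact: ler0n|exact: sqr_ge0].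
apply: (@le_trans _ _ (Ex (fun b : gcode (m + k) => G (trm b) * (An R xpredT b - Zs R xpredT (trm b)) ^+ 2))).
  apply: le_Ex => // b Hb; have Ht := trm_tree trace_tree Hb.
  case: ltP => [H|_] /=; last by apply: mulr_ge0; [exact: G0|exact: sqr_ge0].
  have zk := Zs_pow2 Ht; have z0 := Z0 _ Ht; rewrite /G; set z := Zs _ _ (trm b) in zk z0 *.
  have H' : An R xpredT b < z / 2.
    have : An R xpredT b < 2 ^+ k / 2.
      rewrite -(ltr_pM2l q0) /An mulrA; move: H; rewrite exprD invfM (mulrC (al ^- m)); exact.
    by move: (An _ _ _) => y; lra.
  rewrite mulrAC ler_pdivlMr ?exprn_gt0 // mul1r.
  move: (An R xpredT b) H' => y H'; nra.
apply: (le_trans (An_var p_ge0 trace_tree trace_Ex Ex1 m xpredT G0)).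
have HG : Ex (fun b : gcode k => G b * Zs R xpredT b) <= 4 / 2 ^+ k.
  rewrite -[X in _ <= X](Ex_cst Ex1 k); apply: le_Ex => // b Hb.
  have zk := Zs_pow2 Hb; have z0 := Z0 _ Hb; rewrite /G; set z := Zs _ _ b in zk z0 *.
  rewrite expr2 invfM mulrA mulfVK ?gt_eqF //; apply: ler_wpM2l; first exact: ler0n.
  by rewrite lef_pV2 ?posrE // exprn_gt0.
have W0 : 0 <= Ex (fun b : gcode k => G b * Zs R xpredT b).
  by apply: Ex_ge0 => // b Hb; apply: mulr_ge0; [exact: G0|exact: Zs_ge0].
have m0 : 0 < al ^- m by rewrite invr_gt0 exprn_gt0 // al_gt0.
apply: (@le_trans _ _ (500 * Ex (fun b : gcode k => G b * Zs R xpredT b))).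
  by apply: ler_wpM2r => //; move: (al ^- m) m0 => x; lra.
move: HG; move: (Ex _) => x; rewrite -(mulr1 4) -mulrA => H.
by have : 500 * x <= 500 * (4 * (1 / 2 ^+ k)); [lra|rewrite mul1r mulrA -natrM].
Qed.

End MomentBounds.

(** * Uniform spanning trees *)

Section Random.
Variables (R : realType) (d : measure_display) (Omega : measurableType d) (P : probability Omega R).
Variable T : nat -> Omega -> set (set (pt R)).
Hypothesis UST : consistent_UST P T.
Local Notation gr := (@gr R _).
Local Notation treeb := (@treeb R _).

Definition tree_prob n : R := (#|` fset_set [set t' | @spanning_tree R n t']|%fset)%:R^-1.
Local Notation p := tree_prob.
Local Notation Ex := (@tree_mean R p).

Definition tcode n (w : Omega) : gcode n := enc n (T n w).

Lemma tcodeK n w : gr (tcode n w) = T n w.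
Proof. by case: UST => H _ _; apply: encK; case: (H n w). Qed.

Lemma tcode_tree n w : treeb (tcode n w).
Proof. by apply/asboolP; rewrite tcodeK; case: UST. Qed.

Lemma tcode_trb n w : trb (tcode n.+1 w) = tcode n w.
Proof.
apply: (@gr_inj R); rewrite -Tr_gr ?tcode_tree // !tcodeK.
by case: UST => _ _ H; rewrite -H.
Qed.

Lemma tcodeE n w b : (tcode n w == b) <-> T n w = gr b.
Proof.
split=> [/eqP <-|E]; first by rewrite tcodeK.
by apply/eqP/(@gr_inj R); rewrite tcodeK.
Qed.

Lemma tree_prob_ge0 n : 0 <= p n. Proof. by rewrite invr_ge0. Qed.

Lemma tcode_eq n b : treeb b ->
  measurable [set w | tcode n w == b] /\ P [set w | tcode n w == b] = (p n)%:E.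
Proof.
move=> /asboolP Hb; have -> : [set w | tcode n w == b] = [set w | T n w = gr b].
  by apply/seteqP; split=> w /= /tcodeE.
by case: UST => _ H _; exact: H.
Qed.

Lemma tcode_seq n (s : seq (gcode n)) : uniq s -> all treeb s ->
  measurable [set w | tcode n w \in s] /\
  P [set w | tcode n w \in s] = (\sum_(b <- s) p n)%:E.
Proof.
elim: s => [|b s IH] /=.
  rewrite big_nil (_ : [set w | _] = set0); first by rewrite measure0.
  by apply/seteqP; split.
move=> /andP[Hb Us] /andP[/tcode_eq [mb Pb] /(IH Us) [ms Ps]].
have -> : [set w | tcode n w \in b :: s] = [set w | tcode n w == b] `|` [set w | tcode n w \in s].
  by apply/seteqP; split=> w /=; rewrite inE => /orP.
split; first exact: measurableU.
have D : [set w | tcode n w == b] `&` [set w | tcode n w \in s] = set0.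
  by apply/seteqP; split=> w //= [/eqP E]; rewrite E (negbTE Hb).
have -> := measureU P mb ms D.
by rewrite big_cons EFinD; congr (_ + _)%E; [exact: Pb|exact: Ps].
Qed.

(** Measurability is given for single trees; events determined by T_n are finite disjoint unions of
    these. *)
Lemma tcode_pred n (S : pred (gcode n)) :
  measurable [set w | S (tcode n w)] /\
  P [set w | S (tcode n w)] = (Ex (fun b : gcode n => (S b)%:R))%:E.
Proof.
pose s := [seq b <- enum {: gcode n} | treeb b && S b].
have -> : [set w | S (tcode n w)] = [set w | tcode n w \in s].
  by apply/seteqP; split=> w /=; rewrite mem_filter mem_enum tcode_tree andbT.
have Us : uniq s by rewrite filter_uniq ?enum_uniq.
have As : all treeb s by apply/allP => b; rewrite mem_filter => /andP[/andP[]].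
have [ms ->] := tcode_seq Us As; split=> //; congr (_%:E); rewrite big_filter big_enum_cond /= /tree_mean mulr_sumr.
rewrite [RHS](bigID S) /= [X in _ + X]big1 ?addr0; last first.
    by move=> b /andP[_ /negbTE->]; rewrite mulr0.
by apply: eq_bigr => b /andP[_ ->]; rewrite mulr1.
Qed.

Lemma tcode_Ex1 n : @tree_mean R p n (fun=> 1) = 1.
Proof.
have [_] := @tcode_pred n xpredT; rewrite (_ : [set w | _] = setT); last exact/seteqP.
by rewrite probability_setT => -[<-].
Qed.

Lemma tree_prob_neq0 n : p n != 0.
Proof.
apply/eqP => E; have := tcode_Ex1 n; rewrite /tree_mean E mul0r => /eqP.
by rewrite eq_sym oner_eq0.
Qed.

(** A tree has positive probability, hence is attained at some outcome; properties of the random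
    trees thereby become properties of all trees. *)
Lemma tree_realized n (b : gcode n) : treeb b -> exists w, tcode n w = b.
Proof.
move=> Hb; have [_ PE] := tcode_eq Hb.
have [[w /eqP Hw]|N] := pselect (exists w, tcode n w == b); first by exists w.
move: PE; rewrite (_ : [set w | _] = set0) ?measure0.
  by move=> -[/esym E]; have := tree_prob_neq0 n; rewrite E eqxx.
by apply/seteqP; split=> w //= Hw; case: N; exists w.
Qed.

Lemma trb_tree n (b : gcode n.+1) : treeb b -> treeb (trb b).
Proof. by move=> /tree_realized [w <-]; rewrite tcode_trb tcode_tree. Qed.

Lemma trb_surj n (b : gcode n) : treeb b -> exists2 b', treeb b' & trb b' = b.
Proof.
move=> /tree_realized [w <-]; exists (tcode n.+1 w); [exact: tcode_tree|exact: tcode_trb].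
Qed.

(** T_n is the trace of T_(n+1), so the trees of level n+1 with trace [b] have total probability
    [p n]. *)
Lemma trb_Ex n (f : gcode n -> R) : Ex (fun b => f (trb b)) = Ex f.
Proof.
rewrite /tree_mean (partition_big (@trb n) treeb) /=; last by move=> b; apply: trb_tree.
rewrite !mulr_sumr; apply: eq_bigr => b Hb.
have -> : \sum_(b' : gcode n.+1 | treeb b' && (trb b' == b)) f (trb b') =
    \sum_(b' : gcode n.+1 | treeb b') (trb b' == b)%:R * f b.
  rewrite [RHS](bigID (fun b' => trb b' == b)) /= [X in _ + X]big1 ?addr0.
    by apply: eq_bigr => b' /andP[_ /eqP E]; rewrite E eqxx mul1r.
  by move=> b' /andP[_ /negbTE->]; rewrite mul0r.
rewrite -mulr_suml mulrA; congr (_ * _).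
have [_ E1] := tcode_pred (fun b' : gcode n.+1 => trb b' == b).
have [_ E2] := tcode_eq Hb.
have : (p n)%:E = (Ex (fun b' : gcode n.+1 => (trb b' == b)%:R))%:E.
  by rewrite -E1 -E2; congr (P _); apply/seteqP; split=> w /=; rewrite tcode_trb.
by move=> -[->].
Qed.

(** For fixed [j], failure from some level on is an increasing union of events of probability at
    most 1/(j+1); failure for every [j] is therefore null. *)
Lemma ae_infinitely_often (B : nat -> forall n, pred (gcode n)) :
  (forall j, exists N, forall n, (N <= n)%N ->
     Ex (fun b : gcode n => (~~ B j n b)%:R) <= j.+1%:R^-1) ->
  {ae P, forall w, exists j, forall N, exists2 n, (N <= n)%N & B j n (tcode n w)}.
Proof.
move=> HB.
pose F j N := \bigcap_(n in [set n | (N <= n)%N]) [set w | ~~ B j n (tcode n w)].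
have mB j n : measurable [set w | ~~ B j n (tcode n w)].
  by have [] := tcode_pred (fun b => ~~ B j n b).
have mF j N : measurable (F j N) by apply: bigcap_measurable => [|n _]; [exists N => /=|exact: mB].
have mU j : measurable (\bigcup_N F j N) by apply: bigcupT_measurable.
have PF j N : (P (F j N) <= (j.+1%:R^-1)%:E)%E.
  have [M HM] := HB j; pose n := maxn M N.
  apply: (@le_trans _ _ (P [set w | ~~ B j n (tcode n w)])).
    by apply: le_measure; rewrite ?inE //; move=> w; apply; rewrite /= leq_maxr.
  have [_ ->] := tcode_pred (fun b => ~~ B j n b).
  by rewrite lee_fin HM // leq_maxl.
have PU j : (P (\bigcup_N F j N) <= (j.+1%:R^-1)%:E)%E.
  have nd : {homo F j : n m / (n <= m)%N >-> (n <= m)%O}.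
    move=> n m nm; apply/subsetPset => w Hw k /= mk; apply: Hw => /=.
    exact: leq_trans mk.
  have C := @nondecreasing_cvg_mu _ _ _ P _ (mF j) (mU j) nd.
  rewrite -(cvg_lim _ C) //; apply: lime_le; first by apply/cvg_ex; exists (P (\bigcup_N F j N)).
  by near=> N; apply: PF.
exists (\bigcap_j \bigcup_N F j N); split.
- exact: bigcapT_measurable.
- apply/eqP; rewrite eq_le measure_ge0 andbT; apply/lee_addgt0Pr => e e0; rewrite add0e.
  have [j Hj] : exists j, j.+1%:R^-1 <= e.
    exists (Num.truncn e^-1); rewrite -[leRHS]invrK lef_pV2 ?posrE ?invr_gt0 //.
    by apply/ltW; apply: truncnS_gt.
  apply: (@le_trans _ _ (P (\bigcup_N F j N))).
    by apply: le_measure; rewrite ?inE //; [exact: bigcapT_measurable|move=> w; apply].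
  by apply: le_trans (PU j) _; rewrite lee_fin.
- move=> w /= Hw j _; apply: contrapT => N0; apply: Hw; exists j => N.
  apply: contrapT => N1; apply: N0; exists N => // n /= Hn.
  by apply/negP => HBn; apply: N1; exists n.
Unshelve. all: by end_near. Qed.

End Random.

(** * Distances and cells *)

Lemma mod8_near a b : (a = b %[mod 8])%N -> (a < b + 8)%N -> (b < a + 8)%N -> a = b :> nat.
Proof.
move=> E; rewrite (divn_eq a 8) (divn_eq b 8) E.
move: (b %% 8)%N (ltn_pmod b (isT : (0 < 8)%N)) => r.
move: (a %/ 8)%N (b %/ 8)%N => x y; lia.
Qed.

Section Distance.
Variable R : realType.
Implicit Types (x y z : pt R) (v u : seq 'I_3).

Lemma dist_ge0 x y : 0 <= dist x y. Proof. exact: sqrtr_ge0. Qed.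

Lemma dist_sq x y : dist x y ^+ 2 = (x.1 - y.1) ^+ 2 + (x.2 - y.2) ^+ 2.
Proof. by rewrite sqr_sqrtr // addr_ge0 // sqr_ge0. Qed.

Lemma dist_sym x y : dist x y = dist y x.
Proof. by rewrite /dist -(sqrrN (x.1 - y.1)) -(sqrrN (x.2 - y.2)) !opprB. Qed.

Lemma dist_le x y c : 0 <= c -> (x.1 - y.1) ^+ 2 + (x.2 - y.2) ^+ 2 <= c ^+ 2 -> dist x y <= c.
Proof. by move=> c0 H; rewrite -(ler_pXn2r (n := 2)) ?nnegrE ?dist_ge0 // dist_sq. Qed.

Lemma dist_triangle y x z : dist x z <= dist x y + dist y z.
Proof.
apply: dist_le; first by rewrite addr_ge0 ?dist_ge0.
have := dist_sq x y; have := dist_sq y z; have := dist_ge0 x y; have := dist_ge0 y z.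
move: (dist x y) (dist y z) => p q q0 p0 Eq Ep.
set a := x.1 - y.1 in Ep; set b := x.2 - y.2 in Ep.
set c := y.1 - z.1 in Eq; set e := y.2 - z.2 in Eq.
have -> : x.1 - z.1 = a + c by rewrite /a /c; ring.
have -> : x.2 - z.2 = b + e by rewrite /b /e; ring.
have H : a * c + b * e <= p * q.
  have [|/ltW s0] := leP (a * c + b * e) 0; first by move/le_trans; apply; rewrite mulr_ge0.
  rewrite -(ler_pXn2r (n := 2)) ?nnegrE ?mulr_ge0 // exprMn Ep Eq.
  have := sqr_ge0 (a * e - b * c); nra.
nra.
Qed.

Lemma dist_coord1 x y : `|x.1 - y.1| <= dist x y.
Proof.
rewrite -(ler_pXn2r (n := 2)) ?nnegrE ?dist_ge0 // dist_sq real_normK ?num_real //.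
by rewrite lerDl sqr_ge0.
Qed.

Lemma dist_coord2 x y : `|x.2 - y.2| <= dist x y.
Proof.
rewrite -(ler_pXn2r (n := 2)) ?nnegrE ?dist_ge0 // dist_sq real_normK ?num_real //.
by rewrite lerDr sqr_ge0.
Qed.

Lemma dist_le_coord x y : dist x y <= `|x.1 - y.1| + `|x.2 - y.2|.
Proof.
apply: dist_le; first by rewrite addr_ge0.
rewrite -(real_normK (num_real (x.1 - y.1))) -(real_normK (num_real (x.2 - y.2))).
have := normr_ge0 (x.1 - y.1); have := normr_ge0 (x.2 - y.2); nra.
Qed.

Lemma bary_dist x y k : (0 < k < 3)%N -> `|bary x k - bary y k| <= 2 * dist x y.
Proof.
have s1 : (Num.sqrt 3)^-1 <= 1 :> R.
  rewrite invf_le1 ?sqrt3_gt0 // -[leLHS]sqrtr1 ler_wsqrtr //; lra.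
have s0 : 0 <= (Num.sqrt 3)^-1 :> R by rewrite invr_ge0 sqrtr_ge0.
have H2 : `|(x.2 - y.2) / Num.sqrt 3| <= dist x y.
  rewrite normrM (ger0_norm s0); apply: le_trans (dist_coord2 x y).
  by rewrite ler_piMr.
case: k => [|[|[|k]]] // _; rewrite /bary.
- have -> : x.1 - x.2 / Num.sqrt 3 - (y.1 - y.2 / Num.sqrt 3) = (x.1 - y.1) - (x.2 - y.2) / Num.sqrt 3 by ring.
  apply: (le_trans (ler_normB _ _)); have := dist_coord1 x y; lra.
- have -> : 2 * x.2 / Num.sqrt 3 - 2 * y.2 / Num.sqrt 3 = 2 * ((x.2 - y.2) / Num.sqrt 3) by ring.
  by rewrite normrM ger0_norm //; apply: ler_wpM2l.
Qed.

Definition cell v : set (pt R) := psiw v @` (@Tri R).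

Lemma dist_psi i x y : dist (psi i x) (psi i y) = dist x y / 2.
Proof.
apply: (@pexpIrn _ 2) => //; rewrite ?nnegrE ?dist_ge0 ?divr_ge0 ?dist_ge0 //.
by rewrite dist_sq expr_div_n dist_sq /psi /=; field.
Qed.

Lemma dist_psiw v x y : dist (psiw v x) (psiw v y) = dist x y / 2 ^+ size v.
Proof.
elim: v => [|i v IH] /=; first by rewrite expr0 divr1.
by rewrite dist_psi IH exprSr invfM mulrA.
Qed.

Lemma Tri_diam x y : Tri x -> Tri y -> dist x y <= 1.
Proof.
move=> Hx Hy; apply: dist_le => //; rewrite expr1n.
have s0 := sqrt3_neq0 R.
have s3 : Num.sqrt 3 ^+ 2 = 3 :> R by rewrite sqr_sqrtr.
(* The squared distance is u^2 + u w + w^2 in two coordinate differences u and w, where u, w and u +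
   w lie in [-1, 1]. *)
have E : (x.1 - y.1) ^+ 2 + (x.2 - y.2) ^+ 2 =
    (bary x 1 - bary y 1) ^+ 2 + (bary x 1 - bary y 1) * (bary x 2 - bary y 2) + (bary x 2 - bary y 2) ^+ 2.
  rewrite /bary; move: (x.1) (x.2) (y.1) (y.2) => a b c e.
  transitivity ((a - c) ^+ 2 + (b - e) ^+ 2 * (3 / Num.sqrt 3 ^+ 2)); first by rewrite s3 divff // mulr1.
  by field.
rewrite E; have := bary_sum x; have := bary_sum y.
have := (Hx 0%N isT, Hx 1%N isT, Hx 2%N isT); have := (Hy 0%N isT, Hy 1%N isT, Hy 2%N isT).
move: (bary x 0) (bary x 1) (bary x 2) (bary y 0) (bary y 1) (bary y 2) => a0 a1 a2 c0 c1 c2.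
move=> [[p0 p1] p2] [[q0 q1] q2] S1 S2.
have : 0 <= a1 <= 1 by lra.
have : 0 <= a2 <= 1 by lra.
have : 0 <= c1 <= 1 by lra.
have : 0 <= c2 <= 1 by lra.
have B1 : -1 <= a1 - c1 <= 1 by lra.
have B2 : -1 <= a2 - c2 <= 1 by lra.
have B0 : -1 <= (a1 - c1) + (a2 - c2) <= 1 by lra.
move=> _ _ _ _; move: (a1 - c1) (a2 - c2) B1 B2 B0 => u w /andP[u1 u2] /andP[w1 w2] /andP[t1 t2].
case: (lerP 0 u) => Hu; case: (lerP 0 w) => Hw; nra.
Qed.

Lemma cell_diam v x y : cell v x -> cell v y -> dist x y <= (2 ^+ size v)^-1.
Proof.
case=> x' Hx <- [y' Hy <-]; rewrite dist_psiw -[leRHS]mul1r.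
by apply: ler_wpM2r; [rewrite invr_ge0 exprn_ge0|exact: Tri_diam].
Qed.

Lemma cell_take v k : cell v `<=` cell (take k v).
Proof.
move=> x [y Hy <-]; exists (psiw (drop k v) y); first exact: Tri_psiw.
by rewrite -psiw_cat cat_take_drop.
Qed.

Lemma psiw_comb v a b x y : a + b = 1 ->
  ptcomb a b (psiw v x) (psiw v y) = psiw v (ptcomb a b x y).
Proof.
move=> E; have {E} Eb : b = 1 - a by rewrite -E addrC addKr.
elim: v => //= i v <-; rewrite /psi /ptcomb /= Eb.
by congr (_, _); field.
Qed.

Lemma cell_comb v a b x y : 0 <= a -> 0 <= b -> a + b = 1 -> cell v x -> cell v y -> cell v (ptcomb a b x y).
Proof.
move=> a0 b0 E [x' Hx <-] [y' Hy <-]; exists (ptcomb a b x' y'); last by rewrite psiw_comb.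
move=> k k3; have -> : bary (ptcomb a b x' y') k = a * bary x' k + b * bary y' k.
  have Eb : b = 1 - a by rewrite -E addrC addKr.
  by rewrite /bary /ptcomb Eb; case: k {k3} => [|[|k]] /=; field; exact: sqrt3_neq0.
by rewrite addr_ge0 // mulr_ge0 //; [exact: Hx|exact: Hy].
Qed.

Lemma cell_pv v a : cell v (pv R v a).
Proof. by exists (P6 R a) => //; apply: Tri_P6. Qed.

(* The barycentric coordinate k of psi_v(u_1), multiplied by 2 ^ (size v). *)
Fixpoint coord (k : nat) v : nat :=
  if v is i :: v' then ((val i == k) * 2 ^ size v' + coord k v')%N else 0%N.

Lemma coordE v k : (0 < k < 3)%N -> bary (pv R v 0) k = (coord k v)%:R / 2 ^+ size v.
Proof.
move=> /andP[k0 k3]; elim: v => [|i v IH].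
  by rewrite /pv /= bary_corner // mul0r gtn_eqF.
rewrite /pv /= bary_psi // -/(pv R v 0) IH natrD natrM natrX exprSr.
have x0 : 2 ^+ size v != 0 :> R by rewrite expf_neq0.
by rewrite eq_sym; move: (2 ^+ size v) x0 => x x0; field.
Qed.

(** If the words first differ in letters [i] and [j], a common point forces u_1 to be both the
    corner [i] and the corner [j]. *)
Lemma base_inj u v : size u = size v -> pv R u 0 = pv R v 0 -> u = v.
Proof.
elim: u v => [|i u IH] [|j v] //= [S] E.
have [Eij|N] := eqVneq i j.
  by subst j; rewrite (IH v S) //; apply: (@psi_inj R i).
have [E1 E2] := psi_overlap N (Tri_psiw u (Tri_P6 R 0)) (Tri_psiw v (Tri_P6 R 0)) E.
have := psiw_corner (Tri_P6 R 0) E1; have := psiw_corner (Tri_P6 R 0) E2.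
rewrite (corner_P6 R i) (corner_P6 R j) => Ei Ej.
have i0 : 0%N = i by apply: (P6_inj (R := R)); rewrite ?inE //; apply: lt3_6.
have j0 : 0%N = j by apply: (P6_inj (R := R)); rewrite ?inE //; apply: lt3_6.
by move/eqP: N; case; apply: val_inj; rewrite /= -i0 -j0.
Qed.

(** Two cell diameters and two distances to [z] put the base points within 4 times the scale; the
    coordinates are 2-Lipschitz, which gives 8. *)
Lemma coord_near u v k x y z : size u = size v -> (0 < k < 3)%N -> cell u x -> cell v y ->
  dist x z < (2 ^+ size u)^-1 -> dist y z < (2 ^+ size u)^-1 ->
  (coord k u < coord k v + 8)%N.
Proof.
move=> S Hk Hx Hy Dx Dy.
have Hx' := cell_diam (cell_pv u 0) Hx; have Hy' := cell_diam (cell_pv v 0) Hy.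
rewrite -S in Hy'.
have q0 : 0 < 2 ^+ size u :> R by rewrite exprn_gt0.
have D : dist (pv R u 0) (pv R v 0) < 4 * (2 ^+ size u)^-1.
  have T1 := dist_triangle x (pv R u 0) (pv R v 0).
  have T2 := dist_triangle z x (pv R v 0).
  have T3 := dist_triangle y z (pv R v 0).
  rewrite (dist_sym z y) in T3; rewrite (dist_sym y (pv R v 0)) in T3; lra.
have := bary_dist (pv R u 0) (pv R v 0) Hk; rewrite !coordE // -S => H.
have {}H : `|(coord k u)%:R / 2 ^+ size u - (coord k v)%:R / 2 ^+ size u| < 8 / 2 ^+ size u :> R.
  by apply: (le_lt_trans H); lra.
have : (coord k u)%:R - (coord k v)%:R < 8 :> R.
  rewrite -(ltr_pM2r (_ : 0 < (2 ^+ size u)^-1)) ?invr_gt0 // mulrBl.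
  exact: le_lt_trans (ler_norm _) H.
by rewrite ltrBlDr -(ltr_nat R) natrD addrC.
Qed.

(* Coordinates of nearby cells differ by less than 8, so residues modulo 8 separate them. *)
Lemma card_near k (S : {set k.-tuple 'I_3}) z :
  (forall u : k.-tuple 'I_3, u \in S -> exists2 x, cell u x & dist x z < (2 ^+ k)^-1) -> (#|S| <= 64)%N.
Proof.
move=> HS.
pose f (u : k.-tuple 'I_3) : 'I_8 * 'I_8 := (inord (coord 1 u %% 8), inord (coord 2 u %% 8)).
have <- : #|{: 'I_8 * 'I_8}| = 64%N by rewrite card_prod card_ord.
have finj : {in S &, injective f}.
  move=> u v Hu Hv [/(congr1 val) /= E1 /(congr1 val) /= E2].
  rewrite !inordK ?ltn_mod // in E1 E2.
  have [x Hx Dx] := HS _ Hu; have [y Hy Dy] := HS _ Hv.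
  have Su := size_tuple u; have Sv := size_tuple v.
  have H l : (0 < l < 3)%N -> (coord l u < coord l v + 8)%N /\ (coord l v < coord l u + 8)%N.
    move=> Hl; split; [apply: (coord_near (x := x) (y := y) (z := z))|apply: (coord_near (x := y) (y := x) (z := z))];
      by rewrite ?Su ?Sv.
  have [H11 H12] := H 1%N isT; have [H21 H22] := H 2%N isT.
  have C1 := mod8_near E1 H11 H12.
  have C2 := mod8_near E2 H21 H22.
  apply: val_inj; apply: base_inj; first by rewrite Su Sv.
  have B1 : bary (pv R u 0) 1 = bary (pv R v 0) 1 by rewrite !coordE // C1 Su Sv.
  have B2 : bary (pv R u 0) 2 = bary (pv R v 0) 2 by rewrite !coordE // C2 Su Sv.
  apply: bary_inj => -[|[|[|l]]] // _.
  have := bary_sum (pv R u 0); have := bary_sum (pv R v 0); lra.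
rewrite -(card_in_imset finj); exact: max_card.
Qed.

End Distance.

(** * The self-avoiding walk and its interpolation *)

Section Paths.
Variable R : realType.
Implicit Types (x y z : pt R) (v u : seq 'I_3).
Local Notation gr := (@gr R _).
Local Notation treeb := (@treeb R _).
Local Notation u1 := (corner R i1).
Local Notation u2 := (corner R i2).
Local Notation node p i := (nth (pt0 R) p i).

Lemma corner12 : u1 <> u2.
Proof. by move=> /(congr1 (fun x => x.1)) /= /eqP; rewrite eq_sym oner_eq0. Qed.

Section OneTree.
Variables (n : nat) (b : gcode n).
Hypothesis Hb : treeb b.
Let p := sawpath (gr b).

Lemma sawpath_saw : saw (gr b) u1 u2 p.
Proof.
have /treeP [_ Hc] := Hb.
have [q Hq] := cn_saw (Hc _ _ (corner_Cn R n i1) (corner_Cn R n i2)).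
exact: (@xgetI _ [::] [set q | saw (gr b) u1 u2 q] q Hq).
Qed.

Lemma sawpath_size : (1 < size p)%N.
Proof.
have [[Hs Hh Hl _] _] := sawpath_saw.
case: p Hs Hh Hl => [|x [|y q]] //= _ E1 E2.
by case: corner12; rewrite -E1 -E2.
Qed.

(** If the outside of the cell joined u_1 to u_2, it would bypass the edge together with the two
    remaining pieces of the path, contradicting acyclicity. *)
Lemma sawpath_edge i : (i.+1 < size p)%N -> exists v : n.-tuple 'I_3,
  [/\ crossed R b v, cell v (node p i) & cell v (node p i.+1)].
Proof.
move=> Hi; have [[Hs Hh Hl Hp] Hu] := sawpath_saw.
have s0 : ((size p).-1 < size p)%N by rewrite prednK.
have inj k l : (k < size p)%N -> (l < size p)%N -> node p k = node p l -> k = l.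
  by move=> Hk Hl' /eqP; rewrite nth_uniq // => /eqP.
have /grP [v [k [Sv k3 Hk E]]] := Hp i Hi.
have /eqP Sv' := Sv; exists (Tuple Sv') => /=.
have C : cell v (node p i) /\ cell v (node p i.+1).
  by case: (mkedge_eq E) => -[-> ->]; split; apply: cell_pv.
split; [|by case: C|by case: C].
have /treeP [Hbr _] := Hb.
apply/asboolP => Hc; apply: (Hbr _ _ (Hp i Hi)).
set t := _ `\ _.
have Hct : cn t u1 u2.
  apply: cn_sub Hc => e He; split; first by rewrite (level_split R _ Sv); right.
  by rewrite E => Ee; apply: (@Ed_notin_out R n (lb b) v k Sv k3); rewrite -Ee.
have step j : (j.+1 < size p)%N -> j <> i -> cn t (node p j) (node p j.+1).
  move=> Hj Nj; apply: cn1; split; first exact: Hp.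
  case/mkedge_eq => -[/inj E1 /inj E2]; first by apply: Nj; apply: E1; apply: ltnW.
  by have := E1 (ltnW Hj) Hi; have := E2 Hj (ltnW Hi); lia.
have pre j : (j <= i)%N -> cn t (node p 0) (node p j).
  elim: j => [|j IH] Hj; first exact: cn0.
  apply: cn_trans (IH (ltnW Hj)) (step j _ _); first exact: leq_ltn_trans Hj (ltnW Hi).
  by move=> Ej; rewrite Ej ltnn in Hj.
have post j : (i.+1 + j < size p)%N -> cn t (node p i.+1) (node p (i.+1 + j)).
  elim: j => [|j IH] Hj; first by rewrite addn0; exact: cn0.
  rewrite addnS in Hj *; apply: cn_trans (IH (ltnW Hj)) (step _ Hj _).
  by move=> Ej; have := leq_addr j i.+1; rewrite Ej ltnn.
have P1 : cn t u1 (node p i) by rewrite -Hh -nth0; apply: pre.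
have P2 : cn t (node p i.+1) u2.
  by rewrite -Hl -nth_last; have := post ((size p).-1 - i.+1)%N; rewrite subnKC //; [apply|rewrite -ltnS prednK].
apply: (cn_trans (cn_sym P1)); apply: (cn_trans Hct); exact: cn_sym.
Qed.

Lemma sawpath_node i : (i < size p)%N -> exists2 v : n.-tuple 'I_3, crossed R b v & cell v (node p i).
Proof.
case: i => [|i] Hi.
  by have [v [Hv C _]] := sawpath_edge sawpath_size; exists v.
by have [v [Hv _ C]] := sawpath_edge Hi; exists v.
Qed.

(** The direction used for the lower bound: a path without vertices in the cell would consist of
    outside edges. *)
Lemma crossed_node v : size v = n -> crossed R b v -> exists2 i, (i < size p)%N & cell v (node p i).
Proof.
move=> Sv /asboolP Hx; have [[Hs Hh Hl Hp] _] := sawpath_saw.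
apply: contrapT => N; apply: Hx.
rewrite -Hh -Hl -nth0 -nth_last; apply: walk_nth_cn; last by rewrite prednK.
move=> i Hi; have := Hp i Hi; rewrite {1}(level_split R b Sv) => -[He|//].
case: N; exists i; first exact: ltnW.
have [|a _ ->] := touch_LG (wf6_Lo _) (_ : touch (LG (pv R v) (Lo (lb b v))) (node p i)).
  by exists (node p i.+1).
exact: cell_pv.
Qed.

Lemma LI_cell t : (0 <= t)%E -> exists2 v : n.-tuple 'I_3, crossed R b v & cell v (LI p t).
Proof.
have [[Hs _ _ _] _] := sawpath_saw.
have Hlast : ((size p).-1 < size p)%N by rewrite prednK.
case: t => [s| |] //= s0; last exact: sawpath_node.
rewrite lee_fin in s0; rewrite ltNge s0 /=.
case: ifP => [Hk|_]; last exact: sawpath_node.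
have Hk' : ((Num.truncn s).+1 < size p)%N by rewrite -(prednK Hs) ltnS.
have [v [Hv C1 C2]] := sawpath_edge Hk'; exists v => //.
have /andP[t1 t2] := truncn_itv s0.
apply: cell_comb => //; rewrite ?subr_ge0 //; first exact: ltW.
by rewrite -[in X in X + _]addn1 natrD; ring.
Qed.

End OneTree.

Lemma LI_nat (p : seq (pt R)) i : (i < size p)%N -> LI p i%:R%:E = node p i.
Proof.
move=> Hi; rewrite /LI ltNge ler0n /= natrK.
case: ifP => [_|/negbT]; last by rewrite -leqNgt => H; congr nth; case: (size p) Hi H => //= m; lia.
rewrite -addn1 natrD subrr /ptcomb addrAC subrr add0r !mul1r !mul0r !addr0.
by case: (node p i).
Qed.

Lemma LI_end (p : seq (pt R)) s : (size p).-1%:R <= s -> LI p s%:E = LI p +oo.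
Proof.
move=> Hs; have s0 : 0 <= s by apply: le_trans Hs.
rewrite /LI ltNge s0 /=; case: ifP => // H.
by have := truncnS_gt s; rewrite ltNge (le_trans _ Hs) // ler_nat.
Qed.

Definition clamp (x : R) : R := Num.min 1 (Num.max 0 x).

Lemma clamp_lip (x y : R) : `|clamp x - clamp y| <= `|x - y|.
Proof.
rewrite /clamp; have := ler_norm (x - y); have := ler_norm (y - x); rewrite distrC.
rewrite ler_norml; case: (leP 0 x) => ?; case: (leP 0 y) => ?; 
  case: (leP 1 _) => ?; try case: (leP 1 _) => ?; move: (`|y - x|) => w *; apply/andP; split; lra.
Qed.

(** Writes the interpolation as a sum of clamped increments, for which a Lipschitz bound can be read
    off term by term. *)
Lemma clamp_sum (f : nat -> R) r s : 0 <= s ->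
  f 0%N + \sum_(j < r) clamp (s - j%:R) * (f j.+1 - f j) =
  let k := Num.truncn s in
  if (k < r)%N then (k.+1%:R - s) * f k + (s - k%:R) * f k.+1 else f r.
Proof.
move=> s0; set k := Num.truncn s => /=.
have /andP[t1 t2] := truncn_itv s0; rewrite -/k in t1 t2.
have low m : (m <= k)%N -> f 0%N + \sum_(j < m) clamp (s - j%:R) * (f j.+1 - f j) = f m.
  move=> Hm; elim: m Hm => [|m IH] Hm; first by rewrite big_ord0 addr0.
  rewrite big_ord_recr /= addrA IH ?(ltnW Hm) //.
  have -> : clamp (s - m%:R) = 1.
    have : m.+1%:R <= s by apply: le_trans t1; rewrite ler_nat.
    rewrite -addn1 natrD /clamp => H.
    by rewrite (max_idPr _) ?subr_ge0; [rewrite (min_idPl _) //; lra|lra].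
  by rewrite mul1r addrC subrK.
case: ltnP => Hr; last exact: low.
elim: r Hr => // r IH; rewrite ltnS leq_eqVlt => /orP[/eqP Ek|Hr].
  rewrite big_ord_recr /= addrA -Ek low // -addn1 natrD.
  have -> : clamp (s - k%:R) = s - k%:R.
    rewrite /clamp (max_idPr _) ?subr_ge0 // (min_idPr _) //.
    by move: t2; rewrite -addn1 natrD => ?; lra.
  ring.
rewrite big_ord_recr /= addrA IH //.
have -> : clamp (s - r%:R) = 0.
  have : s <= r%:R by apply: ltW; apply: lt_le_trans t2 _; rewrite ler_nat.
  by move=> H; rewrite /clamp (max_idPl _) ?subr_le0 // (min_idPr _).
by rewrite mul0r addr0.
Qed.

Lemma clamp_lipschitz (f : nat -> R) r : exists2 C, 0 <= C & forall s s', 0 <= s -> 0 <= s' ->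
  `|(f 0%N + \sum_(j < r) clamp (s - j%:R) * (f j.+1 - f j)) -
    (f 0%N + \sum_(j < r) clamp (s' - j%:R) * (f j.+1 - f j))| <= C * `|s - s'|.
Proof.
exists (\sum_(j < r) `|f j.+1 - f j|); first exact: sumr_ge0.
move=> s s' _ _; rewrite opprD addrACA subrr add0r -sumrB mulr_suml.
apply: le_trans (ler_norm_sum _ _ _) _; apply: ler_sum => j _.
rewrite -mulrBl normrM mulrC; apply: ler_wpM2l => //.
by apply: le_trans (clamp_lip _ _) _; rewrite opprB addrA subrK.
Qed.

Lemma LI_lipschitz (p : seq (pt R)) : exists2 C, 0 <= C & forall s s', 0 <= s -> 0 <= s' ->
  dist (LI p s%:E) (LI p s'%:E) <= C * `|s - s'|.
Proof.
set r := (size p).-1.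
have [C1 C10 H1] := clamp_lipschitz (fun i => (node p i).1) r.
have [C2 C20 H2] := clamp_lipschitz (fun i => (node p i).2) r.
exists (C1 + C2); first exact: addr_ge0.
move=> s s' s0 s0'; apply: le_trans (dist_le_coord _ _) _; rewrite mulrDl.
have E1 t : 0 <= t -> (LI p t%:E).1 =
    (node p 0).1 + \sum_(j < r) clamp (t - j%:R) * ((node p j.+1).1 - (node p j).1).
  move=> t0; rewrite (clamp_sum (fun i => (node p i).1)) // /LI ltNge t0 /=.
  by case: ifP.
have E2 t : 0 <= t -> (LI p t%:E).2 =
    (node p 0).2 + \sum_(j < r) clamp (t - j%:R) * ((node p j.+1).2 - (node p j).2).
  move=> t0; rewrite (clamp_sum (fun i => (node p i).2)) // /LI ltNge t0 /=.
  by case: ifP.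
by apply: lerD; rewrite ?E1 ?E2 //; [exact: H1|exact: H2].
Qed.

End Paths.

(** * Upper bound *)

Section Hausdorff.
Variable R : realType.
Implicit Types (A U : set (pt R)) (x y : pt R).

Lemma diam_le U c : (forall x y, U x -> U y -> dist x y <= c) -> (diam U <= c%:E)%E.
Proof.
move=> H; apply: ge_ereal_sup => _ [x [y [Ux Uy ->]]].
by rewrite lee_fin; apply: H.
Qed.

Lemma dist_diam U x y : U x -> U y -> ((dist x y)%:E <= diam U)%E.
Proof. by move=> Ux Uy; apply: ereal_sup_ubound; exists x, y. Qed.

Lemma distxx x : dist x x = 0.
Proof. by rewrite /dist !subrr expr0n addr0 sqrtr0. Qed.

Lemma diam_ge0 U x : U x -> (0 <= diam U)%E.
Proof. by move=> Ux; have := dist_diam Ux Ux; rewrite distxx. Qed.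

Lemma hterm_ge0 s U : (0 <= hterm s U)%E.
Proof. by rewrite /hterm; case: pselect => //= h; apply: poweR_ge0. Qed.

Lemma hterm0 s : hterm s (set0 : set (pt R)) = 0%E.
Proof. by rewrite /hterm; case: pselect. Qed.

Lemma hterm_le s U c : 0 <= s -> (diam U <= c%:E)%E -> (hterm s U <= (c `^ s)%:E)%E.
Proof.
move=> s0 Hc; rewrite /hterm; case: pselect => h /=.
  by rewrite lee_fin powR_ge0.
have /eqP/set0P [x Ux] := h; have d0 := diam_ge0 Ux.
rewrite -poweR_EFin; apply: gt0_ler_poweR => //; rewrite in_itv /= ?andbT ?d0 ?leey //.
by rewrite (le_trans d0 Hc).
Qed.

Lemma hausdorff_delta_ge0 s e A : (0 <= hausdorff_delta s e A)%E.
Proof.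
apply: le_ereal_inf_tmp => _ [U [_ _ ->]].
by apply: nneseries_ge0 => n _ _; apply: hterm_ge0.
Qed.

Lemma hausdorff_delta_finite s e c N (U : nat -> set (pt R)) A : 0 <= s -> c <= e -> 0 <= c ->
  (forall i x y, (i < N)%N -> U i x -> U i y -> dist x y <= c) ->
  (forall x, A x -> exists2 i, (i < N)%N & U i x) ->
  (hausdorff_delta s e A <= (N%:R * c `^ s)%:E)%E.
Proof.
move=> s0 ce c0 HU HA.
(* The finite cover is continued by empty sets, whose term is 0. *)
pose V i := if (i < N)%N then U i else set0.
apply: (@le_trans _ _ (\sum_(i <oo) hterm s (V i))%E).
  apply: ereal_inf_lbound; exists V; split=> //.
  - by move=> x /HA [i Hi Ux]; exists i => //; rewrite /V Hi.
  - move=> i; apply: le_trans (_ : c%:E <= _)%E; last by rewrite lee_fin.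
    by apply: diam_le => x y; rewrite /V; case: ifP => // Hi; apply: HU.
rewrite (nneseries_split 0 N) ?add0n; last by move=> k _; apply: hterm_ge0.
rewrite [X in (_ + X)%E]eseries0 ?adde0; last first.
  by move=> i Hi _; rewrite /V ltnNge Hi /= hterm0.
apply: (@le_trans _ _ (\sum_(0 <= k < N) (c `^ s)%:E)%E).
  rewrite !big_mkord; apply: lee_sum => i _; apply: hterm_le => //; apply: diam_le => x y.
  by rewrite /V ltn_ord; apply: HU.
by rewrite sumEFin lee_fin big_mkord sumr_const card_ord mulr_natl.
Qed.

End Hausdorff.

(** * Covers of the limit curve by neighbourhoods of crossed cells *)

Section Limit.
Variable R : realType.
Implicit Types (x y z : pt R) (v u : seq 'I_3).
Local Notation gr := (@gr R _).
Local Notation treeb := (@treeb R _).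
Local Notation al := (alpha R).

Hypothesis trace_tree : forall n (b : gcode n.+1), treeb b -> treeb (trb b).
Hypothesis trace_surj : forall n (b : gcode n), treeb b -> exists2 b', treeb b' & trb b' = b.
Variables (b : forall n, gcode n) (X : \bar R -> pt R).
Hypothesis Hb : forall n, treeb (b n).
Hypothesis Htr : forall n, trb (b n.+1) = b n.
Hypothesis Hconv : unif_conv (fun n t => LI (sawpath (gr (b n))) ((al ^+ n)%:E * t)%E) X.

Definition trace_curve : set (pt R) := X @` [set t : \bar R | (0 <= t)%E].
Local Notation Xm n t := (LI (sawpath (gr (b n))) ((al ^+ n)%:E * t)%E).

Lemma crossed_take n m v : (n <= m)%N -> size v = m -> crossed R (b m) v -> crossed R (b n) (take n v).
Proof.
move=> Hnm; rewrite -(subnK Hnm); elim: (m - n)%N v => [|j IH] v Sv Hv.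
  by rewrite take_oversize // Sv.
case/lastP: v Sv Hv => // v i; rewrite size_rcons => -[Sv] Hv.
rewrite -cats1 takel_cat; last by rewrite Sv leq_addl.
by apply: IH => //; rewrite -Htr; apply: crossed_child Hv.
Qed.

Lemma aln_gt0 n : 0 < al ^+ n. Proof. by rewrite exprn_gt0 // al_gt0. Qed.

Lemma scaled_ge0 n (t : \bar R) : (0 <= t)%E -> (0 <= (al ^+ n)%:E * t)%E.
Proof. by move=> t0; apply: mule_ge0 => //; rewrite lee_fin ltW // aln_gt0. Qed.

Definition nbd n v : set (pt R) := [set x | exists2 y, cell v y & dist y x < (2 ^+ n)^-1].

(** Some X_m with m >= n is within 2^(-n) of X, and the level n ancestor of a crossed cell is
    crossed. *)
Lemma curve_nbd n x : trace_curve x -> exists2 v : n.-tuple 'I_3, crossed R (b n) v & nbd n v x.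
Proof.
case=> t /= t0 <-.
have q0 : 0 < (2 ^+ n)^-1 :> R by rewrite invr_gt0 exprn_gt0.
have [N HN] := Hconv q0; pose m := maxn N n.
have Hm := HN m (leq_maxl _ _) t t0.
have [v Hv Cv] := LI_cell (Hb m) (scaled_ge0 m t0).
have Su : size (take n v) == n by rewrite size_takel // size_tuple leq_maxr.
exists (Tuple Su) => /=; first by apply: (crossed_take (leq_maxr N n)) => //; rewrite size_tuple.
by exists (Xm m t) => //; apply: cell_take Cv.
Qed.

Lemma nbd_diam n v x y : size v = n -> nbd n v x -> nbd n v y -> dist x y <= 3 * (2 ^+ n)^-1.
Proof.
move=> Sv [x' Cx Dx] [y' Cy Dy]; have := cell_diam Cx Cy; rewrite Sv => D.
have T1 := dist_triangle x' x y; have T2 := dist_triangle y' x' y.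
rewrite dist_sym in Dx; lra.
Qed.

Lemma hausdorff_delta_curve s e n : 0 <= s -> 3 * (2 ^+ n)^-1 <= e ->
  (hausdorff_delta s e trace_curve <= (Zs R xpredT (b n) * (3 * (2 ^+ n)^-1) `^ s)%:E)%E.
Proof.
move=> s0 He; pose S := [seq w : n.-tuple 'I_3 <- enum {: n.-tuple 'I_3} | crossed R (b n) w].
pose v0 : n.-tuple 'I_3 := [tuple ord0 | i < n].
apply: (@le_trans _ _ ((size S)%:R * (3 * (2 ^+ n)^-1) `^ s)%:E).
  apply: (@hausdorff_delta_finite _ s e (3 * (2 ^+ n)^-1) (size S) (fun i => nbd n (nth v0 S i))) => //.
  - by move=> i x y _; apply: nbd_diam; rewrite size_tuple.
  - move=> x /(curve_nbd n) [v Hv Nv].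
    have Sv : v \in S by rewrite mem_filter Hv mem_enum.
    by exists (index v S); rewrite ?index_mem // nth_index.
rewrite lee_fin; apply: ler_wpM2r; first exact: powR_ge0.
apply: le_trans (crossed_le_Zs trace_tree trace_surj xpredT (Hb n)).
rewrite /S size_filter -sum1_count natr_sum big_enum_cond /= big_mkcond /=.
by apply: ler_sum => v _; case: (crossed _ _ _).
Qed.

Lemma curve_null s : 0 <= s ->
  (forall e, 0 < e -> forall N, exists2 n, (N <= n)%N & Zs R xpredT (b n) * ((2 ^+ n)^-1) `^ s <= e) ->
  hausdorff_measure s trace_curve = 0%E.
Proof.
move=> s0 H.
suff Hd e : 0 < e -> hausdorff_delta s e trace_curve = 0%E.
  rewrite /hausdorff_measure (_ : [set _ | _ in _] = [set 0%E]) ?ereal_sup1 //.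
  apply/seteqP; split=> [_ [e e0 <-]|_ ->]; first exact: Hd.
  by exists 1; rewrite /= ?Hd.
move=> e0; apply/eqP; rewrite eq_le hausdorff_delta_ge0 andbT.
apply/lee_addgt0Pr => f f0; rewrite add0e.
have c0 : 0 < 3 `^ s :> R by apply: powR_gt0.
have [N HN] : exists N, forall n, (N <= n)%N -> 3 * (2 ^+ n)^-1 <= e.
  exists (Num.truncn (3 / e)) => n Hn.
  rewrite ler_pdivrMr ?exprn_gt0 // mulrC -ler_pdivrMr //.
  apply: ltW; apply: lt_le_trans (truncnS_gt _) _; rewrite -natrX ler_nat.
  exact: leq_ltn_trans Hn (ltn_expl _ _).
(* The covering sets have diameter at most 3 / 2^n, which costs the factor 3^s. *)
have [n Hn Hz] := H (f / 3 `^ s) (divr_gt0 f0 c0) N.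
apply: le_trans (hausdorff_delta_curve s0 (HN n Hn)) _; rewrite lee_fin.
have -> := @powRM _ 3 (2 ^+ n)^-1 s (ler0n _ _) (ltW _); last by rewrite invr_gt0 exprn_gt0.
by rewrite mulrCA mulrC -ler_pdivlMr.
Qed.

End Limit.

(** * Lower bound *)

Section LowerBound.
Variable R : realType.
Implicit Types (x y z : pt R) (v u : seq 'I_3).
Local Notation gr := (@gr R _).
Local Notation treeb := (@treeb R _).
Local Notation al := (alpha R).

Variables (b : forall n, gcode n) (X : \bar R -> pt R).
Hypothesis Hb : forall n, treeb (b n).
Hypothesis Hconv : unif_conv (fun n t => LI (sawpath (gr (b n))) ((al ^+ n)%:E * t)%E) X.
Local Notation Xm n t := (LI (sawpath (gr (b n))) ((al ^+ n)%:E * t)%E).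

Lemma curve_at_infinity e : 0 < e -> exists2 L, 0 <= L & forall t, L <= t -> dist (X t%:E) (X +oo%E) < e.
Proof.
move=> e0; have [n /(_ n (leqnn n)) Hn] := Hconv (divr_gt0 e0 (ltr0n R 2)).
exists ((size (sawpath (gr (b n)))).-1%:R / al ^+ n); first by rewrite divr_ge0 // ltW // aln_gt0.
move=> t Ht; have t0 : 0 <= t by apply: le_trans Ht; rewrite divr_ge0 // ltW // aln_gt0.
have E : Xm n t%:E = Xm n +oo%E.
  rewrite gt0_muley ?lte_fin ?aln_gt0 // -EFinM LI_end //.
  by rewrite mulrC -ler_pdivrMr // aln_gt0.
have H1 := Hn t%:E (t0 : (0%:E <= t%:E)%E); have H2 := Hn +oo%E (leey _).
have := dist_triangle (Xm n t%:E) (X t%:E) (X +oo%E); rewrite {2}E; rewrite dist_sym in H1; lra.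
Qed.

Lemma curve_continuous e t : 0 < e -> 0 <= t -> exists2 f, 0 < f & forall t', 0 <= t' ->
  `|t - t'| < f -> dist (X t'%:E) (X t%:E) < e.
Proof.
move=> e0 t0; have [n /(_ n (leqnn n)) Hn] := Hconv (divr_gt0 e0 (ltr0n R 3)).
have [C C0 HC] := LI_lipschitz (sawpath (gr (b n))).
pose D := C * al ^+ n + 1.
have D0 : 0 < D by rewrite ltr_pwDr // mulr_ge0 // ltW // aln_gt0.
exists (e / 3 / D); first by rewrite !divr_gt0.
move=> t' t'0; rewrite ltr_pdivlMr // => Ht.
have a0 : 0 <= al ^+ n by rewrite ltW // aln_gt0.
have H1 := Hn t%:E (t0 : (0%:E <= t%:E)%E); have H2 := Hn t'%:E (t'0 : (0%:E <= t'%:E)%E).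
have H3 := HC _ _ (mulr_ge0 a0 t'0) (mulr_ge0 a0 t0).
rewrite -mulrBr normrM (ger0_norm a0) distrC mulrA !EFinM in H3.
have H4 : C * al ^+ n * `|t - t'| <= `|t - t'| * D by rewrite mulrC ler_wpM2l // /D lerDl.
have T1 := dist_triangle (Xm n t'%:E) (X t'%:E) (X t%:E).
have T2 := dist_triangle (Xm n t%:E) (Xm n t'%:E) (X t%:E).
rewrite dist_sym in H2; lra.
Qed.

(** The time interval [0, +oo] is split into a compact [0, L] and a neighbourhood of +oo, on which
    the curve is almost constant. *)
Lemma curve_compact (W : nat -> set (pt R)) :
  (forall n m, (n <= m)%N -> W n `<=` W m) ->
  (forall x, trace_curve X x -> exists N, exists2 f, 0 < f & forall y, dist y x < f -> W N y) ->
  exists N, trace_curve X `<=` W N.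
Proof.
move=> Wmono HW.
have [|N1 [f1 f10 H1]] := HW (X +oo%E); first by exists +oo%E => //=; apply: leey.
have [L L0 HL] := curve_at_infinity f10.
have K : near_covering_within `[0, L]%classic.
  by apply/near_covering_withinP/compact_near_coveringP/segment_compact.
have [N2 _ HN2] : \forall i \near \oo, `[0, L]%classic `<=` (fun t : R => W i (X t%:E)).
  apply: (K nat \oo (fun i (t : R) => W i (X t%:E))) => t; rewrite /= in_itv /= => /andP[t0 _].
  have [|N [f f0 HN]] := HW (X t%:E); first by exists t%:E => //=; rewrite lee_fin.
  have [g g0 Hg] := curve_continuous f0 t0.
  exists (ball t g, [set i | (N <= i)%N]); first by split; [by apply/nbhs_ballP; exists g|exact: nbhs_infty_ge].
  case=> t' i [/= Ht' Hi]; rewrite in_itv /= => /andP[t'0 _].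
  apply: (Wmono _ _ Hi); apply: HN; apply: Hg => //.
exists (maxn N1 N2) => x [t /= t0 <-].
case: t t0 => [t| |] //= t0; last first.
  apply: (Wmono _ _ (leq_maxl N1 N2)); apply: H1.
  by rewrite distxx.
have [Ht|Ht] := leP L t.
  by apply: (Wmono _ _ (leq_maxl N1 N2)); apply: H1; apply: HL.
apply: (Wmono _ _ (leq_maxr N1 N2)); apply: (HN2 N2 (leqnn _)).
by rewrite lee_fin in t0; rewrite /= in_itv /= t0 ltW.
Qed.

Lemma curve_ball_cover (c : nat -> pt R) (rho : nat -> R) :
  (forall x, trace_curve X x -> exists i, dist x (c i) < rho i) ->
  exists N n0, forall n t, (n0 <= n)%N -> (0 <= t)%E -> exists2 i, (i <= N)%N & dist (Xm n t) (c i) < rho i.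
Proof.
(* Shrinking the radii by 1/(N+1) leaves room to pass from the limit curve to X_n for large n. *)
move=> H; pose W N : set (pt R) := [set y | exists2 i, (i <= N)%N & dist y (c i) < rho i - N.+1%:R^-1].
have [|x /H [i Hi]|N HN] := @curve_compact W.
- move=> n m nm y [i Hi Hy]; exists i; first exact: leq_trans nm.
  apply: lt_le_trans Hy _; rewrite lerB // lef_pV2 ?posrE //.
  by rewrite ler_nat.
- set g := (rho i - dist x (c i)) / 2; have g0 : 0 < g by rewrite divr_gt0 // subr_gt0.
  pose M := Num.truncn g^-1; exists (maxn i M), g => // y Hy.
  exists i; first exact: leq_maxl.
  have : (maxn i M).+1%:R^-1 < g.
    rewrite -[ltRHS]invrK ltf_pV2 ?posrE ?invr_gt0 //.
    apply: lt_le_trans (truncnS_gt _) _; by rewrite ler_nat ltnS leq_maxr.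
  have := dist_triangle x y (c i); move: Hy; rewrite /g; move: ((maxn i M).+1%:R^-1) => w; lra.
have [n0 Hn0] : exists n0, forall n, (n0 <= n)%N -> forall t, (0 <= t)%E -> dist (Xm n t) (X t) < N.+1%:R^-1.
  by apply: Hconv; rewrite invr_gt0.
exists N, n0 => n t Hn t0.
have [|i Hi Di] := HN (X t); first by exists t.
exists i => //; have := dist_triangle (X t) (Xm n t) (c i); have := Hn0 n Hn t t0.
by move: Di; move: (N.+1%:R^-1) => w; lra.
Qed.

Section Count.
Variables (c : nat -> pt R) (rho : nat -> R) (kk : nat -> nat) (N n : nat).
Hypothesis Hcov : forall t, (0 <= t)%E -> exists2 i, (i <= N)%N & dist (Xm n t) (c i) < rho i.
Hypothesis Hkk : forall i, (i <= N)%N -> (kk i <= n)%N.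
Hypothesis Hrho : forall i, rho i <= (2 ^+ kk i)^-1.

Definition meets i u := `[< exists2 y, cell u y & dist y (c i) < rho i >].
(** Cells of level [k] are tested only against balls of that scale, each of which meets at most 64
    of them. *)
Definition bad k u := [exists i : 'I_N.+1, (kk i == k) && meets i u].

Lemma crossed_bad v : size v = n -> crossed R (b n) v -> exists2 k, (k <= n)%N & bad k (take k v).
Proof.
move=> Sv Hx; have [j Hj Cj] := crossed_node (Hb n) Sv Hx.
have a0 : al ^+ n != 0 by rewrite gt_eqF // aln_gt0.
have t0 : (0 <= (j%:R / al ^+ n)%:E)%E by rewrite lee_fin divr_ge0 // ltW // aln_gt0.
have [i Hi Di] := Hcov t0.
have E : Xm n (j%:R / al ^+ n)%:E = nth (pt0 R) (sawpath (gr (b n))) j.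
  by rewrite -EFinM mulrCA divff // mulr1 LI_nat.
exists (kk i); first exact: Hkk.
apply/existsP; exists (Ordinal (Hi : (i < N.+1)%N)); rewrite eqxx /=.
by apply/asboolP; exists (nth (pt0 R) (sawpath (gr (b n))) j); [apply: cell_take Cj|rewrite -E].
Qed.

(** Every crossed cell has a bad ancestor, so its weight is counted at least once on the right. *)
Lemma Zs_le_bad : Zs R xpredT (b n) <=
  \sum_(k < n.+1) \sum_(u : k.-tuple 'I_3 | bad k u) Zs R (fun w => take k w == u) (b n).
Proof.
have E (k : nat) (u : k.-tuple 'I_3) : Zs R (fun w => take k w == u) (b n) =
    \sum_(v : n.-tuple 'I_3) (take k v == u :> seq _)%:R * hw R (b n) v.
  rewrite /Zs big_mkcond; apply: eq_bigr => v _.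
  by case: eqP; rewrite ?mul1r ?mul0r.
under eq_bigr => k _ do (under eq_bigr => u _ do rewrite E; rewrite exchange_big /=).
rewrite exchange_big /=; apply: ler_sum => v _.
have h0 : 0 <= hw R (b n) v by apply: wt_ge0.
have nn (k : 'I_n.+1) : 0 <= \sum_(u : k.-tuple 'I_3 | bad k u) (take k v == u :> seq _)%:R * hw R (b n) v.
  by apply: sumr_ge0 => u _; apply: mulr_ge0.
have [Hx|Hx] := boolP (crossed R (b n) v); last first.
  rewrite {1}/hw wt0; last by apply: ty_uncrossed => //; rewrite size_tuple.
  by apply: sumr_ge0 => k _; apply: nn.
have [k Hk Hbad] := crossed_bad (size_tuple v) Hx.
have Su : size (take k v) == k by rewrite size_takel // size_tuple.
rewrite (bigD1 (Ordinal (Hk : (k < n.+1)%N))) //= (bigD1 (Tuple Su)) //= eqxx mul1r -addrA lerDl.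
rewrite addr_ge0 //; first by apply: sumr_ge0 => u _; apply: mulr_ge0.
by apply: sumr_ge0 => i _; apply: nn.
Qed.

Lemma card_bad k : \sum_(u : k.-tuple 'I_3 | bad k u) (1 : R) <=
  \sum_(i < N.+1) (if kk i == k then 64 else 0).
Proof.
apply: (@le_trans _ _ (\sum_(u : k.-tuple 'I_3) \sum_(i < N.+1) ((kk i == k) && meets i u)%:R)).
  rewrite big_mkcond; apply: ler_sum => u _; case: ifP => [/existsP [i Hi]|_]; last exact: sumr_ge0.
  by rewrite (bigD1 i) //= Hi lerDl; apply: sumr_ge0.
rewrite exchange_big /=; apply: ler_sum => i _; case: eqP => [Ek|_] /=; last by rewrite big1.
rewrite -natr_sum ler_nat.
have -> : (\sum_(u : k.-tuple 'I_3) meets i u)%N = #|[set u : k.-tuple 'I_3 | meets i u]%SET|.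
  by rewrite -sum1dep_card [RHS]big_mkcond; apply: eq_bigr => u _; case: (meets i u).
apply: (@card_near R k _ (c i)) => u; rewrite inE => /asboolP [y Cy Dy]; exists y => //.
by apply: lt_le_trans Dy _; rewrite -Ek.
Qed.

(** Cauchy-Schwarz with a free parameter: a cover with a small sum of scales, together with a
    bounded energy, forces a small total mass. *)
Lemma mass_bound r lam : 0 < r -> 0 < lam ->
  al ^- n * Zs R xpredT (b n) <=
  2^-1 * (lam * (64 * \sum_(i < N.+1) r ^- kk i) + energy r (b n) / lam).
Proof.
move=> r0 l0.
have a0 : 0 <= al ^- n by rewrite invr_ge0 ltW // aln_gt0.
apply: le_trans (ler_wpM2l a0 Zs_le_bad) _.
(* AM-GM: [2 m <= lam / r ^ k + r ^ k m ^ 2 / lam]. *)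
pose m (k : nat) (u : k.-tuple 'I_3) := al ^- n * Zs R (fun w => take k w == u) (b n).
apply: (@le_trans _ _ (2^-1 * \sum_(k < n.+1) \sum_(u : k.-tuple 'I_3 | bad k u)
   (lam * r ^- k + r ^+ k * m k u ^+ 2 / lam))).
  rewrite !mulr_sumr; apply: ler_sum => k _; rewrite !mulr_sumr; apply: ler_sum => u _.
  rewrite -/(m k u); have x0 : 0 < r ^+ k by rewrite exprn_gt0.
  rewrite mulrC ler_pdivlMr //.
  have xl : 0 < r ^+ k / lam by rewrite divr_gt0.
  rewrite -subr_ge0 (_ : _ - _ = (r ^+ k / lam) * (m k u - lam / r ^+ k) ^+ 2).
    by rewrite mulr_ge0 // ?sqr_ge0 // ltW.
  by field; rewrite !gt_eqF.
apply: ler_wpM2l; first by rewrite invr_ge0.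
under eq_bigr => k _ do rewrite big_split /=.
rewrite big_split /=; apply: lerD; last first.
  rewrite /energy mulr_suml; apply: ler_sum => k _.
  rewrite /energy_at mulr_sumr mulr_suml [leRHS](bigID (fun u : k.-tuple 'I_3 => bad k u)) /= lerDl.
  apply: sumr_ge0 => u _; apply: divr_ge0; last exact: ltW.
  by apply: mulr_ge0; [exact/exprn_ge0/ltW|exact: sqr_ge0].
have -> : lam * (64 * \sum_(i < N.+1) r ^- kk i) = \sum_(i < N.+1) lam * r ^- kk i * 64.
  by rewrite mulr_sumr mulr_sumr; apply: eq_bigr => i _; ring.
apply: (@le_trans _ _ (\sum_(k < n.+1) lam * r ^- k * \sum_(i < N.+1) (if kk i == k then 64 else 0))).
  apply: ler_sum => k _.
  have -> : \sum_(u : k.-tuple 'I_3 | bad k u) lam * r ^- k = lam * r ^- k * \sum_(u : k.-tuple 'I_3 | bad k u) 1.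
    by rewrite mulr_sumr; apply: eq_bigr => u _; rewrite mulr1.
  apply: ler_wpM2l; last exact: card_bad.
  by rewrite mulr_ge0 ?ltW // invr_gt0 exprn_gt0.
under eq_bigr => k _ do rewrite mulr_sumr.
rewrite exchange_big /=; apply: ler_sum => i _.
have Hi : (kk i < n.+1)%N by rewrite ltnS Hkk // -ltnS.
rewrite (bigD1 (Ordinal Hi)) //= eqxx big1 ?addr0 // => k Nk.
by case: eqP => [E|_]; rewrite ?mulr0 //; move: Nk; rewrite -val_eqE /= E eqxx.
Qed.

End Count.

End LowerBound.

(** * Dyadic powers, and the exponent 0 *)

Section Powers.
Variable R : realType.

Lemma powR_half (s : R) : 2^-1 `^ s = (2 `^ s)^-1.
Proof.
have p0 : 2 `^ s != 0 :> R by rewrite gt_eqF // powR_gt0.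
apply: (mulfI p0); rewrite divff // -powRM // ?invr_ge0 //.
by rewrite divff ?powR1.
Qed.

Lemma powR_dyadic (s : R) k : ((2 ^+ k)^-1) `^ s = (2 `^ s) ^- k.
Proof.
elim: k => [|k IH]; first by rewrite !expr0 !invr1 powR1.
rewrite !exprS !invfM powRM ?invr_ge0 ?exprn_ge0 //.
by rewrite powR_half IH.
Qed.

Lemma dyadic_scale (x : R) : 0 < x -> x <= 1 -> exists k, x <= (2 ^+ k)^-1 /\ (2 ^+ k)^-1 < 2 * x.
Proof.
move=> x0 x1; have ex : exists k, (2 ^+ k)^-1 < 2 * x.
  exists (Num.truncn (x^-1)).
  rewrite -[ltRHS]invrK ltf_pV2 ?posrE ?invr_gt0 ?exprn_gt0 ?mulr_gt0 //.
  rewrite invfM; apply: (@lt_trans _ _ x^-1); first by rewrite gtr_pMl ?invr_gt0 // invf_lt1 //; lra.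
  by apply: lt_le_trans (truncnS_gt _) _; rewrite -natrX ler_nat ltn_expl.
exists (ex_minn ex); case: ex_minnP => k Hk Hmin; split=> //.
case: k Hk Hmin => [|k] Hk Hmin; first by rewrite expr0 invr1.
rewrite leNgt; apply/negP => H.
have : (k.+1 <= k)%N; last by rewrite ltnn.
apply: Hmin; move: H; rewrite exprS invfM => H; lra.
Qed.

Lemma halves_sum (e : R) N : 0 <= e -> \sum_(i < N) e / 2 ^+ i.+1 <= e.
Proof.
move=> e0; have -> : \sum_(i < N) e / 2 ^+ i.+1 = e * (1 - (2 ^+ N)^-1).
  elim: N => [|N IH]; first by rewrite big_ord0 expr0 invr1 subrr mulr0.
  rewrite big_ord_recr /= IH exprS; have x0 : 2 ^+ N != 0 :> R by rewrite expf_neq0.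
  by move: (2 ^+ N) x0 => x x0; field.
by rewrite ler_piMr // gerBl invr_ge0 exprn_ge0.
Qed.

(** At exponent 0 every nonempty set of a cover contributes 1. This settles s = 0, where the radii
    of [curve_positive], powers with exponent 1/s, make no sense. *)
Lemma hausdorff0_empty (A : set (pt R)) : hausdorff_measure 0 A = 0%E -> A = set0.
Proof.
move=> H0; have Hd : (hausdorff_delta 0 1 A < 1)%E.
  apply: (@le_lt_trans _ _ (hausdorff_measure 0 A)); last by rewrite H0 lte_fin.
  by apply: ereal_sup_ubound; exists 1 => /=.
have [_ [U [HU _ ->]] Hs] := ereal_inf_lt Hd.
apply/seteqP; split=> // x /HU [i _ Ui].
have h1 : (hterm 0 (U i) < 1)%E.
  apply: le_lt_trans Hs.
  apply: le_trans (nneseries_lim_ge i.+1 (fun k _ _ => hterm_ge0 0 (U k))).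
  rewrite big_nat_recr //= leeDr //; apply: sume_ge0 => k _; exact: hterm_ge0.
move: h1; rewrite /hterm; case: pselect => h /=; first by rewrite h in Ui.
by rewrite poweRe0 ltxx.
Qed.

End Powers.

(** * Positivity of the Hausdorff measure below the critical exponent *)

Section Positive.
Variable R : realType.
Implicit Types (x y z : pt R) (v u : seq 'I_3).
Local Notation gr := (@gr R _).
Local Notation treeb := (@treeb R _).
Local Notation al := (alpha R).

Variables (b : forall n, gcode n) (X : \bar R -> pt R).
Hypothesis Hb : forall n, treeb (b n).
Hypothesis Hconv : unif_conv (fun n t => LI (sawpath (gr (b n))) ((al ^+ n)%:E * t)%E) X.

Lemma curve_positive s c A : 0 < s -> 0 < c -> 0 < A ->
  (forall N, exists2 n, (N <= n)%N & c <= al ^- n * Zs R xpredT (b n) /\ energy (2 `^ s) (b n) <= A) ->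
  hausdorff_measure s (trace_curve X) <> 0%E.
Proof.
move=> s0 c0 A0 H Hz; set r := 2 `^ s in H.
have r0 : 0 < r by apply: powR_gt0.
(* The sum of scales will be at most 2 r e, so with [lam] = A / c the bound of [mass_bound] is at
   most (c / 2 + c) / 2 < c. The minimum with 1/2 keeps the radii at most 1. *)
pose e := Num.min 2^-1 (c ^+ 2 / (256 * A * r)).
have d0 : 0 < 256 * A * r by rewrite !mulr_gt0.
have e0 : 0 < e by rewrite lt_min invr_gt0 ltr0n /= divr_gt0 // exprn_gt0.
have e1 : e <= 2^-1 by rewrite ge_min lexx.
have e2 : e <= c ^+ 2 / (256 * A * r) by rewrite ge_min lexx orbT.
have Hd : (hausdorff_delta s 1 (trace_curve X) < e%:E)%E.
  apply: (@le_lt_trans _ _ (hausdorff_measure s (trace_curve X))); last by rewrite Hz lte_fin.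
  by apply: ereal_sup_ubound; exists 1 => /=.
have [_ [U [HU Hdiam ->]] Hs] := ereal_inf_lt Hd.
have part M : (\sum_(0 <= i < M) hterm s (U i) <= e%:E)%E.
  apply: le_trans (ltW Hs); apply: nneseries_lim_ge => k _ _; exact: hterm_ge0.
pose h i := fine (hterm s (U i)).
have hE i : hterm s (U i) = (h i)%:E.
  rewrite fineK // ge0_fin_numE ?hterm_ge0 //; apply: (@le_lt_trans _ _ e%:E); last exact: ltry.
  apply: le_trans (part i.+1); rewrite big_nat_recr //= leeDr //.
  by apply: sume_ge0 => k _; exact: hterm_ge0.
have h0 i : 0 <= h i by rewrite -lee_fin -hE hterm_ge0.
have hsum M : \sum_(i < M) h i <= e.
  rewrite -lee_fin -sumEFin; have := part M; rewrite big_mkord.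
  by under eq_bigr => i _ do rewrite hE.
have hle i : h i <= e.
  by apply: le_trans (hsum i.+1); rewrite big_ord_recr /= lerDr; apply: sumr_ge0.
(* A summable excess: it makes the radii positive even for sets of diameter 0, and the distances
   strictly smaller than the radii. *)
pose eta (i : nat) := e / 2 ^+ i.+1.
have eta0 i : 0 < eta i by rewrite divr_gt0 // exprn_gt0.
have etale i : eta i <= 2^-1.
  apply: le_trans e1; rewrite ler_piMr ?(ltW e0) // invf_le1 ?exprn_gt0 //.
  by rewrite exprn_ege1 //; lra.
(* Radius of a ball around U i, chosen with rho i ^ s = h i + eta i > diam (U i) ^ s. *)
pose rho i := (h i + eta i) `^ s^-1.
have b0 i : 0 < h i + eta i by rewrite ltr_wpDl.
have rho0 i : 0 < rho i by apply: powR_gt0.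
have rhos i : rho i `^ s = h i + eta i.
  by rewrite /rho -powRrM mulVf ?gt_eqF // powRr1 // ltW.
have rho1 i : rho i <= 1.
  have -> : 1 = 1 `^ s^-1 :> R by rewrite powR1.
  apply: ge0_ler_powR; rewrite ?nnegrE ?invr_ge0 ?ler01 ?(ltW s0) ?(ltW (b0 i)) //.
  by have := hle i; have := etale i; lra.
have /choice [kk Hkk] i : exists k, rho i <= (2 ^+ k)^-1 /\ (2 ^+ k)^-1 < 2 * rho i.
  exact: dyadic_scale.
have /choice [ctr Hctr] i : exists x, forall y, U i y -> dist y x < rho i.
  have [[x Ux]|N] := pselect (exists x, U i x); last by exists (pt0 R) => y Uy; case: N; exists y.
  exists x => y Uy; have Dd := dist_diam Uy Ux.
  have dfin : diam (U i) \is a fin_num.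
    rewrite ge0_fin_numE ?(diam_ge0 Ux) //; exact: le_lt_trans (Hdiam i) (ltry _).
  have := hE i; rewrite /hterm; case: pselect => [E|_ /=]; first by rewrite E in Ux.
  rewrite -(fineK dfin) poweR_EFin => -[Eh].
  rewrite -(fineK dfin) lee_fin in Dd; apply: le_lt_trans Dd _.
  rewrite ltNge; apply/negP => /(ge0_ler_powR (ltW s0)).
  rewrite !nnegrE (ltW (rho0 i)) fine_ge0 ?(diam_ge0 Ux) // => /(_ isT isT).
  by rewrite rhos Eh; have := eta0 i; lra.
have [|N [n0 HN]] := @curve_ball_cover R b X Hconv ctr rho.
  by move=> x /HU [i _ Ui]; exists i; apply: Hctr.
pose K := \max_(i < N.+1) kk i.
have [n Hn [Hc HA]] := H (maxn n0 K).
have Hn0 : (n0 <= n)%N by apply: leq_trans Hn; rewrite leq_maxl.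
have HK i : (i <= N)%N -> (kk i <= n)%N.
  move=> Hi; apply: leq_trans Hn; rewrite leq_max; apply/orP; right.
  exact: (@leq_bigmax _ (fun i : 'I_N.+1 => kk i) (Ordinal (Hi : (i < N.+1)%N))).
have := mass_bound Hb (fun t => HN n t Hn0) HK (fun i => (Hkk i).1) r0 (divr_gt0 A0 c0).
set S := \sum_(i < N.+1) _ => Hm.
have HS : S <= r * (2 * e).
  apply: (@le_trans _ _ (\sum_(i < N.+1) r * (h i + eta i))).
    (* From 2^(-k) < 2 rho follows 2^(-ks) <= 2^s rho^s, the origin of the factor [r]. *)
    apply: ler_sum => i _; rewrite -powR_dyadic -rhos -powRM //; last exact: ltW.
    apply: ge0_ler_powR; rewrite ?nnegrE ?(ltW s0) ?invr_ge0 ?exprn_ge0 ?mulr_ge0 //; last exact: ltW (Hkk i).2.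
    exact: ltW.
  rewrite -mulr_sumr big_split /=; apply: ler_wpM2l; first exact: ltW.
  by have := hsum N.+1; have := halves_sum N.+1 (ltW e0); rewrite -/(eta _); lra.
have S0 : A / c * (64 * S) <= c / 2.
  apply: (@le_trans _ _ (A / c * (64 * (r * (2 * (c ^+ 2 / (256 * A * r))))))).
    apply: ler_wpM2l; first by rewrite divr_ge0 // ltW.
    apply: ler_wpM2l => //; apply: (le_trans HS); apply: ler_wpM2l; first exact: ltW.
    by apply: ler_wpM2l.
  rewrite le_eqVlt; apply/orP; left; apply/eqP; field.
  by rewrite !gt_eqF.
have S1 : energy r (b n) / (A / c) <= c.
  rewrite ler_pdivrMr ?divr_gt0 // mulrCA divff ?mulr1 // gt_eqF //.
by move: Hm; move: (A / c * _) (energy r (b n) / _) S0 S1 Hc => p q; lra.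
Qed.

End Positive.

(** * The dimension *)

Section Main.
Variables (R : realType) (d : measure_display) (Omega : measurableType d) (P : probability Omega R).
Variables (T : nat -> Omega -> set (set (pt R))) (X : Omega -> \bar R -> pt R).
Hypothesis UST : consistent_UST P T.
Local Notation al := (alpha R).
Local Notation dim := (ln (alpha R) / ln 2).
Local Notation Ex := (@tree_mean R (tree_prob R)).
Local Notation code w := (fun n => tcode T n w).

Lemma ln2_gt0 : 0 < ln 2 :> R. Proof. by rewrite ln_gt0 // ltr1n. Qed.

Lemma powR_lt_alpha (s : R) : s < dim -> 2 `^ s < al.
Proof.
move=> Hs; rewrite -ltr_ln ?posrE ?powR_gt0 ?al_gt0 // ln_powR.
by rewrite -ltr_pdivlMr // ln2_gt0.
Qed.

Lemma alpha_lt_powR (s : R) : dim < s -> al < 2 `^ s.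
Proof.
move=> Hs; rewrite -ltr_ln ?posrE ?powR_gt0 ?al_gt0 // ln_powR.
by rewrite -ltr_pdivrMr // ln2_gt0.
Qed.

Lemma small_expr (x e : R) : 0 <= x -> x < 1 -> 0 < e -> exists N, forall n, (N <= n)%N -> x ^+ n <= e.
Proof.
move=> x0 x1 e0.
have /cvgrPdist_le /(_ _ e0) [N _ HN] : x ^+ n @[n --> \oo] --> 0.
  by apply: cvg_expr; rewrite ger0_norm.
exists N => n /HN /=; rewrite sub0r normrN ger0_norm //; exact: exprn_ge0.
Qed.

Lemma inv_succ_le (e : R) : 0 < e -> exists j, j.+1%:R^-1 <= e.
Proof.
move=> e0; exists (Num.truncn e^-1); rewrite -[leRHS]invrK lef_pV2 ?posrE ?invr_gt0 //.
by apply/ltW; apply: truncnS_gt.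
Qed.

Let pge0 := tree_prob_ge0 R.
Let tr_tree := trb_tree UST.
Let tr_surj := trb_surj UST.
Let tr_Ex := trb_Ex UST.
Let E1 := tcode_Ex1 UST.

(** Markov's inequality: the mean is at most 10 (alpha / 2^s)^n, which tends to 0. *)
Lemma ae_small_count (s e : R) : dim < s -> 0 < e ->
  {ae P, forall w, forall N, exists2 n, (N <= n)%N & Zs R xpredT (tcode T n w) * ((2 ^+ n)^-1) `^ s <= e}.
Proof.
move=> Hs e0; set r := 2 `^ s; have r0 : 0 < r by apply: powR_gt0.
have := ae_infinitely_often UST (B := fun j n (b : gcode n) => Zs R xpredT b * ((2 ^+ n)^-1) `^ s <= e).
have a0 := al_gt0 R.
case=> [j|D [mD D0 HD]]; last first.
  exists D; split=> // w Hw; apply: HD => -[j Hj]; apply: Hw => N; exact: Hj.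
have x1 : al / r < 1 by rewrite ltr_pdivrMr // mul1r alpha_lt_powR.
have x0 : 0 <= al / r by rewrite divr_ge0 // ltW.
have j0 : 0 < e / 10 / j.+1%:R :> R by rewrite !divr_gt0.
have [N HN] := small_expr x0 x1 j0; exists N => n /HN Hn.
have q0 : 0 <= r ^- n by rewrite invr_ge0 exprn_ge0 // ltW.
apply: (@le_trans _ _ (Ex (fun b : gcode n => r ^- n / e * Zs R xpredT b))).
  apply: (le_Ex pge0) => b _; rewrite powR_dyadic -/r.
  have [_|H] /= := leP (Zs R xpredT b * r ^- n) e; first by rewrite mulr_ge0 ?Zs_ge0 // divr_ge0 // ltW.
  by rewrite mulrAC ler_pdivlMr // mul1r mulrC ltW.
rewrite ExZ; apply: (@le_trans _ _ (r ^- n / e * (10 * al ^+ n))).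
  by apply: ler_wpM2l; [rewrite divr_ge0 // ltW|apply: (Ex_Zs pge0 tr_tree tr_Ex E1)].
have -> : r ^- n / e * (10 * al ^+ n) = 10 / e * (al / r) ^+ n by rewrite exprMn exprVn; ring.
rewrite mulrC -ler_pdivlMr ?divr_gt0 //; apply: le_trans Hn _.
by rewrite invf_div mulrC le_eqVlt; apply/orP; left; apply/eqP; ring.
Qed.

Lemma ae_large_mass (s : R) : s < dim ->
  {ae P, forall w, exists c A : R, [/\ 0 < c, 0 < A & forall N, exists2 n, (N <= n)%N &
     c <= al ^- n * Zs R xpredT (tcode T n w) /\ energy (2 `^ s) (tcode T n w) <= A]}.
Proof.
move=> Hs; set r := 2 `^ s; have r0 : 0 < r by apply: powR_gt0.
have ra : r < al by apply: powR_lt_alpha.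
have a0 := al_gt0 R.
have [C C0 HC] : exists2 C : R, 0 < C & forall n, Ex (fun b : gcode n => energy r b) <= C.
  exists (10200 / (1 - r / al)); last by move=> n; apply: (Ex_energy pge0 tr_tree tr_Ex E1 n r0 ra).
  apply: divr_gt0; first by rewrite ltr0n.
  by rewrite subr_gt0 ltr_pdivrMr // mul1r.
(* Half of 1/(j+1) is reserved for a small mass (Chebyshev) and half for a large energy (Markov). *)
have /choice [k Hk] (j : nat) : exists k, 2000 / 2 ^+ k <= 2^-1 * j.+1%:R^-1 :> R.
  have K0 : 0 < 2000 :> R by rewrite ltr0n.
  have x0 : 0 < 2^-1 * j.+1%:R^-1 / 2000 :> R.
    by apply: divr_gt0 K0; rewrite mulr_gt0 ?invr_gt0.
  have [k Hk] := inv_succ_le x0; exists k.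
  rewrite mulrC -(ler_pdivlMr _ _ K0); apply: le_trans Hk.
  by rewrite lef_pV2 ?posrE ?exprn_gt0 // -natrX ler_nat ltn_expl.
pose c j : R := al ^- k j * (2 ^+ k j / 2).
pose A j : R := C * (2 * j.+1%:R).
have c0 j : 0 < c j by rewrite mulr_gt0 ?invr_gt0 ?divr_gt0 ?exprn_gt0.
have A0 j : 0 < A j by rewrite !mulr_gt0.
have := ae_infinitely_often UST
  (B := fun j n (b : gcode n) => (c j <= al ^- n * Zs R xpredT b) && (energy r b <= A j)).
case=> [j|D [mD D0 HD]]; last first.
  exists D; split=> // w Hw; apply: HD => -[j Hj]; apply: Hw; exists (c j), (A j); split=> // N.
  by have [n Hn /andP[H1 H2]] := Hj N; exists n.
exists (k j) => n Hn.
apply: (@le_trans _ _ (Ex (fun b : gcode n =>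
   (al ^- n * Zs R xpredT b < c j)%R%:R + (A j)^-1 * energy r b))).
  apply: (le_Ex pge0) => b _.
  have en0 : 0 <= energy r b.
    by apply: sumr_ge0 => i _; rewrite mulr_ge0 ?exprn_ge0 ?(ltW r0) //; apply: sumr_ge0 => u _; apply: sqr_ge0.
  have en1 : 0 <= (A j)^-1 * energy r b by rewrite mulr_ge0 // invr_ge0 ltW.
  case: (ltP _ (c j)) => H1 /=; first by rewrite lerDl.
  rewrite add0r; have [//|H2] /= := leP (energy r b) (A j).
  by rewrite mulrC ler_pdivlMr // mul1r ltW.
rewrite ExD ExZ.
have H1 := Ex_small pge0 tr_tree tr_surj tr_Ex E1 Hn.
have J0 : 0 < j.+1%:R :> R by [].
have B2 : (A j)^-1 * Ex (fun b : gcode n => energy r b) <= 2^-1 * j.+1%:R^-1.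
  apply: (@le_trans _ _ ((A j)^-1 * C)).
    by apply: ler_wpM2l; [rewrite invr_ge0 ltW|exact: HC].
  by rewrite /A invfM mulrAC mulVf ?gt_eqF // mul1r invfM.
have B3 : Ex (fun b : gcode n => (al ^- n * Zs R xpredT b < c j)%R%:R) <= 2^-1 * j.+1%:R^-1.
  exact: le_trans H1 (Hk j).
apply: le_trans (lerD B3 B2) _; move: (j.+1%:R^-1) => x; lra.
Qed.

(** The deterministic part. A sequence of exponents approaching the dimension from both sides
    suffices, because the dimension is an infimum and the energy is monotone in the exponent. *)
Lemma curve_dim w : unif_conv (fun n => Xn T n w) (X w) ->
  (forall i l : nat, forall N, exists2 n, (N <= n)%N &
     Zs R xpredT (tcode T n w) * ((2 ^+ n)^-1) `^ (dim + i.+1%:R^-1) <= l.+1%:R^-1) ->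
  (forall i : nat, exists c A : R, [/\ 0 < c, 0 < A & forall N, exists2 n, (N <= n)%N &
     c <= al ^- n * Zs R xpredT (tcode T n w) /\
     energy (2 `^ (dim - i.+1%:R^-1)) (tcode T n w) <= A]) ->
  hausdorff_dim (X w @` [set t : \bar R | (0 <= t)%E]) = dim%:E.
Proof.
move=> Hc Hup Hlow.
have Hconv : unif_conv (fun n t => LI (sawpath (@gr R n (code w n))) ((al ^+ n)%:E * t)%E) (X w).
  move=> e e0; have [N HN] := Hc e e0; exists N => n Hn t t0.
  by rewrite (tcodeK UST); apply: HN.
have dim0 : 0 < dim.
  by rewrite divr_gt0 ?ln2_gt0 // ln_gt0 //; have /andP[? ?] := alpha_bounds R; lra.
have Htree n := tcode_tree UST n w; have Htrb n := tcode_trb UST n w.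
apply/eqP; rewrite eq_le; apply/andP; split.
  apply/lee_addgt0Pr => e e0; have [i Hi] := inv_succ_le e0.
  have si : 0 <= dim + i.+1%:R^-1 by rewrite addr_ge0 ?ltW // invr_gt0.
  apply: (@le_trans _ _ (dim + i.+1%:R^-1)%:E); last by rewrite -EFinD lee_fin lerD2l.
  apply: ereal_inf_lbound; exists (dim + i.+1%:R^-1) => //; split=> //.
  apply: (curve_null tr_tree tr_surj Htree Htrb Hconv si) => f f0 N.
  have [l Hl] := inv_succ_le f0; have [n Hn Hz] := Hup i l N.
  by exists n => //; apply: le_trans Hz Hl.
apply: le_ereal_inf_tmp => _ [s [s0 Hs] <-]; rewrite lee_fin leNgt; apply/negP => sd.
have [s00|Ns] := eqVneq s 0.
  move: Hs; rewrite s00 => /hausdorff0_empty E.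
  have : (X w @` [set t : \bar R | (0 <= t)%E]) (X w 0%E) by exists 0%E => //=; exact: lexx.
  by rewrite E.
have s1 : 0 < s by rewrite lt_neqAle eq_sym s0 Ns.
have ds : 0 < dim - s by rewrite subr_gt0.
have [i Hi] := inv_succ_le ds.
have [c [A [c0 A0 H]]] := Hlow i.
apply: (curve_positive Htree Hconv s1 c0 A0) Hs => N.
have [n Hn [H1 H2]] := H N; exists n => //; split=> //.
apply: le_trans H2; apply: ler_sum => k _; apply: ler_wpM2r.
  by apply: sumr_ge0 => u _; apply: sqr_ge0.
rewrite lerXn2r ?nnegrE ?powR_ge0 //.
apply: ler_powR; first by rewrite ler1n.
by rewrite lerBrDr addrC -lerBrDr.
Qed.

End Main.

Theorem mainTheorem14 (R : realType) (d : measure_display)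
  (Omega : measurableType d) (P : probability Omega R)
  (T : nat -> Omega -> set (set (pt R))) (X : Omega -> \bar R -> pt R) :
  consistent_UST P T ->
  {ae P, forall w, unif_conv (fun n => Xn T n w) (X w)} ->
  {ae P, forall w, hausdorff_dim (X w @` [set t : \bar R | (0 <= t)%E]) =
                   (ln (alpha R) / ln 2)%:E}.
Proof.
move=> UST HX.
pose s0 : R := ln (alpha R) / ln 2.
(* Only countably many exponents and thresholds occur, so the exceptional null sets can be
   united. *)
have Hup : {ae P, forall w, forall i l : nat, forall N, exists2 n, (N <= n)%N &
     Zs R xpredT (tcode T n w) * ((2 ^+ n)^-1) `^ (s0 + i.+1%:R^-1) <= l.+1%:R^-1}.
  apply: ae_foralln => i; apply: ae_foralln => l; apply: (ae_small_count UST).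
    by rewrite ltrDl invr_gt0.
  by rewrite invr_gt0.
have Hlow : {ae P, forall w, forall i : nat, exists c A : R, [/\ 0 < c, 0 < A & forall N,
     exists2 n, (N <= n)%N & c <= alpha R ^- n * Zs R xpredT (tcode T n w) /\
     energy (2 `^ (s0 - i.+1%:R^-1)) (tcode T n w) <= A]}.
  apply: ae_foralln => i; apply: (ae_large_mass UST).
  by rewrite gtrDl oppr_lt0 invr_gt0.
by apply: filterS3 HX Hup Hlow => w Hc H1 H2; apply: (curve_dim UST Hc H1 H2).
Qed.
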